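(* Let $n\geq 2$ be an integer and let $p>n$ be real. For any real $\lambda$ with $$\lambda_p(\mathbb{R}^n\setminus\{0\})<\lambda<\lambda_p(\mathbb{R}^n_+)$$ there exists a unique $\delta\in(0,1)$ such that $\lambda=\lambda_p(A_{\delta,1})$, where $A_{\delta,1}=\{x\in\mathbb{R}^n:\delta<|x|<1\}$ and $\mathbb{R}^n_+=\{x\in\mathbb{R}^n:x_n>0\}$.
   Context: $\mathcal{D}^{1,p}(\mathbb{R}^n)=\{u\in L^1_{\rm loc}(\mathbb{R}^n): \text{all weak partial derivatives } u_{x_i}\in L^p(\mathbb{R}^n)\}$; since $p>n$, each $u$ is identified with its Hölder continuous representative. For a nonempty open $\Omega\subsetneq\mathbb{R}^n$, $\mathcal{D}^{1,p}_0(\Omega)=\{u\in\mathcal{D}^{1,p}(\mathbb{R}^n): u(x)=0 \text{ for all } x\notin\Omega\}$, with norm $\|Du\|_p$, and $d_\Omega(x)=\inf_{y\in\Omega^c}|x-y|$. For $u\in\mathcal{D}^{1,p}_0(\Omega)\setminus\{0\}$, $\mathcal{R}_p(\Omega,u)=\bigl\|u/d_\Omega^{1-n/p}\bigr\|_\infty^{-p}\,\|Du\|_p^p$ (the supremum norm is taken over $\Omega$), and $\lambda_p(\Omega)=\inf_{u\in\mathcal{D}^{1,p}_0(\Omega)\setminus\{0\}}\mathcal{R}_p(\Omega,u)$. *)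

(* Defs.v *)
From HB Require Import structures.
From mathcomp Require Import all_boot all_order all_algebra.
From mathcomp Require Import all_classical all_reals all_analysis.

Set Implicit Arguments.
Unset Strict Implicit.
Unset Printing Implicit Defensive.

Import Order.TTheory GRing.Theory Num.Theory.
Import numFieldNormedType.Exports.

Local Open Scope classical_set_scope.
Local Open Scope ring_scope.

(* Row vectors carry the sigma-algebra generated by the coordinates; for
   T = R it is the Borel sigma-algebra of R^n. *)
Section measurable_row.
Context {d} {T : measurableType d}.
Variable n : nat.

Let coors : 'I_n -> 'rV[T]_n -> T := fun i x => x ord0 i.

Let row_set0 : g_sigma_preimage coors set0.
Proof. exact: sigma_algebra0. Qed.

Let row_setC A : g_sigma_preimage coors A -> g_sigma_preimage coors (~` A).
Proof. exact: sigma_algebraC. Qed.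

Let row_bigcup (F : _^nat) : (forall i, g_sigma_preimage coors (F i)) ->
  g_sigma_preimage coors (\bigcup_i (F i)).
Proof. exact: sigma_algebra_bigcup. Qed.

HB.instance Definition _ := @isMeasurable.Build (measure_tuple_display d)
  'rV[T]_n (g_sigma_preimage coors) row_set0 row_setC row_bigcup.

End measurable_row.

Lemma measurable_coord d (T : measurableType d) n (i : 'I_n) :
  measurable_fun [set: 'rV[T]_n] (fun x : 'rV[T]_n => x ord0 i).
Proof.
move=> _ Y mY; rewrite setTI; apply: sub_sigma_algebra => /=.
rewrite -bigcup_seq/=; exists i => /=; first by rewrite mem_index_enum.
by exists Y => //; rewrite setTI.
Qed.

Lemma measurable_fun_coord d1 d2 (T1 : measurableType d1)
    (T2 : measurableType d2) n (f : T1 -> 'rV[T2]_n) :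
  (forall i, measurable_fun [set: T1] (fun t => f t ord0 i)) ->
  measurable_fun [set: T1] f.
Proof.
move=> mf.
have H : g_sigma_preimage (fun i : 'I_n => (fun x : 'rV[T2]_n => x ord0 i) \o f)
    `<=` measurable.
  apply: smallest_sub; first exact: sigma_algebra_measurable.
  case: n => [|n] in f mf *; first by rewrite big_ord0.
  rewrite -bigcup_mkord_ord; apply: bigcup_sub => i Ii.
  by move=> A [B mB <-]; exact: mf.
move: H; rewrite g_sigma_preimage_comp => prefS _ A mA.
by apply: prefS; exists A.
Qed.

Section lebesgue_row.
Context {R : realType}.

Definition row_snoc n (z : 'rV[R]_n * measurableTypeR R) : 'rV[R]_n.+1 :=
  \row_i if unlift ord_max i is Some j then z.1 ord0 j else z.2.

Lemma measurable_row_snoc n : measurable_fun setT (@row_snoc n).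
Proof.
apply: measurable_fun_coord => i.
under eq_fun do rewrite mxE.
case: (unlift ord_max i) => [j|].
  exact: (measurableT_comp (measurable_coord j) measurable_fst).
exact: (@measurable_snd _ _ 'rV[R]_n (measurableTypeR R)).
Qed.

HB.instance Definition _ n :=
  isMeasurableFun.Build _ _ _ _ (@row_snoc n) (@measurable_row_snoc n).

Section step.
Context {n : nat} (nu : {measure set 'rV[R]_n -> \bar R}).

(* R^(n+1) is identified with R^n * R. *)
Definition lebesgue_row_step : set 'rV[R]_n.+1 -> \bar R :=
  pushforward (nu \x lebesgue_measure)%E (@row_snoc n).

Let step0 : lebesgue_row_step set0 = 0%E.
Proof. exact: measure0. Qed.

Let step_ge0 A : (0 <= lebesgue_row_step A)%E.
Proof. exact: measure_ge0. Qed.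

Let step_sigma_additive : semi_sigma_additive lebesgue_row_step.
Proof. exact: measure_semi_sigma_additive. Qed.

HB.instance Definition _ := isMeasure.Build _ _ _ lebesgue_row_step
  step0 step_ge0 step_sigma_additive.

End step.

(* n-dimensional Lebesgue measure. *)
Fixpoint lebesgue_row n : {measure set 'rV[R]_n -> \bar R} :=
  if n is m.+1 return {measure set 'rV[R]_n -> \bar R}
  then [the {measure set 'rV[R]_m.+1 -> \bar R} of
         lebesgue_row_step (lebesgue_row m)]
  else [the {measure set 'rV[R]_0 -> \bar R} of
         \d_(0 : 'rV[R]_0) : set 'rV[R]_0 -> \bar R].

End lebesgue_row.

Section sobolev.
Context {R : realType} {n : nat}.
Implicit Types (u v phi f : 'rV[R]_n -> R) (i : 'I_n) (p : R)
  (x y : 'rV[R]_n) (Omega : set 'rV[R]_n).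

Local Notation mu := (@lebesgue_row R n).

(* The norm `|x| of the library on 'rV[R]_n is the sup norm. *)
Definition enorm x : R := Num.sqrt (\sum_i x ord0 i ^+ 2).

Definition partial i f : 'rV[R]_n -> R := fun x => 'D_(delta_mx ord0 i) f x.

Definition smooth f : Prop := forall s : seq 'I_n,
  continuous (foldr partial f s) /\
  forall i x, derivable (foldr partial f s) x (delta_mx ord0 i).

Definition test_function phi : Prop :=
  smooth phi /\ compact (closure [set x | phi x != 0]).

Definition loc_integrable f : Prop :=
  measurable_fun setT f /\
  forall K, compact K -> (\int[mu]_(x in K) `|f x|%:E < +oo)%E.

Definition is_weak_partial i u v : Prop :=
  loc_integrable v /\
  forall phi, test_function phi ->
    \int[mu]_x (u x * partial i phi x) = - \int[mu]_x (v x * phi x).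

(* Some version of the i-th weak derivative, when there is one; versions agree
   almost everywhere. *)
Definition weak_partial i u : 'rV[R]_n -> R :=
  xget (cst 0) [set v | is_weak_partial i u v].

Definition weak_gradient u x : 'rV[R]_n := \row_i weak_partial i u x.

Definition holder_continuous (a : R) u : Prop :=
  exists C : R, forall x y, `|u x - u y| <= C * enorm (x - y) `^ a.

(* Functions rather than classes modulo null sets: for p > n, the last clause
   selects the Hoelder continuous representative given by Morrey's
   inequality. *)
Definition D1p p : set ('rV[R]_n -> R) := [set u |
  [/\ loc_integrable u,
      forall i, exists2 v, is_weak_partial i u v & v \in Lfun mu p%:E
    & holder_continuous (1 - n%:R / p) u]].

Definition D1p0 p Omega : set ('rV[R]_n -> R) :=
  [set u | D1p p u /\ forall x, ~ Omega x -> u x = 0].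

Definition gradient_norm p u : R :=
  fine (Lnorm mu p%:E (fun x => (enorm (weak_gradient u x))%:E)).

Definition bdry_dist Omega x : R := inf [set enorm (x - y) | y in ~` Omega].

Definition weighted_sup p Omega u : R :=
  sup [set `|u x / bdry_dist Omega x `^ (1 - n%:R / p)| | x in Omega].

Definition rayleigh p Omega u : R :=
  weighted_sup p Omega u `^ (- p) * gradient_norm p u `^ p.

Definition lambda_p p Omega : R :=
  inf [set rayleigh p Omega u | u in [set u | D1p0 p Omega u /\ u <> cst 0]].

Definition annulus (a b : R) : set 'rV[R]_n := [set x | a < enorm x < b].

(* The last coordinate is the one of index n - 1. *)
Definition half_space : set 'rV[R]_n :=
  [set x | exists2 i : 'I_n, i.+1 = n & 0 < x ord0 i].

End sobolev.

(* Main.v *)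
(* Write q = p - n > 0, and let kappa be lambda_p of the half-space. By Morrey's
   inequality and scaling, lambda_p(Omega) < m means that some u vanishing off
   Omega, with u(x) = 1, satisfies dist(x, Omega^c)^q ||Du||_p^p < m. Rotating the
   unit ball into a half-space gives (1 - |x|)^q ||Du||_p^p >= kappa for every u
   supported in the ball; hence, for annuli and below kappa, only the distance to
   the inner sphere matters. Call delta good for m if some u vanishing off
   A_(delta,1), with u(x) = 1, satisfies (|x| - delta)^q ||Du||_p^p <= m.

   Clarkson's inequality makes minimizing sequences Cauchy, and a blow-up at the
   inner sphere (whose limit is the half-space) prevents concentration there; so
   goodness passes to limits of delta and m, for m < kappa. Truncation (u - e)^+
   shows that goodness is open in (delta, m), and that some delta is good for
   lambda when lambda > lambda_p(R^n minus a point). If delta' < delta, dilating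
   an optimal u by delta'/delta yields a competitor for A_(delta',1) that vanishes
   near the outer sphere; by the strong maximum principle (comparison with the
   minimizer of a ball) it is not optimal, so lambda_p(A_(delta,1)) is strictly
   increasing below kappa. The required delta is the supremum of the good ones. *)

Require Import Defs.
From HB Require Import structures.
From mathcomp Require Import all_boot all_order all_algebra.
From mathcomp Require Import all_classical all_reals all_analysis.
From mathcomp Require Import measurable_realfun ring lra.

Set Implicit Arguments.
Unset Strict Implicit.
Unset Printing Implicit Defensive.

Import Order.TTheory GRing.Theory Num.Theory.
Import numFieldNormedType.Exports.

Local Open Scope classical_set_scope.
Local Open Scope ring_scope.

(** * Lebesgue measure on row vectors *)

Section lebesgue_row_theory.
Context {R : realType}.

(** The Rayleigh quotient is split into point problems: minimize the energy of a weak gradient among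
    functions with u(x) = 1. The supremum in the quotient need not be attained, so [lambda_p] is
    handled through strict inequalities; attainment is recovered only for annuli, below
    [half_energy]. Measuring |x| - d instead of the distance to the boundary matters for
    monotonicity: that quantity does not change when a dilated competitor is regarded in an annulus
    with a larger outer radius. No Euler-Lagrange equation and no regularity theory enter. The
    maximum principle comes from the energies of a maximum and a minimum together with uniqueness of
    minimizers. Pointwise control comes from Morrey's inequality, which is derived by testing
    against products of one-variable functions, so that neither polar coordinates nor averages over
    balls are needed. Weak derivatives of |u| are obtained from difference quotients, through an
    exact discrete chain rule. *)

Definition obox n (a b : 'rV[R]_n) : set 'rV[R]_n :=
  [set x | forall i, a ord0 i < x ord0 i <= b ord0 i].

Lemma measurable_coord_cond n (P : 'I_n -> set R) :
  (forall i, measurable (P i)) ->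
  measurable [set x : 'rV[R]_n | forall i, P i (x ord0 i)].
Proof.
move=> mP; rewrite (_ : mkset _ = \bigcap_(i in [set: 'I_n])
   ((fun x : 'rV[R]_n => x ord0 i) @^-1` P i)); last first.
  by apply/seteqP; split => [x Px i _|x Px i]; [exact: Px|exact: (Px i)].
apply: fin_bigcap_measurable; first exact: finite_finset.
move=> i _; rewrite -[X in measurable X]setTI.
exact: (measurable_coord i measurableT (mP i)).
Qed.

Lemma measurable_obox n (a b : 'rV[R]_n) : measurable (obox a b).
Proof.
apply: (measurable_coord_cond (P := fun i => [set t | a ord0 i < t <= b ord0 i])).
by move=> i; rewrite -set_itvoc.
Qed.

Lemma coord_ler_norm n (x : 'rV[R]_n) i : `|x ord0 i| <= `|x|.
Proof.
rewrite [leRHS]/Num.Def.normr /= mx_normrE; apply/bigmax_geP; right => /=.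
by exists (ord0, i).
Qed.

Lemma row_norm_lt n (x : 'rV[R]_n) e : 0 < e ->
  (forall i, `|x ord0 i| < e) -> `|x| < e.
Proof.
move=> e0 xe; rewrite [ltLHS]/Num.Def.normr /= mx_normrE.
by apply/bigmax_ltP; split => // -[i j] _ /=; rewrite ord1.
Qed.

Lemma row_norm_le n (x : 'rV[R]_n) e : 0 <= e ->
  (forall i, `|x ord0 i| <= e) -> `|x| <= e.
Proof.
move=> e0 xe; rewrite [leLHS]/Num.Def.normr /= mx_normrE.
by apply/bigmax_leP; split => // -[i j] _ /=; rewrite ord1.
Qed.

(** The sigma-algebra is generated by coordinates and the topology by the sup norm. They are
    reconciled by writing an open set as the union of the countably many cubes with rational centre
    and radius 1/(k+1) that it contains. *)
Lemma open_measurable_row n (A : set 'rV[R]_n) : open A -> measurable A.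
Proof.
move=> oA.
pose D (q : 'rV[rat]_n * nat) : set 'rV[R]_n :=
  [set x | forall i, `|x ord0 i - ratr (q.1 ord0 i)| < q.2.+1%:R^-1].
pose F q := if `[< D q `<=` A >] then D q else set0.
have -> : A = \bigcup_q F q.
  apply/seteqP; split => [x Ax|x [q _]]; last first.
    by rewrite /F; case: asboolP => // DA /DA.
  have /nbhs_ballP[e /= e0 xA] : nbhs x A by exact: open_nbhs_nbhs.
  have [k ke] : exists k, k.+1%:R^-1 < e / 2.
    have e20 : 0 < e / 2 by rewrite divr_gt0.
    have [k _ /(_ _ (leqnn k))/= h] :=
      near_infty_natSinv_lt (PosNum e20).
    by exists k.
  have /all_sig[q qP] : forall i, {q : rat | `|x ord0 i - ratr q| < k.+1%:R^-1}.
    move=> i; apply: cid.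
    have [|q] := @rat_in_itvoo R (x ord0 i - k.+1%:R^-1) (x ord0 i + k.+1%:R^-1).
      by rewrite ltrBlDr -addrA ltrDl addr_gt0// invr_gt0.
    rewrite in_itv/= => /andP[q1 q2]; exists q.
    move: (ratr q) (k.+1%:R^-1) q1 q2 => Q z q1 q2.
    by rewrite ltr_norml; apply/andP; split; lra.
  exists (\row_i q i, k) => //; rewrite /F; case: asboolP => [_|].
    by move=> i/=; rewrite mxE.
  case=> y Dy; apply: xA; rewrite -ball_normE /=.
  apply: row_norm_lt => // i; rewrite !mxE.
  have := Dy i; have := qP i; rewrite /= mxE => h1 h2.
  have -> : x ord0 i - y ord0 i =
    (x ord0 i - ratr (q i)) - (y ord0 i - ratr (q i)) by ring.
  rewrite (le_lt_trans (ler_normB _ _))//.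
  move: `|_| `|_| (k.+1%:R^-1) h1 h2 ke => ? ? ? *; lra.
apply: countable_bigcupT_measurable; first exact: countableP.
move=> q; rewrite /F; case: asboolP => // _.
apply: (measurable_coord_cond
  (P := fun i => [set t : R | `|t - ratr (q.1 ord0 i)| < q.2.+1%:R^-1])).
move=> i; rewrite (_ : mkset _ = ball (ratr (q.1 ord0 i) : R) q.2.+1%:R^-1).
  by rewrite ball_itv; exact: measurable_itv.
by rewrite -ball_normE; apply/seteqP; split => t /=; rewrite distrC.
Qed.

Lemma closed_measurable_row n (A : set 'rV[R]_n) : closed A -> measurable A.
Proof.
move=> cA; rewrite -[A]setCK; apply: measurableC; apply: open_measurable_row.
exact: closed_openC.
Qed.

Lemma continuous_measurable_row n (f : 'rV[R]_n -> R) :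
  continuous f -> measurable_fun setT f.
Proof.
move=> cf; apply: (measurability _ (RGenOInfty.measurableE R)) => _ [_ [x ->]] <-.
rewrite setTI; apply: open_measurable_row.
by apply: open_comp => [? _|]; [exact: cf|exact: interval_open].
Qed.

Lemma obox_row_snoc n (a b : 'rV[R]_n.+1) :
  @row_snoc R n @^-1` obox a b =
  obox (\row_j a ord0 (lift ord_max j)) (\row_j b ord0 (lift ord_max j)) `*`
  `]a ord0 ord_max, b ord0 ord_max]%classic.
Proof.
apply/seteqP; split => [[x t] /= h|[x t] /= [h]].
  split; last by have := h ord_max; rewrite /row_snoc mxE unlift_none /= in_itv.
  by move=> j; have := h (lift ord_max j); rewrite /row_snoc !mxE liftK.
rewrite in_itv/= => ht i; rewrite /row_snoc mxE.
by case: unliftP => [j ->|->] //=; have := h j; rewrite !mxE.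
Qed.

Lemma lebesgue_row_obox n (a b : 'rV[R]_n) :
  (forall i, a ord0 i <= b ord0 i) ->
  lebesgue_row n (obox a b) = (\prod_i (b ord0 i - a ord0 i))%:E.
Proof.
elim: n a b => [|n IH] a b ab.
  rewrite /= big_ord0 diracE mem_set// => -[].
  done.
rewrite /= /lebesgue_row_step /pushforward obox_row_snoc.
rewrite product_measure1E//; last exact: measurable_obox.
rewrite IH; last by move=> i; rewrite !mxE.
rewrite (bigD1_ord ord_max)//= mulrC EFinM; congr (_ * _)%E.
  by congr (_%:E); apply: eq_bigr => i _; rewrite !mxE.
rewrite [LHS]lebesgue_measure_itv/= lte_fin.
case: ltP => // h; rewrite (@le_anti _ _ (a ord0 ord_max) (b ord0 ord_max)) ?subrr//.
by rewrite ab h.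
Qed.

Definition cube n (k : nat) : set 'rV[R]_n :=
  obox (const_mx (- k%:R)) (const_mx k%:R).
Arguments cube : clear implicits.

Lemma cube_cover n : \bigcup_k cube n k = setT.
Proof.
apply/seteqP; split => // x _.
have [k _ /(_ _ (leqnn k)) /= h] := nbhs_infty_gtr `|x|.
exists k => //= i; rewrite !mxE.
have /ler_normlP [h1 h2] := coord_ler_norm x i; lra.
Qed.

Lemma lebesgue_cube_lty n k : (lebesgue_row n (cube n k) < +oo)%E.
Proof.
rewrite /cube lebesgue_row_obox ?ltry// => i; rewrite !mxE.
by rewrite (@le_trans _ _ 0)// oppr_le0.
Qed.

Lemma lebesgue_row_sigma_finite n : sigma_finite setT (lebesgue_row (R:=R) n).
Proof.
exists (cube n); first by rewrite cube_cover.
by move=> k; split; [exact: measurable_obox|exact: lebesgue_cube_lty].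
Qed.

(** The same measure under a name that carries a sigma-finite instance, as Tonelli's theorem
    requires. *)
Definition lebr n : set 'rV[R]_n -> \bar R := lebesgue_row n.
Arguments lebr : clear implicits.
HB.instance Definition _ n := Measure.copy (lebr n) (lebesgue_row n).
HB.instance Definition _ n :=
  Measure_isSigmaFinite.Build _ _ _ (lebr n) (lebesgue_row_sigma_finite n).

Definition oboxes n : set (set 'rV[R]_n) :=
  [set A | exists a b : 'rV[R]_n, (forall i, a ord0 i <= b ord0 i) /\ A = obox a b].

Lemma oboxes_setI n : setI_closed (@oboxes n).
Proof.
move=> _ _ [a [b [ab ->]]] [c [d [cd ->]]].
pose l := \row_i Num.max (a ord0 i) (c ord0 i).
(* The maximum with [l] keeps the end points ordered when the two boxes are disjoint; the resulting
   box is then empty. *)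
pose u := \row_i Num.max (l ord0 i) (Num.min (b ord0 i) (d ord0 i)).
exists l, u; split => [i|]; first by rewrite [leRHS]mxE le_max lexx.
apply/seteqP; split => [x [xab xcd] i|x xlu].
  rewrite !mxE gt_max le_max le_min.
  by have /andP[-> ->] := xab i; have /andP[-> ->] := xcd i; rewrite orbT.
have {}xlu i : a ord0 i < x ord0 i <= b ord0 i /\ c ord0 i < x ord0 i <= d ord0 i.
  have := xlu i; rewrite !mxE gt_max !le_max le_min.
  move=> /andP[/andP[-> ->]] /orP[/orP[]|/andP[-> ->]]//.
    by rewrite leNgt; have := xlu i; rewrite !mxE gt_max => /andP[/andP[-> _] _].
  by rewrite leNgt; have := xlu i; rewrite !mxE gt_max => /andP[/andP[_ ->] _].
by split => i; have [] := xlu i.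
Qed.

(** A set where one coordinate exceeds a given number is a countable union of boxes. *)
Lemma measurable_oboxes n : @measurable _ 'rV[R]_n = <<s @oboxes n >>.
Proof.
apply/seteqP; split; last first.
  apply: smallest_sub; first exact: sigma_algebra_measurable.
  by move=> _ [a [b [_ ->]]]; exact: measurable_obox.
apply: smallest_sub; first exact: smallest_sigma_algebra.
rewrite -bigcup_seq; apply: bigcup_sub => i _ _ [B mB <-]; rewrite setTI.
pose T := g_sigma_algebraType (@oboxes n).
suff : measurable_fun setT (fun x : T => (x : 'rV[R]_n) ord0 i).
  by move=> /(_ measurableT B mB); rewrite setTI.
apply: (measurability _ (RGenOInfty.measurableE R)) => _ [_ [x ->]] <-.
rewrite setTI.
rewrite (_ : _ @^-1` _ = \bigcup_k obox (\row_j if j == i then x else - k%:R)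
   (\row_j if j == i then Num.max x k%:R else k%:R)); last first.
  apply/seteqP; split => [y /=|y [k _]]; last first.
    by move=> /(_ i); rewrite !mxE eqxx => /andP[]; rewrite /= in_itv/= andbT.
  rewrite in_itv/= andbT => xy.
  have [k _ /(_ _ (leqnn k)) /= h] := nbhs_infty_gtr `|y|.
  exists k => //= j; rewrite !mxE.
  have /ler_normlP [h1 h2] := coord_ler_norm y j.
  case: eqP => [ji|_].
    by rewrite ji in h1 h2 *; rewrite xy/= le_max (le_trans h2 (ltW h)) orbT.
  by rewrite ltrNl (le_lt_trans h1 h)//= (le_trans h2 (ltW h)).
apply: bigcupT_measurable => k; apply: sub_sigma_algebra.
exists (\row_j if j == i then x else - k%:R), (\row_j if j == i then Num.max x k%:R else k%:R).
split=> // j; rewrite !mxE; case: eqP => _; first by rewrite le_max lexx.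
by rewrite (@le_trans _ _ 0)// oppr_le0.
Qed.

Lemma cube_oboxes n k : @oboxes n (cube n k).
Proof.
exists (const_mx (- k%:R)), (const_mx k%:R); split => // i; rewrite !mxE.
by rewrite (@le_trans _ _ 0)// oppr_le0.
Qed.

(** Boxes form a generating class closed under intersection, and cubes of finite measure exhaust the
    space. *)
Lemma measure_obox_unique n (m1 m2 : {measure set 'rV[R]_n -> \bar R}) :
  (forall a b : 'rV[R]_n, (forall i, a ord0 i <= b ord0 i) ->
     m1 (obox a b) = m2 (obox a b)) ->
  (forall k, (m1 (cube n k) < +oo)%E) ->
  forall A, measurable A -> m1 A = m2 A.
Proof.
move=> m12 m1oo; apply: (measure_unique (@oboxes n) (cube n)) => //.
- exact: measurable_oboxes.
- exact: oboxes_setI.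
- exact: cube_oboxes.
- exact: cube_cover.
- by move=> _ [a [b [ab ->]]]; exact: m12.
Qed.

End lebesgue_row_theory.
Arguments cube {R} n k.
Arguments lebr {R} n.

Lemma continuous_rowP {R : realType} {n} (V : normedModType R) (f : 'rV[R]_n -> V) :
  continuous f <-> forall x e, 0 < e -> exists d, 0 < d /\
    forall y, `|x - y| < d -> `|f x - f y| < e.
Proof.
split=> [cf x e e0|h x].
  have /cvgrPdist_lt /(_ e e0) /nbhs_ballP [d d0 hd] := cf x.
  by exists d; split => // y xy; apply: hd; rewrite -ball_normE.
apply/(@cvgrPdist_lt _ _ _ (nbhs x) (nbhs_filter (x : 'rV[R]_n))) => e.
move=> /(h x) [d [d0 hd]]; apply/nbhs_ballP; exists d => // y.
by rewrite -ball_normE /=; exact: hd.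
Qed.

Lemma continuous_row_comp {R : realType} {n m} (T : 'rV[R]_n -> 'rV[R]_m)
    (f : 'rV[R]_m -> R) :
  continuous T -> continuous f -> continuous (fun x => f (T x)).
Proof. move=> cT cf x; exact: (@continuous_comp _ _ _ T f x (cT x) (cf (T x))). Qed.

Lemma continuous_coord {R : realType} {n} (i : 'I_n) :
  continuous (fun x : 'rV[R]_n => x ord0 i).
Proof. by move=> x; exact: coord_continuous. Qed.

(** * Euclidean inner product and norm *)

Section euclid.
Context {R : realType} {n : nat}.
Implicit Types x y z : 'rV[R]_n.

Definition dot x y : R := \sum_i x ord0 i * y ord0 i.

Lemma dotC x y : dot x y = dot y x.
Proof. by apply: eq_bigr => i _; rewrite mulrC. Qed.

Lemma dotDl x y z : dot (x + y) z = dot x z + dot y z.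
Proof. by rewrite -big_split; apply: eq_bigr => i _; rewrite mxE mulrDl. Qed.

Lemma dotZl a x y : dot (a *: x) y = a * dot x y.
Proof. by rewrite /dot mulr_sumr; apply: eq_bigr => i _; rewrite mxE mulrA. Qed.

Lemma dotDr x y z : dot x (y + z) = dot x y + dot x z.
Proof. by rewrite dotC dotDl !(dotC x). Qed.

Lemma dotZr a x y : dot x (a *: y) = a * dot x y.
Proof. by rewrite dotC dotZl dotC. Qed.

Lemma dotNl x y : dot (- x) y = - dot x y.
Proof. by rewrite -scaleN1r dotZl mulN1r. Qed.

Lemma dotNr x y : dot x (- y) = - dot x y.
Proof. by rewrite dotC dotNl dotC. Qed.

Lemma dot0l x : dot 0 x = 0.
Proof. by rewrite -(scale0r 0) dotZl mul0r. Qed.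

Lemma dot_ge0 x : 0 <= dot x x.
Proof. by apply: sumr_ge0 => i _; rewrite -expr2 sqr_ge0. Qed.

Lemma enormE x : enorm x = Num.sqrt (dot x x).
Proof. by congr Num.sqrt; apply: eq_bigr => i _; rewrite expr2. Qed.

Lemma enorm_ge0 x : 0 <= enorm x. Proof. exact: sqrtr_ge0. Qed.

Lemma sqr_enorm x : enorm x ^+ 2 = dot x x.
Proof. by rewrite enormE sqr_sqrtr// dot_ge0. Qed.

Lemma enorm_le x a : 0 <= a -> (enorm x <= a) = (dot x x <= a ^+ 2).
Proof. by move=> a0; rewrite -sqr_enorm ler_sqr ?nnegrE// enorm_ge0. Qed.

Lemma enorm0 : enorm (0 : 'rV[R]_n) = 0.
Proof. by rewrite enormE dot0l sqrtr0. Qed.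

Lemma coord_le_enorm x i : `|x ord0 i| <= enorm x.
Proof.
rewrite -sqrtr_sqr; apply: ler_wsqrtr; rewrite (bigD1 i)//= lerDl.
by apply: sumr_ge0 => j _; rewrite sqr_ge0.
Qed.

Lemma norm_le_enorm x : `|x| <= enorm x.
Proof. by apply: row_norm_le => [|i]; [exact: enorm_ge0|exact: coord_le_enorm]. Qed.

Lemma enorm_le_norm x : enorm x <= n%:R * `|x|.
Proof.
rewrite enorm_le ?mulr_ge0//; apply: (@le_trans _ _ (\sum_(i < n) `|x| ^+ 2)).
  apply: ler_sum => i _; rewrite -expr2 -[leLHS]real_normK ?num_real//.
  by rewrite ler_sqr ?nnegrE// coord_ler_norm.
rewrite sumr_const card_ord -[leLHS]mulr_natl exprMn ler_wpM2r ?exprn_ge0//.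
by rewrite -natrX ler_nat; case: (n) => // k; rewrite expnS leq_pmulr// expn1.
Qed.

Lemma enorm_eq0 x : enorm x = 0 -> x = 0.
Proof.
by move=> x0; apply/normr0_eq0/eqP; rewrite eq_le normr_ge0 andbT -x0 norm_le_enorm.
Qed.

Lemma enorm_gt0 x : x != 0 -> 0 < enorm x.
Proof.
by rewrite lt0r enorm_ge0 andbT; apply: contra => /eqP/enorm_eq0 ->.
Qed.

Lemma enormZ a x : enorm (a *: x) = `|a| * enorm x.
Proof.
by rewrite !enormE dotZl dotZr mulrA -expr2 sqrtrM ?sqr_ge0// sqrtr_sqr.
Qed.

Lemma enormN x : enorm (- x) = enorm x.
Proof. by rewrite !enormE dotNl dotNr opprK. Qed.

Lemma enormB x y : enorm (x - y) = enorm (y - x).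
Proof. by rewrite -enormN opprB. Qed.

(** Cauchy-Schwarz: expand the square of |y| x - |x| y and divide by |x| |y|. *)
Lemma dot_le x y : dot x y <= enorm x * enorm y.
Proof.
have [->|x0] := eqVneq x 0; first by rewrite dot0l enorm0 mul0r.
have [->|y0] := eqVneq y 0; first by rewrite dotC dot0l enorm0 mulr0.
have a0 := enorm_gt0 x0; have b0 := enorm_gt0 y0.
set a := enorm x in a0 *; set b := enorm y in b0 *.
have := dot_ge0 (b *: x - a *: y).
rewrite !(dotDl, dotDr, dotNl, dotNr, dotZl, dotZr) -!sqr_enorm -/a -/b (dotC y x).
move: (dot x y) => d h.
have : 0 <= (a * b) * (a * b - d) by nra.
by rewrite pmulr_rge0 ?mulr_gt0// subr_ge0.
Qed.

Lemma enormD x y : enorm (x + y) <= enorm x + enorm y.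
Proof.
rewrite enorm_le ?addr_ge0 ?enorm_ge0// !(dotDl, dotDr) (dotC y x) -!sqr_enorm.
have := dot_le x y; nra.
Qed.

Lemma enorm_subl x y : enorm x - enorm y <= enorm (x - y).
Proof. by rewrite lerBlDr -{1}(subrK y x) enormD. Qed.

Lemma dist_enorm x y : `|enorm x - enorm y| <= enorm (x - y).
Proof. by rewrite ler_norml lerNl opprB [in X in X && _]enormB !enorm_subl. Qed.

Lemma continuous_enorm : continuous (@enorm R n).
Proof.
apply/continuous_rowP => x e e0; exists (e / n.+1%:R).
split=> [|y]; first by rewrite divr_gt0.
rewrite ltr_pdivlMr// => h.
rewrite (le_lt_trans (dist_enorm _ _))// (le_lt_trans (enorm_le_norm _))//.
by rewrite mulrC (le_lt_trans _ h)// ler_wpM2l ?ler_nat.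
Qed.

End euclid.

(** * Affine maps acting on row vectors *)

Section affine.
Context {R : realType} {n : nat}.
Implicit Types (x y a : 'rV[R]_n) (M : 'M[R]_n).

Definition aff a M x : 'rV[R]_n := a + x *m M.

Lemma continuous_aff a M : continuous (aff a M).
Proof.
apply/continuous_rowP => x e e0; exists (e / (n.+1%:R * (`|M| + 1))).
have M1 : 0 < n.+1%:R * (`|M| + 1) by rewrite mulr_gt0// ltr_wpDl.
split=> [|y]; first by rewrite divr_gt0.
rewrite ltr_pdivlMr// => h; rewrite /aff opprD addrACA subrr add0r -mulmxBl.
apply: row_norm_lt => // i; rewrite mxE.
rewrite (@le_lt_trans _ _ (\sum_(j < n) `|x - y| * `|M|))//.
  rewrite (le_trans (ler_norm_sum _ _ _))//; apply: ler_sum => j _.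
  rewrite normrM ler_pM//; first exact: coord_ler_norm.
  rewrite [leRHS]/Num.Def.normr /= mx_normrE; apply/bigmax_geP; right => /=.
  by exists (j, i).
rewrite sumr_const card_ord -[ltLHS]mulr_natl (le_lt_trans _ h)// mulrCA.
rewrite ler_wpM2l//; apply: ler_pM => //; first by rewrite ler_nat.
by rewrite lerDl.
Qed.

Lemma measurable_aff a M : measurable_fun setT (aff a M).
Proof.
apply: measurable_fun_coord => i; apply: continuous_measurable_row.
exact: (@continuous_row_comp R n n (aff a M) (fun v => v ord0 i)
  (@continuous_aff a M) (@continuous_coord R n i)).
Qed.

HB.instance Definition _ a M :=
  isMeasurableFun.Build _ _ _ _ (aff a M) (measurable_aff a M).

Lemma dot_mulmx s M x y : M *m M^T = (s ^+ 2)%:M ->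
  dot (x *m M) (y *m M) = s ^+ 2 * dot x y.
Proof.
have dotE u v : dot u v = (u *m v^T) ord0 ord0.
  by rewrite mxE; apply: eq_bigr => i _; rewrite mxE.
move=> MM; rewrite !dotE trmx_mul mulmxA -(mulmxA x) MM.
by rewrite mul_mx_scalar -scalemxAl mxE.
Qed.

Lemma enorm_mulmx s M x : 0 <= s -> M *m M^T = (s ^+ 2)%:M ->
  enorm (x *m M) = s * enorm x.
Proof.
by move=> s0 /dot_mulmx h; rewrite !enormE h sqrtrM ?sqr_ge0// sqrtr_sqr ger0_norm.
Qed.

End affine.

(** The proof of sigma-finiteness is an argument of the copy, so that an instance can be declared on
    it. *)
Definition sigma_finite_copy d (T : measurableType d) (R : realType) (nu : {measure set T -> \bar R})
  (h : sigma_finite setT nu) : set T -> \bar R := nu.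
Section sigma_finite_copy.
Context d (T : measurableType d) (R : realType) (nu : {measure set T -> \bar R})
  (h : sigma_finite setT nu).
HB.instance Definition _ := Measure.copy (sigma_finite_copy h) nu.
HB.instance Definition _ := Measure_isSigmaFinite.Build _ _ _ (sigma_finite_copy h) h.
End sigma_finite_copy.
Lemma sigma_finite_measure_ex d (T : measurableType d) (R : realType) (nu : {measure set T -> \bar R}) :
  sigma_finite setT nu -> exists sm : {sigma_finite_measure set T -> \bar R}, forall B, sm B = nu B.
Proof.
move=> h. by exists (sigma_finite_copy h).
Qed.

(** * Lebesgue measure under dilations and orthogonal maps *)

Section haar.
Context {R : realType} {n : nat}.
Local Notation mu := (@lebesgue_row R n).
Implicit Types (x y a : 'rV[R]_n) (M : 'M[R]_n) (A : set 'rV[R]_n).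

Lemma lebesgue_dilate a (s : R) A : 0 < s -> measurable A ->
  mu (aff a s%:M @^-1` A) = ((s ^- n)%:E * mu A)%E.
Proof.
move=> s0 mA.
have sn : 0 <= s ^- n by rewrite invr_ge0 exprn_ge0// ltW.
have box (c d : 'rV[R]_n) : (forall i, c ord0 i <= d ord0 i) ->
    mu (aff a s%:M @^-1` obox c d) = ((s ^- n)%:E * mu (obox c d))%E.
  move=> cd.
  have -> : aff a s%:M @^-1` obox c d = obox (s^-1 *: (c - a)) (s^-1 *: (d - a)).
    apply/seteqP; split => x /= h i; have := h i;
      rewrite /aff mul_mx_scalar !mxE => /andP[h1 h2].
      by rewrite ltr_pdivrMl// ler_pdivlMl// ltrBlDl h1 lerBrDl h2.
    move: h1 h2; rewrite ltr_pdivrMl// ler_pdivlMl// ltrBlDl lerBrDl.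
    by move=> -> ->.
  rewrite !lebesgue_row_obox//; last first.
    by move=> i; rewrite !mxE ler_pM2l ?invr_gt0// lerD2r.
  rewrite -EFinM; congr (_%:E).
  have -> : s ^- n = \prod_(i < n) s^-1 by rewrite prodr_const card_ord exprVn.
  by rewrite -big_split/=; apply: eq_bigr => i _; rewrite !mxE; ring.
have := @measure_obox_unique R n (pushforward mu (aff a s%:M))
  (mscale (NngNum sn) mu).
rewrite /pushforward /= /mscale/=; apply => //.
move=> k; rewrite /pushforward /cube box; first by rewrite lte_mul_pinfty// lebesgue_cube_lty.
by move=> i; rewrite !mxE (@le_trans _ _ 0)// oppr_le0.
Qed.

Lemma lebesgue_translate a A : measurable A -> mu (aff a 1%:M @^-1` A) = mu A.
Proof. by move=> mA; rewrite lebesgue_dilate// expr1n invr1 mul1e. Qed.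

Definition eball r : set 'rV[R]_n := [set x | enorm x < r].
Arguments eball r%_R.

Lemma measurable_eball r : measurable (eball r).
Proof.
apply: open_measurable_row; rewrite (_ : eball r = @enorm R n @^-1` [set t | t < r])//.
apply: open_comp => [x _|]; first exact: continuous_enorm.
by rewrite (_ : mkset _ = `]-oo, r[%classic); [exact: interval_open|rewrite set_itvNyo].
Qed.

Lemma lebesgue_eball_lty r : (mu (eball r) < +oo)%E.
Proof.
have [k _ /(_ _ (leqnn k)) /= h] := nbhs_infty_gtr r.
apply: le_lt_trans (lebesgue_cube_lty n k).
apply: le_measure; rewrite ?inE; [exact: measurable_eball|exact: measurable_obox|].
move=> x /= xr i; rewrite !mxE.
have /ler_normlP [h1 h2] := coord_le_enorm x i.
by rewrite ltrNl (le_lt_trans h1 (lt_trans xr h))/= (le_trans h2 (ltW (lt_trans xr h))).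
Qed.

Lemma lebesgue_eball_gt0 : (0 < mu (eball 1))%E.
Proof.
pose c : R := (n.+1%:R)^-1.
have c0 : 0 < c by rewrite invr_gt0.
apply: (@lt_le_trans _ _ (mu (obox (const_mx (- (c / 2))) (const_mx (c / 2))))).
  rewrite lebesgue_row_obox; last by move=> i; rewrite !mxE; lra.
  by rewrite lte_fin; apply: prodr_gt0 => i _; rewrite !mxE; lra.
apply: le_measure; rewrite ?inE; [exact: measurable_obox|exact: measurable_eball|].
move=> x xc /=; apply: le_lt_trans (enorm_le_norm x) _.
apply: (@le_lt_trans _ _ (n.+1%:R * (c / 2))).
  apply: ler_pM => //; first by rewrite ler_nat.
  apply: row_norm_le; first by rewrite divr_ge0// ltW.
  by move=> i; have := xc i; rewrite !mxE ler_norml => /andP[/ltW -> ->].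
by rewrite mulrA divff// mul1r; lra.
Qed.

Lemma image_measure_ex (f : 'rV[R]_n -> 'rV[R]_n) : measurable_fun setT f ->
  exists nu : {measure set 'rV[R]_n -> \bar R}, forall B, nu B = mu (f @^-1` B).
Proof.
move=> mf.
by unshelve refine (ex_intro _ (pushforward mu f : {measure set _ -> \bar R}) _).
Qed.

(** Uniqueness of Haar measure, without determinants: the image measure is translation invariant,
    hence proportional to [mu], and the factor is 1 because the Euclidean unit ball is invariant and
    has positive finite measure. *)
Lemma lebesgue_orthogonal M A : M *m M^T = 1%:M -> measurable A ->
  mu (aff 0 M @^-1` A) = mu A.
Proof.
move=> MM mA.
have M2 : M *m M^T = (1 ^+ 2)%:M by rewrite expr1n.
have MN : M^T *m M = 1%:M by rewrite (mulmx1C MM).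
have [nu nuE] := image_measure_ex (measurable_aff 0 M).
have nuU : nu (eball 1) = mu (eball 1).
  rewrite nuE; congr (mu _); apply/seteqP.
  by split => x; rewrite /eball /= /aff add0r (enorm_mulmx _ _ M2)// mul1r.
have nut (a : 'rV[R]_n) B : measurable B -> nu (aff a 1%:M @^-1` B) = nu B.
  move=> mB; rewrite !nuE.
  rewrite -[RHS](lebesgue_translate (a *m M^T)).
    congr (mu _); apply/seteqP; split => x;
    by rewrite /= /aff !mulmx1 !add0r mulmxDl -mulmxA MN mulmx1.
  by rewrite -[X in measurable X]setTI; exact: measurable_aff.
have nusf : sigma_finite setT nu.
  exists (fun k => eball k%:R).
    apply/seteqP; split => // x _.
    have [k _ /(_ _ (leqnn k)) /= h] := nbhs_infty_gtr (enorm x).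
    by exists k.
  move=> k; split; first exact: measurable_eball.
  rewrite nuE (_ : _ @^-1` _ = eball k%:R).
    exact: lebesgue_eball_lty.
  by apply/seteqP; split => x; rewrite /eball /= /aff add0r (enorm_mulmx _ _ M2)// mul1r.
have [sm smE] := sigma_finite_measure_ex nusf.
pose U := eball 1.
have mU : measurable U := measurable_eball 1.
have mpre (B : set 'rV[R]_n) (f : 'rV[R]_n * 'rV[R]_n -> 'rV[R]_n) : measurable B ->
    measurable_fun setT f -> measurable (f @^-1` B).
  by move=> mB mf; rewrite -[X in measurable X]setTI; exact: mf.
have mcomb (c : R) : measurable_fun setT
    (fun z : 'rV[R]_n * 'rV[R]_n => z.1 + c *: z.2).
  apply: measurable_fun_coord => i.
  under eq_fun do rewrite !mxE.
  apply: measurable_funD; first exact: (measurableT_comp (measurable_coord i) measurable_fst).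
  apply: measurable_funM => //.
  exact: (measurableT_comp (measurable_coord i) measurable_snd).
have swap (S : set ('rV[R]_n * 'rV[R]_n)) : measurable S ->
    (\int[lebr n]_x sm (xsection S x) = \int[sm]_y lebr n (ysection S y))%E.
  move=> mS; have := @indic_fubini_tonelli _ _ _ _ R (lebr n) sm S mS.
  by rewrite indic_fubini_tonelli_FE// indic_fubini_tonelli_GE.
have intc (V : set 'rV[R]_n) (c : \bar R) : measurable V -> (0 <= c)%E ->
    (\int[lebr n]_x (if x \in V then c else 0) = mu V * c)%E.
  move=> mV c0; transitivity (\int[lebr n]_(x in V) cst c x)%E.
    by rewrite [RHS]integral_mkcond; apply: eq_integral => x _; rewrite patchE.
  by rewrite integral_cst// muleC.
(* Tonelli for the indicators of [U x, A (x + y)] and [A x, U (x - y)], which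
   are related by the translation invariance of the first measure. *)
pose S1 : set ('rV[R]_n * 'rV[R]_n) := [set z | U z.1 /\ A (z.1 + z.2)].
pose S2 : set ('rV[R]_n * 'rV[R]_n) := [set z | A z.1 /\ U (z.1 - z.2)].
have key : (mu U * nu A = mu A * nu U)%E.
  have mS1 : measurable S1.
    apply: measurableI; first exact: (mpre U fst mU measurable_fst).
    move: (mpre _ _ mA (mcomb 1)).
    rewrite (_ : _ @^-1` _ = [set z | A (z.1 + z.2)])//.
    by apply/seteqP; split => z /=; rewrite scale1r.
  have mS2 : measurable S2.
    apply: measurableI; first exact: (mpre A fst mA measurable_fst).
    move: (mpre _ _ mU (mcomb (-1))).
    rewrite (_ : _ @^-1` _ = [set z | U (z.1 - z.2)])//.
    by apply/seteqP; split => z /=; rewrite scaleN1r.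
  transitivity (\int[lebr n]_x sm (xsection S1 x))%E.
    rewrite -intc//; apply: eq_integral => x _; rewrite smE.
    case: ifPn => [|/negP]; rewrite inE => xU.
      rewrite -(nut x A mA); congr (nu _); apply/seteqP; split => y;
        rewrite /xsection /= /aff mulmx1 inE //=.
      by case.
    rewrite (_ : xsection _ _ = set0) ?measure0// -subset0 => y.
    by rewrite /xsection /= inE => -[].
  transitivity (\int[lebr n]_x sm (xsection S2 x))%E; last first.
    rewrite -intc//; apply: eq_integral => x _; rewrite smE.
    case: ifPn => [|/negP]; rewrite inE => xA.
      rewrite -(nut (- x) U mU); congr (nu _); apply/seteqP; split => y;
        rewrite /xsection /= /aff mulmx1 inE /U /eball /= addrC enormB //.
      by case.
    rewrite (_ : xsection _ _ = set0) ?measure0// -subset0 => y.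
    by rewrite /xsection /= inE => -[].
  rewrite !swap//; apply: eq_integral => y _.
  have mys := measurable_ysection y mS1.
  rewrite -[LHS](lebesgue_translate (- y) mys); congr (mu _).
  apply/seteqP; split => x; rewrite /ysection /= /aff mulmx1 !inE /S1 /S2 /= (addrC (- y)) subrK;
  by case.
have fU : mu U \is a fin_num by rewrite ge0_fin_numE ?measure_ge0// lebesgue_eball_lty.
move: key; rewrite nuU muleC -nuE => key; apply/eqP; rewrite eq_le.
rewrite -(lee_pmul2r fU lebesgue_eball_gt0) -[X in _ && X](lee_pmul2r fU lebesgue_eball_gt0).
by rewrite key lexx.
Qed.

End haar.

(** * Change of variables for similitudes; local integrability *)

Section change_of_variables.
Context {R : realType} {n : nat}.
Local Notation mu := (@lebesgue_row R n).
Implicit Types (x y a : 'rV[R]_n) (M : 'M[R]_n) (A : set 'rV[R]_n).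

(** A positive multiple of an orthogonal matrix. Such maps change both the measure and the Euclidean
    norm of gradients by a constant factor, and no other linear maps are needed. *)
Definition similitude (s : R) M := 0 < s /\ M *m M^T = (s ^+ 2)%:M.

Lemma similitude_scalar (s : R) : 0 < s -> similitude s s%:M.
Proof.
by move=> s0; split => //; rewrite tr_scalar_mx -scalar_mxM -expr2.
Qed.

Lemma similitudeZ (s t : R) M : 0 < t -> similitude s M -> similitude (t * s) (t *: M).
Proof.
move=> t0 [s0 MM]; split; first exact: mulr_gt0.
rewrite linearZ/= -scalemxAl -scalemxAr MM scalerA -expr2 exprMn.
by rewrite scale_scalar_mx.
Qed.

Lemma lebesgue_similitude s M a A : similitude s M -> measurable A ->
  mu (aff a M @^-1` A) = ((s ^- n)%:E * mu A)%E.
Proof.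
move=> [s0 MM] mA; rewrite -(lebesgue_dilate a s0 mA).
have OO : (s^-1 *: M) *m (s^-1 *: M)^T = 1%:M.
  rewrite linearZ/= -scalemxAl -scalemxAr MM scalerA scale_scalar_mx.
  by rewrite -expr2 exprVn mulVf// expf_neq0// gt_eqF.
have mB : measurable (aff a s%:M @^-1` A).
  by rewrite -[X in measurable X]setTI; exact: measurable_aff.
rewrite -(lebesgue_orthogonal OO mB); congr (mu _).
apply/seteqP; split => x; rewrite /= /aff add0r mul_mx_scalar -scalemxAr scalerA;
  by rewrite divff ?gt_eqF// scale1r.
Qed.

Lemma ge0_integral_similitude s M a (f : 'rV[R]_n -> \bar R) : similitude s M ->
  measurable_fun setT f -> (forall x, 0 <= f x)%E ->
  (\int[mu]_x f (aff a M x) = (s ^- n)%:E * \int[mu]_x f x)%E.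
Proof.
move=> sM mf f0; have s0 := sM.1.
have sn : 0 <= s ^- n by rewrite invr_ge0 exprn_ge0// ltW.
have := @ge0_integral_pushforward _ _ _ _ R _ (measurable_aff a M) mu setT f
  measurableT mf (fun x _ => f0 x).
rewrite preimage_setT => <-.
have <- := @ge0_integral_mscale _ _ _ mu _ measurableT (NngNum sn) _ mf (fun x _ => f0 x).
apply: eq_measure_integral => A mA _.
exact: (lebesgue_similitude a sM mA).
Qed.

Lemma integrable_similitude s M a (f : 'rV[R]_n -> R) : similitude s M ->
  mu.-integrable setT (EFin \o f) -> mu.-integrable setT (EFin \o (f \o aff a M)).
Proof.
move=> sM /integrableP[mf fi]; apply/integrableP; split.
  exact: (measurableT_comp mf (measurable_aff a M)).
have mabs : measurable_fun setT (fun x => `|(EFin \o f) x|%E).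
  exact: measurableT_comp.
have := ge0_integral_similitude a sM mabs (fun x => abse_ge0 _).
rewrite /= => ->; rewrite lte_mul_pinfty// lee_fin invr_ge0 exprn_ge0// ltW//.
by case: sM.
Qed.

Lemma Rintegral_similitude s M a (f : 'rV[R]_n -> R) : similitude s M ->
  mu.-integrable setT (EFin \o f) ->
  \int[mu]_x f (aff a M x) = s ^- n * \int[mu]_x f x.
Proof.
move=> sM fi; have fTi := integrable_similitude a sM fi.
have mf := measurable_int _ fi.
rewrite /Rintegral integralE.
rewrite [in RHS]integralE.
have -> : (\int[mu]_x (fun x => (f (aff a M x))%:E)^\+ x =
    (s ^- n)%:E * \int[mu]_x (EFin \o f)^\+ x)%E.
  rewrite -(ge0_integral_similitude a sM)//; last exact: measurable_funepos.
  by apply: eq_integral => x _; rewrite !funeposE.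
have -> : (\int[mu]_x (fun x => (f (aff a M x))%:E)^\- x =
    (s ^- n)%:E * \int[mu]_x (EFin \o f)^\- x)%E.
  rewrite -(ge0_integral_similitude a sM)//; last exact: measurable_funeneg.
  by apply: eq_integral => x _; rewrite !funenegE.
have fp := integrable_pos_fin_num measurableT fi.
have fn := integrable_neg_fin_num measurableT fi.
by rewrite -muleBr ?fineM// ?fin_num_adde_defl ?fin_numN// fin_numB fp.
Qed.

Lemma Rintegral_translate a (f : 'rV[R]_n -> R) :
  mu.-integrable setT (EFin \o f) ->
  \int[mu]_x f (x + a) = \int[mu]_x f x.
Proof.
move=> fi.
have := Rintegral_similitude a (similitude_scalar ltr01) fi.
rewrite expr1n invr1 mul1r => <-; apply: eq_Rintegral => x _.
by rewrite /aff mulmx1 addrC.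
Qed.

Definition cball (N : R) : set 'rV[R]_n := [set x | `|x| <= N].

Lemma continuous_norm_row : continuous (fun x : 'rV[R]_n => `|x|).
Proof.
apply/continuous_rowP => x e e0; exists e; split => // y.
exact: le_lt_trans (ler_dist_dist _ _).
Qed.

Lemma closed_cball N : closed (cball N).
Proof.
rewrite (_ : cball N = (fun x : 'rV[R]_n => `|x|) @^-1` [set t | t <= N])//.
apply: (@closed_comp _ _ (fun x : 'rV[R]_n => `|x|)) => [x _|].
  exact: continuous_norm_row.
exact: closed_le.
Qed.

Lemma compact_cball N : compact (cball N).
Proof.
apply: bounded_closed_compact; last exact: closed_cball.
exists N; split; first exact: num_real.
by move=> K NK x xN; exact: le_trans xN (ltW NK).
Qed.

Lemma measurable_cball N : measurable (cball N).
Proof. by apply: closed_measurable_row; exact: closed_cball. Qed.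

Lemma lebesgue_cball_lty N : (mu (cball N) < +oo)%E.
Proof.
have [k _ /(_ _ (leqnn k)) /= h] := nbhs_infty_gtr N.
apply: le_lt_trans (lebesgue_cube_lty n k).
apply: le_measure; rewrite ?inE; [exact: measurable_cball|exact: measurable_obox|].
move=> x /= xr i; rewrite !mxE.
have /ler_normlP [h1 h2] := coord_ler_norm x i.
rewrite ltrNl (le_lt_trans h1 (le_lt_trans xr h))/=.
by rewrite (le_trans h2 (ltW (le_lt_trans xr h))).
Qed.

Lemma continuous_bounded (f : 'rV[R]_n -> R) N : continuous f ->
  exists2 C, 0 <= C & forall x, `|x| <= N -> `|f x| <= C.
Proof.
move=> cf.
have : compact (f @` cball N).
  by apply: continuous_compact; [exact: continuous_subspaceT|exact: compact_cball].
move=> /compact_bounded [C [_ hC]]; exists (`|C| + 1) => // x xN.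
apply: hC; last by exists x.
by rewrite (le_lt_trans (ler_norm C))// ltrDl.
Qed.

Definition bsupp (f : 'rV[R]_n -> R) := exists N, forall x, N < `|x| -> f x = 0.

Lemma bsuppMr (f g : 'rV[R]_n -> R) : bsupp g -> bsupp (fun x => f x * g x).
Proof. by case=> N gN; exists N => x /gN ->; rewrite mulr0. Qed.

Lemma continuous_bsupp_bounded (f : 'rV[R]_n -> R) : continuous f -> bsupp f ->
  exists2 C, 0 <= C & forall x, `|f x| <= C.
Proof.
move=> cf [N fN]; have [C C0 hC] := continuous_bounded N cf.
exists C => // x; have [/hC//|/fN ->] := leP `|x| N.
by rewrite normr0.
Qed.

Definition locint (v : 'rV[R]_n -> R) := measurable_fun setT v /\
  forall N, mu.-integrable (cball N) (EFin \o v).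

Lemma locintE v : loc_integrable v <-> locint v.
Proof.
split=> [[mv vK]|[mv vN]]; split => //.
  move=> N; apply/integrableP; split.
    by apply/measurable_EFinP; exact: measurable_funTS.
  by have := vK _ (@compact_cball N).
move=> K cK.
have [N [_ hN]] := compact_bounded cK.
have /integrableP[_] := vN (N + 1).
apply: le_lt_trans; apply: ge0_subset_integral => //.
- by apply: closed_measurable_row; exact: (compact_closed (@norm_hausdorff _ _)).
- exact: measurable_cball.
- by apply/measurable_EFinP/measurableT_comp => //; exact: measurable_funTS.
- by move=> x Kx; apply: (hN _ _ _ Kx); rewrite ltrDl.
Qed.

Lemma locint_integrableM (v f : 'rV[R]_n -> R) (C : R) : locint v ->
  measurable_fun setT f -> bsupp f -> (forall x, `|f x| <= C) ->
  mu.-integrable setT (EFin \o (fun x => v x * f x)).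
Proof.
move=> [mv vN] mf [N fN] fC.
have := vN N => /integrable_mkcond -/(_ (measurable_cball N)) iv.
apply: (@le_integrable _ _ _ mu _ _ _ (fun x => C%:E * ((EFin \o v) \_ (cball N)) x)%E) => //.
- by apply/measurable_EFinP; exact: measurable_funM.
- move=> x _ /=; rewrite patchE; case: ifPn => [_|].
    rewrite -[(C%:E * _)%E]/((C * v x)%:E) abse_EFin lee_fin !normrM mulrC.
    by rewrite ler_wpM2r// (le_trans (fC x))// ler_norm.
  rewrite notin_setE /= => /negP; rewrite -ltNge => /fN ->.
  by rewrite lee_fin mulr0 normr0.
- exact: integrableZl.
Qed.

Lemma continuous_locint (u : 'rV[R]_n -> R) : continuous u -> locint u.
Proof.
move=> cu; have mu_ := continuous_measurable_row cu; split => // N.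
have [C C0 hC] := continuous_bounded N cu.
apply: measurable_bounded_integrable => //.
- exact: measurable_cball.
- exact: lebesgue_cball_lty.
- exact: measurable_funTS.
- exists C; split; first exact: num_real.
  by move=> M CM x xN /=; exact: le_trans (hC _ xN) (ltW CM).
Qed.

Lemma continuous_cst_row (c : R) : continuous (fun _ : 'rV[R]_n => c).
Proof.
apply/continuous_rowP => x e e0; exists 1; split=> // y _.
by rewrite subrr normr0.
Qed.

Lemma locint_cst (c : R) : locint (fun _ : 'rV[R]_n => c).
Proof. exact/continuous_locint/continuous_cst_row. Qed.

Lemma integrable_bsupp (f : 'rV[R]_n -> R) (C : R) : measurable_fun setT f ->
  bsupp f -> (forall x, `|f x| <= C) -> mu.-integrable setT (EFin \o f).
Proof.
move=> mf bf fC.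
have := locint_integrableM (locint_cst 1) mf bf fC.
by congr (_.-integrable _ _); apply/funext => x /=; rewrite mul1r.
Qed.

Lemma locint_integrableMc (v f : 'rV[R]_n -> R) : locint v ->
  continuous f -> bsupp f ->
  mu.-integrable setT (EFin \o (fun x => v x * f x)).
Proof.
move=> lv cf bf; have [C _ hC] := continuous_bsupp_bounded cf bf.
exact: locint_integrableM lv (continuous_measurable_row cf) bf hC.
Qed.

End change_of_variables.

(** * Smooth functions and test functions *)

Section directional_derivative.
Context {R : realType} {V : normedModType R}.

Lemma is_derive_epsP (f : V -> R) x v l : is_derive x v f l <->
  forall e, 0 < e -> exists d, 0 < d /\ forall h, h != 0 -> `|h| < d ->
    `|h^-1 * (f (h *: v + x) - f x) - l| < e.
Proof.
split=> [[df dl] e e0|H].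
  have : (fun h => h^-1 *: ((f \o shift x) (h *: v) - f x)) @ 0^' --> l.
    by rewrite -dl; exact: df.
  move=> /cvgrPdist_lt /(_ e e0) [d /= d0 hd]; exists d; split => // h h0 hlt.
  by rewrite distrC; apply: hd => //=; rewrite sub0r normrN.
have cf : (fun h => h^-1 *: ((f \o shift x) (h *: v) - f x)) @ 0^' --> l.
  apply/cvgrPdist_lt => e e0; have [d [d0 hd]] := H e e0.
  exists d => //= h /=; rewrite sub0r normrN => hlt h0.
  by rewrite distrC; exact: hd.
by apply: DeriveDef; [apply: cvgP cf|exact: cvg_lim cf].
Qed.

End directional_derivative.

Section line.
Context {R : realType} {V : normedModType R}.

Lemma is_derive_lineP (f : V -> R) x v (t : R) l :
  is_derive t 1 (fun t : R => f (t *: v + x)) l <-> is_derive (t *: v + x) v f l.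
Proof.
have aux (h : R) : f ((h *: (1 : R) + t) *: v + x) = f (h *: v + (t *: v + x)).
  by rewrite addrA -scalerDl; congr (f ((_ + _) *: _ + _)); exact: mulr1.
have h1 := is_derive_epsP f (t *: v + x) v l.
split=> H.
  have {}H := (is_derive_epsP (fun t0 : R => f (t0 *: v + x)) t 1 l).1 H.
  apply: h1.2 => e /H [d [d0 hd]].
  by exists d; split => // h h0 hlt; have := hd h h0 hlt; rewrite aux.
apply: (is_derive_epsP (fun t0 : R => f (t0 *: v + x)) t 1 l).2.
move=> e /(h1.1 H) [d [d0 hd]].
by exists d; split => // h h0 hlt; have := hd h h0 hlt; rewrite aux.
Qed.

End line.

(** * Smooth functions of one variable *)

Section smooth_real.
Context {R : realType}.
Implicit Types (P : {poly R}) (f g F : R -> R).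

(** The flat function exp(-1/t), with a polynomial factor in 1/t that makes the family stable under
    differentiation. *)
Definition poly_exp_inv P (t : R) : R :=
  if 0 < t then P.[t^-1] * expR (- t^-1) else 0.

(* A class of smooth functions closed under differentiation; the last clause
   gives primitives. *)
Inductive smooth1 : (R -> R) -> Prop :=
| smooth1_poly_exp P : smooth1 (poly_exp_inv P)
| smooth1_cst c : smooth1 (fun=> c)
| smooth1_aff c d f : smooth1 f -> smooth1 (fun t => f (c * t + d))
| smooth1D f g : smooth1 f -> smooth1 g -> smooth1 (fun t => f t + g t)
| smooth1M f g : smooth1 f -> smooth1 g -> smooth1 (fun t => f t * g t)
| smooth1_prim f F : smooth1 f -> (forall t : R, is_derive t 1 F (f t)) -> smooth1 F.

(** With s = 1/h, the rate s^-2 bounds the difference quotient of [poly_exp_inv P] at 0 by C h. It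
    comes from the term of order [size P] + 2 of the exponential series. *)
Lemma poly_exp_decay P : exists2 C, 0 <= C &
  forall s : R, 1 <= s -> `|P.[s]| * expR (- s) <= C * s ^- 2.
Proof.
pose K : R := \sum_(i < size P) `|P`_i|; pose m := size P.
have K0 : 0 <= K by apply: sumr_ge0.
exists (K * m.+2`!%:R); first by rewrite mulr_ge0.
move=> s s1; have s0 : 0 < s by exact: lt_le_trans s1.
have PK : `|P.[s]| <= K * s ^+ m.
  rewrite horner_coef (le_trans (ler_norm_sum _ _ _))// mulr_suml.
  apply: ler_sum => i _; rewrite normrM ler_wpM2l// normrX ger0_norm ?(ltW s0)//.
  by rewrite ler_weXn2l// ltnW.
rewrite (le_trans (ler_wpM2r (expR_ge0 _) PK))// -!mulrA ler_wpM2l//.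
rewrite expRN ler_pdivrMr ?expR_gt0// mulrAC ler_pdivlMr ?exprn_gt0// -exprD addn2.
rewrite -ler_pdivrMl ?ltr0n ?fact_gt0// mulrC.
by apply: le_trans (expR_ge1Dxn m.+1 (ltW s0)); rewrite lerDr.
Qed.

Lemma is_derive_near f g (t l d : R) : 0 < d ->
  (forall s, `|s - t| < d -> f s = g s) -> is_derive t 1 f l -> is_derive t 1 g l.
Proof.
move=> d0 fg H; have {}H := (is_derive_epsP f t 1 l).1 H.
apply: (is_derive_epsP g t 1 l).2 => e /H [d' [d'0 hd']].
exists (Num.min d d'); split; first by rewrite lt_min d0.
move=> h h0; rewrite lt_min => /andP[hd hlt].
rewrite -!fg ?subrr ?normr0 ?hd'// addrK -[h *: (1 : R)]/(h * 1) mulr1//.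
Qed.

Lemma is_derive_poly_exp_inv P (t : R) : is_derive t 1 (poly_exp_inv P)
  (poly_exp_inv ('X^2 * (P - P^`())) t).
Proof.
have [t0|t0|->] := ltgtP t 0.
- rewrite [X in is_derive _ _ _ X]/poly_exp_inv ltNge (ltW t0)/=.
  apply: (@is_derive_near (cst 0) _ _ _ (- t)); rewrite ?oppr_gt0//.
  move=> s st; rewrite /poly_exp_inv ltNge (_ : s <= 0)//.
  by move: st; rewrite ltr_norml; lra.
- rewrite [X in is_derive _ _ _ X]/poly_exp_inv t0.
  have tn0 : t != 0 by rewrite gt_eqF.
  apply: (@is_derive_near (fun s => P.[s^-1] * expR (- s^-1)) _ _ _ t) => //.
    by move=> s; rewrite ltr_norml => st; rewrite /poly_exp_inv ifT//; lra.
  have dV : is_derive t 1 (fun s : R => s^-1) (- t ^- 2).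
    have := @is_deriveV R id t 1 1 tn0 (is_derive_id _ _).
    by rewrite /= scaler1.
  have dP : is_derive t 1 (fun s : R => P.[s^-1]) (P^`().[t^-1] * - t ^- 2).
    exact: (@is_derive1_comp _ (horner P) (fun s : R => s^-1)).
  have dE : is_derive t 1 (fun s : R => expR (- s^-1)) (expR (- t^-1) * t ^- 2).
    have dN : is_derive t 1 (fun s : R => - s^-1) (t ^- 2).
      by have := is_deriveN dV; rewrite opprK.
    exact: (@is_derive1_comp _ expR (fun s : R => - s^-1)).
  have := @is_deriveM _ _ (fun s : R => P.[s^-1]) (fun s : R => expR (- s^-1)) t 1 _ _ dP dE.
  move=> /is_derive_eq; apply.
  rewrite !hornerE /=; rewrite -exprVn -![_ *: (_ : R)]/(_ * _); ring.
- rewrite [X in is_derive _ _ _ X]/poly_exp_inv ltxx.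
  have [C C0 hC] := poly_exp_decay P.
  apply/is_derive_epsP => e e0; exists (Num.min 1 (e / (C + 1))).
  split; first by rewrite lt_min ltr01 divr_gt0// ltr_wpDl.
  move=> h h0; rewrite lt_min => /andP[h1 he].
  rewrite addr0 /poly_exp_inv ltxx subr0 subr0 -[h *: (1 : R)]/(h * 1) mulr1.
  case: ifPn => [hp|_]; last by rewrite mulr0 normr0.
  rewrite gtr0_norm// in h1 he.
  rewrite normrM gtr0_norm ?invr_gt0// normrM (gtr0_norm (expR_gt0 _)).
  have hV1 : 1 <= h^-1 by rewrite invf_ge1// ltW.
  rewrite (@le_lt_trans _ _ (h^-1 * (C * h ^+ 2)))//.
    rewrite ler_wpM2l ?invr_ge0 ?(ltW hp)//.
    by have := hC _ hV1; rewrite exprVn invrK.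
  rewrite mulrCA expr2 mulKf//.
  move: he; rewrite ltr_pdivlMr; last by rewrite ltr_wpDl.
  by apply: le_lt_trans; rewrite mulrC ler_wpM2l ?(ltW hp)// lerDl.
Qed.

Lemma smooth1_is_derive f : smooth1 f ->
  exists2 f', smooth1 f' & forall t : R, is_derive t 1 f (f' t).
Proof.
elim=> {f} [P|c|c d f sf [f' sf' ff']|f g sf [f' sf' ff'] sg [g' sg' gg']|
  f g sf [f' sf' ff'] sg [g' sg' gg']|f F sf _ fF].
- by exists (poly_exp_inv ('X^2 * (P - P^`()))); [constructor|exact: is_derive_poly_exp_inv].
- by exists (fun=> 0); [constructor|move=> t; exact: is_derive_cst].
- exists (fun t => f' (c * t + d) * c).
    by apply: smooth1M; [exact: smooth1_aff|exact: smooth1_cst].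
  move=> t; have daff : is_derive t 1 (fun t => c * t + d) c.
    have := @is_deriveD _ _ _ (fun t => c * t) (cst d) t 1 _ _
      (@is_deriveZ _ _ _ id c t 1 1 (is_derive_id _ _)) (is_derive_cst d t 1).
    by rewrite addr0 -[c *: (1 : R)]/(c * 1) mulr1.
  exact: (@is_derive1_comp R f (fun t => c * t + d) t _ _ (ff' _) daff).
- exists (fun t => f' t + g' t); first exact: smooth1D.
  by move=> t; exact: (@is_deriveD _ _ _ f g t 1 _ _ (ff' t) (gg' t)).
- exists (fun t => f t * g' t + g t * f' t).
    by apply: smooth1D; apply: smooth1M.
  by move=> t; exact: (@is_deriveM _ _ f g t 1 _ _ (ff' t) (gg' t)).
- by exists f.
Qed.

Lemma smooth1_continuous f : smooth1 f -> continuous f.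
Proof.
move=> /smooth1_is_derive [f' _ ff'] t.
by apply/differentiable_continuous/derivable1_diffP; case: (ff' t).
Qed.

Lemma is_derive_continuous f (df : R -> R) : (forall t : R, is_derive t 1 f (df t)) ->
  continuous f.
Proof.
by move=> fdf t; apply/differentiable_continuous/derivable1_diffP; case: (fdf t).
Qed.

Lemma MVT_is_derive f (df : R -> R) a b : a <= b ->
  (forall t : R, is_derive t 1 f (df t)) ->
  exists2 c, a <= c <= b & f b - f a = df c * (b - a).
Proof.
move=> ab fdf.
have [|c] := @MVT_segment R f df a b ab (fun x _ => fdf x).
  by apply: continuous_subspaceT; exact: is_derive_continuous fdf.
by rewrite in_itv/=; exists c.
Qed.

Lemma is_derive_ge0_nondecreasing f (df : R -> R) a b :
  (forall t : R, is_derive t 1 f (df t)) -> (forall t, 0 <= df t) ->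
  a <= b -> f a <= f b.
Proof.
move=> fdf df0 ab; have [c _ fE] := MVT_is_derive ab fdf.
by rewrite -subr_ge0 fE mulr_ge0// subr_ge0.
Qed.

(** The arguments are spelled out as [c * t + d] to fit the constructor [smooth1_aff]. *)
Definition bump0 (t : R) := poly_exp_inv 1 (1 * t + 1) * poly_exp_inv 1 ((-1) * t + 1).

Lemma smooth1_bump0 : smooth1 bump0.
Proof. by apply: smooth1M; apply: smooth1_aff; exact: smooth1_poly_exp. Qed.

Lemma bump0_gt0 t : -1 < t < 1 -> 0 < bump0 t.
Proof.
move=> /andP[t1 t2]; rewrite /bump0 /poly_exp_inv mul1r mulN1r.
by rewrite !ifT; [|lra..]; rewrite !hornerC !mul1r mulr_gt0// expR_gt0.
Qed.

Lemma bump0_eq0 t : 1 <= `|t| -> bump0 t = 0.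
Proof.
move=> t1; rewrite /bump0 /poly_exp_inv mul1r mulN1r.
case: ifPn => h1; last by rewrite mul0r.
case: ifPn => h2; last by rewrite mulr0.
by exfalso; move: t1; rewrite leNgt ltr_norml; lra.
Qed.

Lemma bump0_ge0 t : 0 <= bump0 t.
Proof.
have [t1|/bump0_eq0 -> //] := ltP `|t| 1.
by apply/ltW/bump0_gt0; rewrite -ltr_norml.
Qed.

Lemma bump0_primitive : exists2 F : R -> R,
  (forall t : R, is_derive t 1 F (bump0 t)) & forall t, t <= -1 -> F t = 0.
Proof.
have cb := smooth1_continuous smooth1_bump0.
have mb : measurable_fun setT bump0 by exact: continuous_measurable_fun.
have ib : lebesgue_measure.-integrable setT (EFin \o bump0).
  have i1 : lebesgue_measure.-integrable `[(-1)%R, 1%R] (EFin \o bump0).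
    by apply: continuous_compact_integrable; [exact: segment_compact|exact: continuous_subspaceT].
  move: i1 => /integrable_mkcond -/(_ (measurable_itv _)).
  congr (_.-integrable _ _); apply/funext => t /=; rewrite patchE.
  case: ifPn => //; rewrite notin_setE /= in_itv/= => /negP tN.
  rewrite bump0_eq0// leNgt ltr_norml; apply: contra tN => /andP[/ltW -> /ltW ->//].
pose F x := \int[lebesgue_measure]_(t in `]-oo, x]) bump0 t.
exists F => t.
  have h1 : t < t + 1 by rewrite ltrDl.
  have h2 : lebesgue_measure.-integrable [set` Interval -oo%O (BRight (t + 1))] (EFin \o bump0).
    by apply: integrableS ib => //; exact: measurable_itv.
  have [dF F'] := @continuous_FTC1 R bump0 -oo%O t (t + 1) h1 h2 (ltNyr _) (cb t).
  by apply: DeriveDef => //; rewrite -derive1E.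
move=> t1; rewrite /F /Rintegral integral0_eq// => x /=; rewrite in_itv/= => xt.
by rewrite bump0_eq0// ler0_norm; lra.
Qed.

(** [beta] is the primitive of [bump0], normalized to reach 1. Both functions are kept: [b] is the
    profile of mollifiers, and [beta] yields compactly supported primitives of differences of
    translated or rescaled copies of [b]. *)
Lemma smooth_step : exists beta b : R -> R, [/\ smooth1 beta /\ smooth1 b,
  (forall t : R, is_derive t 1 beta (b t)),
  (forall t, t <= -1 -> beta t = 0) /\ (forall t, 1 <= t -> beta t = 1),
  (forall t, 0 <= beta t <= 1) /\ (forall t, 0 <= b t) &
  (forall t, 1 <= `|t| -> b t = 0) /\ 0 < b 0].
Proof.
have [F F' F0] := bump0_primitive.
have Fnd s t : s <= t -> F s <= F t.
  by apply: is_derive_ge0_nondecreasing F' _; exact: bump0_ge0.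
have F1 : 0 < F 1.
  apply: (@lt_le_trans _ _ (F (1/2))); last by apply: Fnd; lra.
  (* The mean value theorem is used on [0, 1/2], where the bump is positive. *)
  have h0 : 0 <= (1 : R) / 2 by lra.
  have [c cin] := MVT_is_derive h0 F'.
  have := @Fnd (-1) 0 ltac:(lra); rewrite F0// => F00.
  have := @bump0_gt0 c ltac:(lra); move: (bump0 c) => bc; nra.
have FE t : 1 <= t -> F t = F 1.
  move=> t1; have [c cin] := MVT_is_derive t1 F'.
  rewrite bump0_eq0 ?mul0r; first by move/eqP; rewrite subr_eq0 => /eqP.
  by rewrite ger0_norm; lra.
have sF : smooth1 F by exact: smooth1_prim smooth1_bump0 F'.
exists (fun t => (F 1)^-1 * F t), (fun t => (F 1)^-1 * bump0 t); split.
- by split; apply: smooth1M => //; [exact: smooth1_cst..|exact: smooth1_bump0].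
- by move=> t; exact: (@is_deriveZ _ _ _ F (F 1)^-1 t 1 _ (F' t)).
- by split=> t => [/F0 ->|/FE ->]; rewrite ?mulr0// mulVf// gt_eqF.
- split=> t; last by rewrite mulr_ge0 ?bump0_ge0// invr_ge0 ltW.
  rewrite mulr_ge0 ?invr_ge0 ?(ltW F1)//=.
    rewrite ler_pdivrMl// mulr1; have [/FE ->//|t1] := leP 1 t.
    exact/Fnd/ltW.
  have [/F0 ->//|t1] := leP t (-1).
  by rewrite -(F0 (-1)) ?lexx//; exact/Fnd/ltW.
- split=> [t t1|]; first by rewrite bump0_eq0// mulr0.
  by rewrite mulr_gt0 ?invr_gt0// bump0_gt0//; lra.
Qed.

End smooth_real.

(** * Smooth functions and test functions on R^n *)

Section smooth_row.
Context {R : realType} {n : nat}.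
Implicit Types (x y : 'rV[R]_n) (f g phi : 'rV[R]_n -> R) (F : 'I_n -> R -> R).

Local Notation ev i := (delta_mx (@ord0 0) i : 'rV[R]_n).

Lemma norm_scale_delta (t : R) (i : 'I_n) : `|t *: (ev i)| <= `|t|.
Proof.
rewrite normrZ -[leRHS]mulr1 ler_wpM2l//; apply: row_norm_le => // j.
by rewrite mxE; case: (_ && _); rewrite ?normr0 ?normr1.
Qed.

(** Coinduction principle: [smooth] speaks of all iterated partial derivatives, so a function is
    smooth once it lies in a class of continuous functions stable under partial differentiation. *)
Lemma smooth_class (A : set ('rV[R]_n -> R)) :
  (forall f, A f -> continuous f) ->
  (forall f i, A f -> exists2 g, A g & forall x, is_derive x (ev i) f (g x)) ->
  forall f, A f -> smooth f.
Proof.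
move=> Ac Ad f Af s.
have Afs : A (foldr partial f s).
  elim: s => [//|i s IH] /=; have [g Ag dg] := Ad _ i IH.
  suff -> : partial i (foldr partial f s) = g by [].
  by apply/funext => x; rewrite /partial; case: (dg x).
split; first exact: Ac.
by move=> i x; have [g _ dg] := Ad _ i Afs; case: (dg x).
Qed.

Lemma smooth_continuous f : smooth f -> continuous f.
Proof. by move=> /(_ [::]) []. Qed.

Lemma smooth_partial f i : smooth f -> smooth (partial i f).
Proof. by move=> sf s; have := sf (rcons s i); rewrite foldr_rcons. Qed.

Lemma smooth_is_derive f i x : smooth f -> is_derive x (ev i) f (partial i f x).
Proof. by move=> /(_ [::]) [_ /(_ i x)] /= /derivableP. Qed.

Lemma is_derive_partial f i (g : 'rV[R]_n -> R) :
  (forall x, is_derive x (ev i) f (g x)) -> partial i f = g.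
Proof. by move=> fg; apply/funext => x; rewrite /partial; case: (fg x). Qed.

Lemma partial_eq0 f i N x : (forall x, N < `|x| -> f x = 0) -> N < `|x| ->
  partial i f x = 0.
Proof.
move=> fN xN.
suff : is_derive x (ev i) f 0 by case.
apply/is_derive_epsP => e e0; exists (`|x| - N); split; first by rewrite subr_gt0.
move=> h h0 hN; rewrite !fN// ?subrr ?mulr0 ?subr0 ?normr0//.
have := ler_normB (h *: (ev i) + x) (h *: (ev i)); rewrite addrC addKr => hx.
have := norm_scale_delta h i; move: hx hN.
move: `|x| `|_| `|_| `|_| => *; lra.
Qed.

Lemma bsupp_partial f i : bsupp f -> bsupp (partial i f).
Proof. by move=> [N fN]; exists N => x; exact: partial_eq0. Qed.

Lemma test_functionP phi : test_function phi <-> smooth phi /\ bsupp phi.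
Proof.
split=> [[sphi cphi]|[sphi [N phiN]]]; split => //.
  have [M [_ hM]] := compact_bounded cphi.
  exists (M + 1) => x xM; apply/eqP/negP => /negP phix.
  have : `|x| <= M + 1.
    by apply: (hM (M + 1)); [rewrite ltrDl|exact: subset_closure].
  by rewrite leNgt xM.
have sub : closure [set x | phi x != 0] `<=` cball N.
  have /closure_id -> := @closed_cball R n N.
  apply: closureS => x /=; apply: contraNP => /negP; rewrite -ltNge => /phiN ->.
  by rewrite eqxx.
apply: subclosed_compact sub; [exact: closed_closure|exact: compact_cball].
Qed.

Definition prodf F x : R := \prod_j F j (x ord0 j).

Lemma continuous_prodf F : (forall j, continuous (F j)) -> continuous (prodf F).
Proof.
move=> cF; rewrite /prodf.
elim: (index_enum _) => [|j s IH].
  under eq_fun do rewrite big_nil; exact: continuous_cst_row.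
under eq_fun do rewrite big_cons.
move=> x; apply: (@cvgM _ _ (nbhs x)); last exact: IH.
exact: (@continuous_comp _ _ _ (fun x : 'rV[R]_n => x ord0 j) (F j) x
  (@continuous_coord R n j x) (cF j _)).
Qed.

Lemma is_derive_prodf F (F' : 'I_n -> R -> R) i x :
  (forall j (t : R), is_derive t 1 (F j) (F' j t)) ->
  is_derive x (ev i) (prodf F) (prodf (fun j => if j == i then F' j else F j) x).
Proof.
move=> FF'; rewrite -[x]add0r -[0](scale0r (ev i)); apply/is_derive_lineP.
rewrite scale0r add0r /prodf (bigD1 i)//= eqxx.
under eq_fun do rewrite (bigD1 i)//= !mxE !eqxx mulr1.
set c := (X in _ * X).
rewrite [X in is_derive _ _ X _](_ : _ = fun t => c *: F i (t + x ord0 i)); last first.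
  apply/funext => t; rewrite mulrC; congr (_ * _).
  by apply: eq_bigr => j ji; rewrite !mxE eqxx (negbTE ji) mulr0 add0r.
rewrite mulrC.
have -> : c = \prod_(j < n | j != i) F j (x ord0 j).
  by apply: eq_bigr => j /negbTE ->.
apply: is_deriveZ.
have d1 : is_derive (0 : R) 1 (fun t => t + x ord0 i) 1.
  have := @is_deriveD _ _ _ id (cst (x ord0 i)) (0 : R) 1 _ _ (is_derive_id _ _) (is_derive_cst _ _ _).
  by rewrite addr0.
have := @is_derive1_comp R (F i) (fun t => t + x ord0 i) 0 _ 1 (FF' i _) d1.
by rewrite add0r mulr1.
Qed.

Lemma smooth_prodf F : (forall j, smooth1 (F j)) -> smooth (prodf F).
Proof.
move=> sF; apply: (@smooth_class [set f | exists2 F, (forall j, smooth1 (F j)) & f = prodf F]);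
  last by exists F.
  move=> _ [G sG ->]; apply: continuous_prodf => j; exact: smooth1_continuous.
move=> _ i [G sG ->].
have /choice [G' G'P] j : exists G', smooth1 G' /\ forall t : R, is_derive t 1 (G j) (G' t).
  by have [G' ? ?] := smooth1_is_derive (sG j); exists G'.
exists (prodf (fun j => if j == i then G' j else G j)).
  exists (fun j => if j == i then G' j else G j) => // j.
  by case: (j == i) => //; case: (G'P j).
by move=> x; apply: is_derive_prodf => j; case: (G'P j).
Qed.

Lemma bsupp_prodf F N : 0 <= N -> (forall j t, N < `|t| -> F j t = 0) -> bsupp (prodf F).
Proof.
move=> N0 FN; exists N => x xN.
have [/forallP h|] := boolP [forall j, `|x ord0 j| <= N].
  by have := row_norm_le N0 h; rewrite leNgt xN.
rewrite negb_forall => /existsP[j]; rewrite -ltNge => jN.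
by rewrite /prodf (bigD1 j)//= FN// mul0r.
Qed.

Lemma prodf_le F C x : 0 <= C -> (forall j t, `|F j t| <= C) -> `|prodf F x| <= C ^+ n.
Proof.
move=> C0 FC; rewrite /prodf normr_prod.
have -> : C ^+ n = \prod_(j < n) C by rewrite prodr_const card_ord.
by apply: ler_prod => j _; rewrite normr_ge0 FC.
Qed.

Lemma test_prodf F N : 0 <= N -> (forall j, smooth1 (F j)) ->
  (forall j t, N < `|t| -> F j t = 0) -> test_function (prodf F).
Proof.
by move=> N0 sF FN; apply/test_functionP; split; [exact: smooth_prodf|exact: bsupp_prodf FN].
Qed.

Lemma MVT_partial f i x (h : R) : smooth f ->
  exists2 t : R, `|t| <= `|h| & f (h *: (ev i) + x) - f x = h * partial i f (t *: (ev i) + x).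
Proof.
move=> sf; pose G t := f (t *: (ev i) + x).
have dG (t : R) : is_derive t 1 G (partial i f (t *: (ev i) + x)).
  by apply/is_derive_lineP; exact: smooth_is_derive.
have GE : f x = G 0 by rewrite /G scale0r add0r.
have [h0|h0] := leP 0 h.
  have [c cin] := MVT_is_derive h0 dG.
  rewrite GE subr0 mulrC => ->; exists c => //.
  by rewrite !ger0_norm//; lra.
have [c cin] := MVT_is_derive (ltW h0) dG.
move=> cE; exists c; first by rewrite !ler0_norm//; lra.
rewrite GE -[f _]/(G h) -[LHS]opprB cE; ring.
Qed.

(* The increment is split along the coordinates. *)
Lemma smooth_is_derive_dir f (v : 'rV[R]_n) x : smooth f ->
  is_derive x v f (\sum_i v ord0 i * partial i f x).
Proof.
move=> sf.
pose w (k : nat) : 'rV[R]_n := \row_(j < n) if (j < k)%N then v ord0 j else 0.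
have w0 : w 0%N = 0 by apply/rowP => j; rewrite !mxE.
have wn : w n = v by apply/rowP => j; rewrite !mxE ltn_ord.
have wS (i : 'I_n) : w i.+1 = v ord0 i *: (ev i) + w i.
  apply/rowP => j; rewrite !mxE eqxx/= ltnS leq_eqVlt val_eqE.
  by case: (eqVneq j i) => [->|ji] /=; rewrite ?ltnn ?mulr1 ?addr0// mulr0 add0r.
suff key : forall k, (k <= n)%N ->
    is_derive x (w k) f (\sum_(i < n | (i < k)%N) v ord0 i * partial i f x).
  by have := key _ (leqnn n); rewrite wn; congr is_derive; apply: eq_bigl => i; rewrite ltn_ord.
elim=> [_|k IH kn].
  rewrite w0 big_pred0//; apply/is_derive_epsP => e e0; exists 1; split => // h _ _.
  by rewrite scaler0 add0r subrr mulr0 subr0 normr0.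
pose i := Ordinal kn.
rewrite (bigD1 i) ?ltnSn//=.
rewrite (eq_bigl (fun j : 'I_n => (j < k)%N)); last first.
  by move=> j; rewrite ltnS ltn_neqAle andbC -val_eqE.
have /is_derive_epsP {}IH := IH (ltnW kn).
apply/is_derive_epsP => e e0.
have [d1 [d10 hd1]] := IH (e / 2) (divr_gt0 e0 (ltr0Sn _ 1)).
have cp := smooth_continuous (smooth_partial i sf).
have V0 : 0 < `|v ord0 i| + 1 by rewrite ltr_wpDl.
have [d2 [d20 hd2]] := (continuous_rowP _).1 cp x (e / 2 / (`|v ord0 i| + 1))
   (divr_gt0 (divr_gt0 e0 (ltr0Sn _ 1)) V0).
have W0 : 0 < `|v| + `|w k| + 1 by rewrite ltr_wpDl// addr_ge0.
exists (Num.min d1 (d2 / (`|v| + `|w k| + 1))); split.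
  by rewrite lt_min d10 divr_gt0.
move=> h h0; rewrite lt_min => /andP[hh1]; rewrite ltr_pdivlMr// => hh2.
rewrite (wS i) scalerDr scalerA -addrA.
have [t tle tE] := MVT_partial i (h *: w k + x) (h * v ord0 i) sf.
have -> : f ((h * v ord0 i) *: (ev i) + (h *: w k + x)) - f x =
  h * v ord0 i * partial i f (t *: (ev i) + (h *: w k + x)) + (f (h *: w k + x) - f x).
  by rewrite -tE; ring.
have -> : h^-1 * (h * v ord0 i * partial i f (t *: (ev i) + (h *: w k + x)) +
    (f (h *: w k + x) - f x)) -
    (v ord0 i * partial i f x + \sum_(j < n | (j < k)%N) v ord0 j * partial j f x) =
  v ord0 i * (partial i f (t *: (ev i) + (h *: w k + x)) - partial i f x) +
  (h^-1 * (f (h *: w k + x) - f x) - \sum_(j < n | (j < k)%N) v ord0 j * partial j f x).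
  by field.
rewrite (le_lt_trans (ler_normD _ _))// [ltRHS]splitr ltrD ?hd1//.
have : `|x - (t *: (ev i) + (h *: w k + x))| < d2.
  rewrite addrA opprD addrCA subrr addr0 normrN.
  apply: le_lt_trans hh2; rewrite (le_trans (ler_normD _ _))// mulrDr mulrDr -addrA.
  rewrite [`|h *: w k|]normrZ; apply: lerD; last by rewrite lerDl mulr1.
  apply: (le_trans (norm_scale_delta t i)).
  by rewrite (le_trans tle)// normrM ler_wpM2l// coord_ler_norm.
move=> /hd2; rewrite distrC ltr_pdivlMr// => hlt.
rewrite normrM mulrC (le_lt_trans _ hlt)// ler_wpM2l// lerDl//.
Qed.

(** By the chain rule, the partial derivatives of g o T are linear combinations of functions
    (partial g) o T; this closure is the stable class to which [smooth_class] is applied. *)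
Inductive lincomb (A : set ('rV[R]_n -> R)) : ('rV[R]_n -> R) -> Prop :=
| lincomb_base f : A f -> lincomb A f
| lincomb_cst0 : lincomb A (fun=> 0)
| lincombD f g : lincomb A f -> lincomb A g -> lincomb A (fun x => f x + g x)
| lincombZ c f : lincomb A f -> lincomb A (fun x => c * f x).

Lemma lincomb_sum A (I : finType) (F : I -> 'rV[R]_n -> R) :
  (forall i, lincomb A (F i)) -> lincomb A (fun x => \sum_i F i x).
Proof.
move=> AF; elim: (index_enum I) => [|i s IH].
  under eq_fun do rewrite big_nil; exact: lincomb_cst0.
under eq_fun do rewrite big_cons; exact: lincombD.
Qed.

Lemma smooth_aff_is_derive f a (M : 'M[R]_n) i x : smooth f ->
  is_derive x (ev i) (f \o aff a M) (\sum_j M i j * partial j f (aff a M x)).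
Proof.
move=> sf; have := smooth_is_derive_dir (row i M) (aff a M x) sf.
move=> /is_derive_epsP H; apply/is_derive_epsP => e /H [d [d0 hd]].
exists d; split => // h h0 hlt; have := hd h h0 hlt.
have -> : h *: row i M + aff a M x = aff a M (h *: (ev i) + x).
  by rewrite /aff mulmxDl -scalemxAl -rowE addrCA.
by under eq_bigr do rewrite mxE.
Qed.

Lemma smooth_lincomb_aff a (M : 'M[R]_n) f :
  lincomb [set g \o aff a M | g in smooth] f -> smooth f.
Proof.
apply: smooth_class => {f} f.
  elim=> {f} [_ [g sg <-]| |f g _ cf _ cg|c f _ cf].
  - by apply: continuous_row_comp; [exact: continuous_aff|exact: smooth_continuous].
  - exact: continuous_cst_row.
  - by move=> x; apply: (@cvgD _ _ _ (nbhs x)); [exact: cf|exact: cg].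
  - by move=> x; apply: (@cvgM _ _ (nbhs x)); [exact: continuous_cst_row|exact: cf].
move=> i; elim=> {f} [_ [g sg <-]| |f g _ [f' Af' ff'] _ [g' Ag' gg']|c f _ [f' Af' ff']].
- exists (fun x => \sum_j M i j * partial j g (aff a M x)).
    apply: lincomb_sum => j; apply: lincombZ; apply: lincomb_base.
    by exists (partial j g) => //; exact: smooth_partial.
  by move=> x; exact: smooth_aff_is_derive.
- by exists (fun=> 0); [exact: lincomb_cst0|move=> x; exact: is_derive_cst].
- exists (fun x => f' x + g' x); first exact: lincombD.
  by move=> x; exact: (@is_deriveD _ _ _ f g x _ _ _ (ff' x) (gg' x)).
- exists (fun x => c * f' x); first exact: lincombZ.
  by move=> x; exact: (@is_deriveZ _ _ _ f c x _ _ (ff' x)).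
Qed.

Lemma smooth_aff f a (M : 'M[R]_n) : smooth f -> smooth (f \o aff a M).
Proof. by move=> sf; apply: (@smooth_lincomb_aff a M); apply: lincomb_base; exists f. Qed.

Lemma partial_aff f a (M : 'M[R]_n) i : smooth f ->
  partial i (f \o aff a M) = fun x => \sum_j M i j * partial j f (aff a M x).
Proof. by move=> sf; apply: is_derive_partial => x; exact: smooth_aff_is_derive. Qed.

End smooth_row.

(** * Weak derivatives *)

Section density_measure.
Context d (T : measurableType d) (R : realType) (m : {measure set T -> \bar R}).
Variables (f : T -> \bar R) (mf : measurable_fun setT f) (f0 : forall x, (0 <= f x)%E).

(** The two proofs are arguments so that the measure structure can be attached to the term. *)
Definition density_measure of measurable_fun setT f & (forall x, (0 <= f x)%E) :=
  fun A : set T => (\int[m]_(x in A) f x)%E.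
Local Notation dm := (density_measure mf f0).

Let dm0 : dm set0 = 0%E. Proof. exact: integral_set0. Qed.
Let dm_ge0 A : (0 <= dm A)%E. Proof. by apply: integral_ge0 => x _; exact: f0. Qed.
Let dm_sigma_additive : semi_sigma_additive dm.
Proof. exact: semi_sigma_additive_nng_induced. Qed.

HB.instance Definition _ := isMeasure.Build _ _ _ dm dm0 dm_ge0 dm_sigma_additive.

Lemma density_measure_ex : exists m' : {measure set T -> \bar R},
  forall A, m' A = (\int[m]_(x in A) f x)%E.
Proof. by exists dm. Qed.
End density_measure.

Lemma fin_sub_eq0 (R : realType) (x y : \bar R) : x \is a fin_num ->
  y \is a fin_num -> (x - y = 0)%E -> x = y.
Proof.
case: x y => [x| |] [y| |] //= _ _ [/eqP].
by rewrite subr_eq0 => /eqP ->.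
Qed.

Section weak_derivative.
Context {R : realType} {n : nat}.
Local Notation mu := (@lebesgue_row R n).
Implicit Types (x y a : 'rV[R]_n) (u v phi : 'rV[R]_n -> R) (i : 'I_n).
Local Notation ev i := (delta_mx (@ord0 0) i : 'rV[R]_n).

Lemma test_continuous phi : test_function phi -> continuous phi.
Proof. by move=> /test_functionP[/smooth_continuous]. Qed.

Lemma test_bsupp phi : test_function phi -> bsupp phi.
Proof. by move=> /test_functionP[]. Qed.

Lemma test_partial phi i : test_function phi -> test_function (partial i phi).
Proof.
move=> /test_functionP[s b]; apply/test_functionP.
by split; [exact: smooth_partial|exact: bsupp_partial].
Qed.

Lemma bsupp_similitude phi a (s : R) (M : 'M[R]_n) : similitude s M ->
  bsupp phi -> bsupp (phi \o aff a M).
Proof.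
move=> [s0 MM] [N phiN]; exists (n%:R * (`|N| + `|a|) / s) => x xN /=.
apply: phiN; rewrite ltNge; apply/negP => aN; move: xN; apply/negP; rewrite -leNgt.
rewrite ler_pdivlMr// mulrC (le_trans (ler_wpM2l (ltW s0) (norm_le_enorm x)))//.
rewrite -(enorm_mulmx _ (ltW s0) MM) (le_trans (enorm_le_norm _))//.
rewrite ler_wpM2l//.
have -> : x *m M = aff a M x - a by rewrite /aff addrC addKr.
by rewrite (le_trans (ler_normB _ _))// lerD2r (le_trans aN)// ler_norm.
Qed.

Lemma test_similitude phi a (s : R) (M : 'M[R]_n) : similitude s M ->
  test_function phi -> test_function (phi \o aff a M).
Proof.
move=> sM /test_functionP[sphi bphi]; apply/test_functionP; split.
  exact: smooth_aff.
exact: bsupp_similitude sM bphi.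
Qed.

Lemma test_translate phi a : test_function phi -> test_function (fun x => phi (a + x)).
Proof.
move=> /(test_similitude a (similitude_scalar ltr01)).
by congr test_function; apply/funext => x /=; rewrite /aff mulmx1.
Qed.

Lemma partial_translate phi a i : smooth phi ->
  partial i (fun x => phi (a + x)) = fun x => partial i phi (a + x).
Proof.
move=> sphi; apply: is_derive_partial => x.
have /is_derive_epsP H := smooth_is_derive i (a + x) sphi.
apply/is_derive_epsP => e /H [d [d0 hd]]; exists d; split => // h h0 hlt.
by rewrite addrCA; exact: hd.
Qed.

(** Differentiation under the integral sign. As the parameter only moves [phi], local integrability
    of [u] suffices; integration by parts and the use of weak derivatives along lines both rest on
    it. *)
Lemma is_derive_int_translate u phi i (t : R) : locint u -> test_function phi ->
  is_derive t 1 (fun t => \int[mu]_x (u x * phi (t *: ev i + x)))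
    (\int[mu]_x (u x * partial i phi (t *: ev i + x))).
Proof.
move=> lu tphi.
have [sphi [N phiN]] := (test_functionP _).1 tphi.
have tp := test_partial i tphi.
have [C C0 hC] := continuous_bsupp_bounded (test_continuous tp) (test_bsupp tp).
(* For parameters within 1 of [t], all translates of the derivative of [phi] vanish outside this
   ball; [chi] then dominates them. *)
pose N' := N + `|t| + 1.
pose chi : 'rV[R]_n -> R := fun x => C * \1_(cball N') x.
have mchi : measurable_fun setT chi.
  by apply: measurable_funM => //; apply: measurable_indic; exact: measurable_cball.
have bchi : bsupp chi.
  exists N' => x xN; rewrite /chi indicE memNset ?mulr0//= => xN'.
  by move: xN; rewrite ltNge xN'.
have chiC x : `|chi x| <= C.
  rewrite /chi normrM (ger0_norm C0) -[leRHS]mulr1 ler_wpM2l// indicE.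
  by case: (_ \in _); rewrite ?normr1 ?normr0.
have iG := integrable_norm (locint_integrableM lu mchi bchi chiC).
have It : `](t - 1)%R, (t + 1)%R[%classic t by rewrite /= in_itv/=; apply/andP; split; lra.
have ifx (s : R) : mu.-integrable setT (EFin \o (fun x => u x * phi (s *: ev i + x))).
  have ts := test_translate (s *: ev i) tphi.
  exact: locint_integrableMc lu (test_continuous ts) (test_bsupp ts).
have df (s : R) x : is_derive s 1 (fun t => u x * phi (t *: ev i + x))
    (u x * partial i phi (s *: ev i + x)).
  apply: (@is_deriveZ _ _ _ (fun t : R => phi (t *: ev i + x)) (u x) s 1).
  by apply/is_derive_lineP; exact: smooth_is_derive.
have d1E (s : R) x : partial1of2 (fun t x => u x * phi (t *: ev i + x)) s x =
    u x * partial i phi (s *: ev i + x).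
  by rewrite partial1of2E; case: (df s x).
have Gub (s : R) x : `](t - 1)%R, (t + 1)%R[%classic s -> setT x ->
    `|partial1of2 (fun t x => u x * phi (t *: ev i + x)) s x| <= `|u x * chi x|.
  rewrite /= in_itv/= d1E => /andP[s1 s2] _; rewrite !normrM ler_wpM2l//.
  have [xN|xN] := leP `|x| N'.
    have chiE : chi x = C by rewrite /chi indicE mem_set//= mulr1n mulr1.
    by rewrite (le_trans (hC _))// -normrM -[C * _]/(chi x) chiE ler_norm.
  rewrite (partial_eq0 i phiN) ?normr0// ?mulr_ge0//.
  have := ler_normB (s *: ev i + x) (s *: ev i); rewrite [_ + x]addrC addrK.
  have := norm_scale_delta s i.
  have : `|s| <= `|t| + 1.
    rewrite -[s](subrK t) (le_trans (ler_normD _ _))// addrC lerD2l.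
    by rewrite ler_norml; apply/andP; split; lra.
  move: xN; rewrite /N'.
  move: `|x + _| `|s *: _| `|x| `|s| `|t| => *; lra.
have dint := @derivable_under_integral R _ _ mu
  (fun t x => u x * phi (t *: ev i + x)) setT measurableT t (t - 1) (t + 1) It
  (fun s _ => ifx s) (fun s x _ _ => @ex_derive _ _ _ _ _ _ _ (df s x))
  (fun x => `|u x * chi x|) (fun x => normr_ge0 _) iG Gub.
have vint := @differentiation_under_integral R _ _ mu
  (fun t x => u x * phi (t *: ev i + x)) setT measurableT t (t - 1) (t + 1) It
  (fun s _ => ifx s) (fun s x _ _ => @ex_derive _ _ _ _ _ _ _ (df s x))
  (fun x => `|u x * chi x|) (fun x => normr_ge0 _) iG Gub.
apply: DeriveDef => //; rewrite -derive1E vint.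
by apply: eq_Rintegral => x _; rewrite d1E.
Qed.

Lemma Rintegral_shift u phi i (t : R) : locint u -> test_function phi ->
  \int[mu]_x (u (t *: ev i + x) * phi x) = \int[mu]_x (u x * phi (- t *: ev i + x)).
Proof.
move=> lu tphi.
have ts := test_translate (- t *: ev i) tphi.
have ii := locint_integrableMc lu (test_continuous ts) (test_bsupp ts).
rewrite -(Rintegral_translate (t *: ev i) ii); apply: eq_Rintegral => x _.
by rewrite addrC [x + _]addrC addrA -scalerDl addNr scale0r add0r.
Qed.

Lemma is_derive_unique (f : R -> R) (t k l : R) :
  is_derive t 1 f k -> is_derive t 1 f l -> k = l.
Proof. by move=> [_ <-] [_ <-]. Qed.

(** Translation invariance makes the integral of u(x) phi(x + t e_i) equal to that of u(x - t e_i)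
    phi(x); both sides are differentiated at t = 0. *)
Lemma test_ibp u phi i : test_function u -> test_function phi ->
  \int[mu]_x (u x * partial i phi x) = - \int[mu]_x (partial i u x * phi x).
Proof.
move=> tu tphi.
have lu := continuous_locint (test_continuous tu).
have lp := continuous_locint (test_continuous tphi).
have d1 := is_derive_int_translate i 0 lu tphi.
have d2 := is_derive_int_translate i 0 lp tu.
have E t : \int[mu]_x (u x * phi (t *: ev i + x)) =
    (fun t => \int[mu]_x (phi x * u (t *: ev i + x))) (- t).
  have := Rintegral_shift i (- t) lu tphi; rewrite opprK => <-.
  by apply: eq_Rintegral => x _; rewrite mulrC.
have d0 : is_derive (0 : R) 1 (fun t => - t) (-1) by exact: is_deriveNid.
have d2' : is_derive (- 0 : R) 1 (fun t => \int[mu]_x (phi x * u (t *: ev i + x)))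
    (\int[mu]_x (phi x * partial i u (0 *: ev i + x))) by rewrite oppr0.
have := @is_derive1_comp R _ (fun t => - t) 0 _ _ d2' d0.
have -> : ((fun t => \int[mu]_x (phi x * u (t *: ev i + x))) \o (fun t => - t)) =
    (fun t => \int[mu]_x (u x * phi (t *: ev i + x))).
  by apply/funext => t /=; rewrite E.
move=> d2''; have := is_derive_unique d1 d2''; rewrite mulrN1.
under [LHS]eq_Rintegral do rewrite scale0r add0r.
move=> ->; congr (- _); apply: eq_Rintegral => x _.
by rewrite scale0r add0r mulrC.
Qed.

(** The integral of a translate of [phi] is constant in the translation parameter. *)
Lemma Rintegral_partial phi i : test_function phi -> \int[mu]_x partial i phi x = 0.
Proof.
move=> tphi.
have l1 := @locint_cst R n 1.
have d1 := is_derive_int_translate i 0 l1 tphi.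
have ip : mu.-integrable setT (EFin \o phi).
  have [C _ hC] := continuous_bsupp_bounded (test_continuous tphi) (test_bsupp tphi).
  exact: integrable_bsupp (continuous_measurable_row (test_continuous tphi))
    (test_bsupp tphi) hC.
have d2 : is_derive (0 : R) 1 (fun t : R => \int[mu]_x (1 * phi (t *: ev i + x))) 0.
  rewrite [X in is_derive _ _ X _](_ : _ = cst (\int[mu]_x phi x)); first exact: is_derive_cst.
  apply/funext => t /=; rewrite -(Rintegral_translate (t *: ev i) ip).
  by apply: eq_Rintegral => x _; rewrite mul1r addrC.
have := is_derive_unique d1 d2 => <-; apply: eq_Rintegral => x _.
by rewrite mul1r scale0r add0r.
Qed.

(** * The fundamental lemma of the calculus of variations *)

Section fundamental_lemma.
Variables (v : 'rV[R]_n -> R).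
Hypothesis lv : locint v.
Hypothesis v0 : forall phi, test_function phi -> \int[mu]_x (v x * phi x) = 0.

(** The indicator of a box is a pointwise limit of test functions that are products of differences
    of steepening smooth steps; dominated convergence concludes. *)
Lemma Rintegral_obox_eq0 (a b : 'rV[R]_n) : (forall i, a ord0 i <= b ord0 i) ->
  \int[mu]_x (v x * \1_(obox a b) x) = 0.
Proof.
move=> ab; have [beta [bt [[sbeta _] _ [b0 b1] [bge _] _]]] := @smooth_step R.
(* Subtracting 1 inside [beta] starts each step exactly at its end point, so that the limit is the
   indicator of the half-open interval. *)
pose F (k : nat) (j : 'I_n) (t : R) :=
  beta (k.+1%:R * t + (- (k.+1%:R * a ord0 j) - 1)) -
  beta (k.+1%:R * t + (- (k.+1%:R * b ord0 j) - 1)).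
have FE k j t : F k j t = beta (k.+1%:R * (t - a ord0 j) - 1) -
    beta (k.+1%:R * (t - b ord0 j) - 1).
  by rewrite /F !mulrBr !addrA.
have sF k j : smooth1 (F k j).
  rewrite [F k j](_ : _ = fun t => beta (k.+1%:R * t + (- (k.+1%:R * a ord0 j) - 1)) +
    (-1) * beta (k.+1%:R * t + (- (k.+1%:R * b ord0 j) - 1))); last first.
    by apply/funext => t; rewrite mulN1r.
  apply: smooth1D; first exact: smooth1_aff.
  by apply: smooth1M; [exact: smooth1_cst|exact: smooth1_aff].
have Fa k j t : t <= a ord0 j -> F k j t = 0.
  move=> ta; have tb := le_trans ta (ab j).
  by rewrite FE !b0 ?subrr// gerDr pmulr_rle0// subr_le0.
(* The margin 2 is what the widest step, k = 0, needs to reach its final value. *)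
pose N := `|a| + `|b| + 2.
have FN k j t : N < `|t| -> F k j t = 0.
  rewrite /N => Nt.
  have := coord_ler_norm a j; have := coord_ler_norm b j.
  rewrite !ler_norml => /andP[hb1 hb2] /andP[ha1 ha2].
  have [t0|t0] := leP t 0.
    rewrite ler0_norm// in Nt; apply: Fa.
    by move: Nt hb1 hb2 ha1 ha2 (normr_ge0 b); move: `|a| `|b| => *; lra.
  rewrite gtr0_norm// in Nt.
  have h (c : R) : c <= `|a| + `|b| -> 1 <= k.+1%:R * (t - c) - 1.
    move=> ch; have tc : 2 <= t - c.
      by move: Nt ch; move: `|a| `|b| => *; lra.
    have k1 : (1 : R) <= k.+1%:R by rewrite ler1n.
    by move: (t - c) (k.+1%:R) tc k1 => *; nra.
  rewrite FE !b1 ?subrr//; apply: h.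
    by rewrite (le_trans hb2)// lerDr.
  by rewrite (le_trans ha2)// lerDl.
have N0 : 0 <= N by rewrite addr_ge0// addr_ge0.
have F1 k j t : `|F k j t| <= 1.
  rewrite FE ler_norml.
  have /andP[h1 h2] := bge (k.+1%:R * (t - a ord0 j) - 1).
  have /andP[h3 h4] := bge (k.+1%:R * (t - b ord0 j) - 1).
  by apply/andP; split; lra.
have tF k : test_function (prodf (F k)) by exact: test_prodf N0 (sF k) (FN k).
have bound k x : `|prodf (F k) x| <= \1_(cball N) x.
  rewrite indicE; case: (boolP (x \in cball N)) => [_|].
    by have := prodf_le x ler01 (F1 k); rewrite expr1n.
  rewrite notin_setE /= => /negP; rewrite -ltNge => xN.
  have Nge0 : 0 <= N by [].
  rewrite ler_norml oppr0 -eq_le eq_sym; apply/eqP.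
  have [/forallP h|] := boolP [forall j, `|x ord0 j| <= N].
    by have := row_norm_le Nge0 h; rewrite leNgt xN.
  rewrite negb_forall => /existsP[j]; rewrite -ltNge => jN.
  by rewrite /prodf (bigD1 j)//= FN// mul0r.
have evF x : \forall k \near \oo, prodf (F k) x = \1_(obox a b) x.
  have large (c d : R) : c < d -> \forall k \near \oo, 1 <= k.+1%:R * (d - c) - 1.
    rewrite -subr_gt0; move: (d - c) => {}d d0.
    have [K _ hK] := nbhs_infty_gtr (2 / d).
    exists K => // k /hK /=; rewrite ltr_pdivrMr// => h.
    have : k%:R * d <= k.+1%:R * d by rewrite ler_wpM2r ?(ltW d0)// ler_nat.
    by move: (k%:R * d) (k.+1%:R * d) h => *; lra.
  have : \forall k \near \oo, forall j,
      F k j (x ord0 j) = (a ord0 j < x ord0 j <= b ord0 j)%R%:R.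
    apply: filter_forall => j.
    have [xa|xa] := leP (x ord0 j) (a ord0 j).
      by apply: nearW => k; rewrite Fa// .
    have [xb|xb] := leP (x ord0 j) (b ord0 j); rewrite /=.
      apply: filterS (large _ _ xa) => k hk.
      by rewrite FE b1// b0 ?subr0// gerDr pmulr_rle0// subr_le0.
    apply: filterS2 (large _ _ xa) (large _ _ xb) => k h1 h2.
    by rewrite FE !b1// subrr.
  apply: filterS => k hk; rewrite /prodf; under eq_bigr do rewrite hk.
  rewrite indicE; case: (boolP (x \in obox a b)); rewrite ?inE ?notin_setE => xab.
    by rewrite big1// => j _; rewrite xab.
  have [/forallP h|] := boolP [forall j, a ord0 j < x ord0 j <= b ord0 j].
    by exfalso; apply: xab.
  rewrite negb_forall => /existsP[j /negbTE jN].
  by rewrite (bigD1 j)//= jN mul0r.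
have mind A : measurable A -> measurable_fun setT (\1_A : 'rV[R]_n -> R).
  by move=> mA; exact: measurable_indic.
have bN : bsupp (\1_(cball N) : 'rV[R]_n -> R).
  exists N => x xN; rewrite indicE memNset//= => xN'.
  by move: xN; rewrite ltNge xN'.
have ind1 A (x : 'rV[R]_n) : `|\1_A x : R| <= 1.
  by rewrite indicE; case: (_ \in _); rewrite ?normr1 ?normr0.
have iG := integrable_norm (locint_integrableM lv (mind _ (@measurable_cball R n N)) bN (ind1 _)).
have iFk k := locint_integrableMc lv (test_continuous (tF k)) (test_bsupp (tF k)).
have mlim : measurable_fun setT (fun x => (v x * \1_(obox a b) x)%:E).
  apply/measurable_EFinP; apply: measurable_funM; first by case: lv.
  by apply: mind; exact: measurable_obox.
have hcv x : setT x -> (v x * prodf (F k) x)%:E @[k --> \oo] --> (v x * \1_(obox a b) x)%:E.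
  by move=> _; apply: cvg_near_cst; apply: filterS (evF x) => k ->.
pose g : 'rV[R]_n -> \bar R := EFin \o (Num.norm \o (fun x => v x * \1_(cball N) x)).
have hb x k : setT x -> (`|((v x * prodf (F k) x)%R)%:E| <= g x)%E.
  move=> _; rewrite /g lee_fin /= !normrM ler_wpM2l// (le_trans (bound k x))//.
  exact: ler_norm.
have [_ _] := @dominated_convergence _ _ R mu setT measurableT
  (fun k x => (v x * prodf (F k) x)%:E) (fun x => (v x * \1_(obox a b) x)%:E)
  g (fun k => measurable_int _ (iFk k)) mlim (aeW _ hcv) iG (aeW _ hb).
rewrite (_ : (fun k => _) = fun=> 0%E); last first.
  apply/funext => k; have := v0 (tF k); rewrite /Rintegral => h.
  by rewrite -[LHS]fineK ?h//; exact: integrable_fin_num (iFk k).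
move=> hc; have h := cvg_unique (@ereal_hausdorff R) hc (cvg_cst _).
by rewrite /Rintegral h.
Qed.

(** On a cube, the positive and negative parts of [v] are densities of two finite measures that
    agree on boxes, hence on all measurable sets. *)
Lemma fundamental_lemma : {ae mu, forall x, v x = 0}.
Proof.
have mind A : measurable A -> measurable_fun setT (\1_A : 'rV[R]_n -> R).
  by move=> mA; exact: measurable_indic.
have ind1 A (x : 'rV[R]_n) : `|\1_A x : R| <= 1.
  by rewrite indicE; case: (_ \in _); rewrite ?normr1 ?normr0.
have bcube K : bsupp (\1_(cube n K) : 'rV[R]_n -> R).
  exists K%:R => x xK; rewrite indicE memNset//= => xc.
  move: xK; apply/negP; rewrite -leNgt; apply: row_norm_le => // i.
  by have := xc i; rewrite !mxE ler_norml => /andP[/ltW -> ->].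
have mcube K := measurable_obox (const_mx (- K%:R) : 'rV[R]_n) (const_mx K%:R).
suff key K : {ae mu, forall x, setT x -> (v x * \1_(cube n K) x)%:E = 0%E}.
  have := ae_foralln key; apply: filterS => x h.
  have [K _ /= xK] : (\bigcup_k cube n k) x by rewrite (@cube_cover R n).
  have := h K I; rewrite indicE mem_set// mulr1n mulr1.
  by case.
pose w x : \bar R := (v x * \1_(cube n K) x)%:E.
have iw : mu.-integrable setT w.
  exact: locint_integrableM lv (mind _ (mcube K)) (bcube K) (ind1 _).
have mw := measurable_int _ iw.
have [m1 m1E] := density_measure_ex mu (measurable_funepos mw) (@funepos_ge0 _ _ w).
have [m2 m2E] := density_measure_ex mu (measurable_funeneg mw) (@funeneg_ge0 _ _ w).
have fp A : measurable A -> (\int[mu]_(x in A) w^\+ x)%E \is a fin_num.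
  by move=> mA; apply: integrable_pos_fin_num => //; exact: integrableS iw.
have fn A : measurable A -> (\int[mu]_(x in A) w^\- x)%E \is a fin_num.
  by move=> mA; apply: integrable_neg_fin_num => //; exact: integrableS iw.
have m12 A : measurable A -> m1 A = m2 A.
  apply: measure_obox_unique => [a b ab|k]; last first.
    by rewrite m1E ltey_eq fp//; exact: mcube.
  rewrite m1E m2E; have mab := measurable_obox a b.
  apply: fin_sub_eq0; [exact: fp|exact: fn|].
  rewrite -integralE.
  have [c [d [cd cdE]]] : oboxes (obox a b `&` cube n K).
    by apply: oboxes_setI; [exists a, b|exact: cube_oboxes].
  rewrite integral_mkcond.
  transitivity (\int[mu]_x (v x * \1_(obox c d) x)%:E)%E.
    apply: eq_integral => x _; rewrite -cdE patchE indicI /w.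
    case: (boolP (x \in obox a b)) => xab /=.
      by rewrite [\1_(obox a b) x]indicE xab mulr1n mul1r.
    by rewrite [\1_(obox a b) x]indicE (negbTE xab) mulr0n mul0r mulr0.
  have bcd : bsupp (\1_(obox c d) : 'rV[R]_n -> R).
    by rewrite -cdE indicI; apply: bsuppMr; exact: bcube.
  have icd := locint_integrableM lv (mind _ (measurable_obox c d)) bcd (ind1 _).
  by rewrite -[LHS]fineK ?[fine _]Rintegral_obox_eq0//; exact: integrable_fin_num icd.
have := @integral_ae_eq _ _ R mu setT measurableT (cst 0%E) w iw
  (measurable_cst _).
apply => E _ mE; rewrite integralE -m1E -m2E m12// m2E subee ?fn//.
by rewrite integral_cst// mul0e.
Qed.

End fundamental_lemma.

Lemma is_weak_partial_unique i u v w : is_weak_partial i u v ->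
  is_weak_partial i u w -> {ae mu, forall x, v x = w x}.
Proof.
move=> [/locintE lv uv] [/locintE lw uw].
have lvw : locint (fun x => v x - w x).
  split; first by apply: measurable_funB; [case: lv|case: lw].
  by move=> N; have := integrableB (@measurable_cball R n N) (lv.2 N) (lw.2 N).
have := @fundamental_lemma _ lvw; case.
  move=> phi tphi.
  under eq_Rintegral do rewrite mulrBl.
  rewrite RintegralB//; last 2 first.
  - exact: locint_integrableMc lv (test_continuous tphi) (test_bsupp tphi).
  - exact: locint_integrableMc lw (test_continuous tphi) (test_bsupp tphi).
  by apply/eqP; rewrite subr_eq0 -eqr_opp -uv// -uw.
move=> A [mA A0 hA]; exists A; split => // x /= vw; apply: hA => /= /eqP.
by rewrite subr_eq0 => /eqP.
Qed.

End weak_derivative.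

(** * Functions with p-integrable weak gradient *)

Section powR_inequalities.
Context {R : realType}.
Implicit Types (a b e p q : R).

Lemma le_powR a b p : 0 <= p -> 0 <= a -> a <= b -> a `^ p <= b `^ p.
Proof. by move=> p0 a0 ab; rewrite ge0_ler_powR ?nnegrE// (le_trans a0). Qed.

Lemma le_1_powR a p : 1 <= p -> 0 <= a -> a <= 1 + a `^ p.
Proof.
move=> p1 a0; have [a1|a1] := leP a 1.
  by rewrite (le_trans a1)// lerDl powR_ge0.
by rewrite (le_trans (le1r_powR (ltW a1) p1))// lerDr.
Qed.

Lemma midpoint_powR q a b : 1 <= q -> 0 <= a -> 0 <= b ->
  ((a + b) / 2) `^ q <= (a `^ q + b `^ q) / 2.
Proof.
move=> q1 a0 b0; rewrite mulrDl mulrDl ![_ / 2]mulrC.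
rewrite {2 4}(_ : 2^-1 = 1 - 2^-1); last by lra.
by apply: (convex_powR q1 (Itv01 _ _)) => //=;
  rewrite ?inE/= ?in_itv/= ?andbT// ?invr_ge0// invf_le1 ?ler1n.
Qed.

Lemma superadditive_powR q a b : 1 <= q -> 0 <= a -> 0 <= b ->
  a `^ q + b `^ q <= (a + b) `^ q.
Proof.
move=> q1 a0 b0; have q0 : 0 < q by exact: lt_le_trans q1.
have ab0 : 0 <= a + b by exact: addr_ge0.
rewrite -!(mulr_powRB1 _ q0)// mulrDl lerD// ler_wpM2l// le_powR ?subr_ge0//.
  by rewrite lerDl.
by rewrite lerDr.
Qed.

End powR_inequalities.

(** * Pairs of a function and its weak gradient *)

Section sobolev_pairs.
Context {R : realType} {n : nat}.
Local Notation mu := (@lebesgue_row R n).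
Implicit Types (x y z a : 'rV[R]_n) (u v phi : 'rV[R]_n -> R)
  (g k : 'rV[R]_n -> 'rV[R]_n) (i : 'I_n) (p : R).

Lemma integrable_le (f G : 'rV[R]_n -> R) : measurable_fun setT f ->
  (forall x, `|f x| <= G x) -> mu.-integrable setT (EFin \o G) ->
  mu.-integrable setT (EFin \o f).
Proof.
move=> mf fG iG; apply: (@le_integrable _ _ _ mu _ _ _ (EFin \o G)) => //.
  exact/measurable_EFinP.
by move=> x _; rewrite /= lee_fin (le_trans (fG x))// ler_norm.
Qed.

Lemma Rintegral_sum (I : finType) (f : I -> 'rV[R]_n -> R) :
  (forall j, mu.-integrable setT (EFin \o f j)) ->
  \int[mu]_x (\sum_j f j x) = \sum_j \int[mu]_x f j x /\
  mu.-integrable setT (EFin \o (fun x => \sum_j f j x)).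
Proof.
move=> fi; elim: (index_enum I) => [|j s [IH1 IH2]].
  under eq_Rintegral do rewrite big_nil; rewrite big_nil.
  split; first by rewrite Rintegral_cst// mul0r.
  by under eq_fun do rewrite big_nil; exact: integrable0.
rewrite big_cons -IH1; split.
  under eq_Rintegral do rewrite big_cons.
  by rewrite RintegralD.
have := integrableD measurableT (fi j) IH2.
by congr (_.-integrable _ _); apply/funext => x /=; rewrite big_cons.
Qed.

Definition energy p g : R := \int[mu]_x (enorm (g x) `^ p).

(* [u] with weak gradient [g] in L^p; for [p > n] this describes the elements of
   [D1p] (their Hoelder continuity follows from Morrey's inequality). *)
Definition sobolev p u g := [/\ continuous u, measurable_fun setT g,
  mu.-integrable setT (EFin \o (fun x => enorm (g x) `^ p)) &
  forall i phi, test_function phi ->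
    \int[mu]_x (u x * partial i phi x) = - \int[mu]_x (g x ord0 i * phi x)].

Lemma measurable_enorm_powR p g : measurable_fun setT g ->
  measurable_fun setT (fun x => enorm (g x) `^ p).
Proof.
move=> mg; apply: (measurableT_comp (measurable_powR p)).
exact: (measurableT_comp (continuous_measurable_row (@continuous_enorm R n)) mg).
Qed.

Lemma measurable_coord_comp g i : measurable_fun setT g ->
  measurable_fun setT (fun x => g x ord0 i).
Proof. by move=> mg; exact: (measurableT_comp (measurable_coord i) mg). Qed.

Lemma energy_ge0 p g : 0 <= energy p g.
Proof. by apply: Rintegral_ge0 => x _; exact: powR_ge0. Qed.

Lemma powR_locint p (v : 'rV[R]_n -> R) : 1 <= p -> measurable_fun setT v ->
  mu.-integrable setT (EFin \o (fun x => `|v x| `^ p)) -> locint v.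
Proof.
move=> p1 mv iv; split => // N.
have i1 : mu.-integrable (cball N) (EFin \o (fun x => 1 + `|v x| `^ p)).
  have i2 : mu.-integrable (cball N) (EFin \o (fun x => `|v x| `^ p)).
    by apply: integrableS iv => //; exact: measurable_cball.
  exact: (integrableD (@measurable_cball R n N) ((@locint_cst R n 1).2 N) i2).
apply: (le_integrable _ _ _ i1).
- exact: measurable_cball.
- by apply/measurable_EFinP; exact: measurable_funTS.
- move=> x _ /=; rewrite lee_fin (le_trans (le_1_powR p1 (normr_ge0 _)))//.
  exact: ler_norm.
Qed.

Lemma sobolev_locint p u g i : 1 <= p -> sobolev p u g -> locint (fun x => g x ord0 i).
Proof.
move=> p1 [_ mg ig _]; have mgi := measurable_coord_comp i mg.
apply: (powR_locint p1 mgi).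
apply: integrable_le ig.
  by apply: (measurableT_comp (measurable_powR p)); exact: measurableT_comp.
move=> x; rewrite ger0_norm ?powR_ge0// le_powR ?(le_trans _ p1)//.
exact: coord_le_enorm.
Qed.

Lemma sobolev_integrable p u g i phi : 1 <= p -> sobolev p u g -> test_function phi ->
  mu.-integrable setT (EFin \o (fun x => g x ord0 i * phi x)) /\
  mu.-integrable setT (EFin \o (fun x => u x * partial i phi x)).
Proof.
move=> p1 ug tphi; split.
  exact: locint_integrableMc (sobolev_locint i p1 ug) (test_continuous tphi) (test_bsupp tphi).
have tp := test_partial i tphi; have [cu _ _ _] := ug.
exact: locint_integrableMc (continuous_locint cu) (test_continuous tp) (test_bsupp tp).
Qed.

Lemma integrable_enormD p g k : 1 <= p -> measurable_fun setT g -> measurable_fun setT k ->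
  mu.-integrable setT (EFin \o (fun x => enorm (g x) `^ p)) ->
  mu.-integrable setT (EFin \o (fun x => enorm (k x) `^ p)) ->
  measurable_fun setT (fun x => g x + k x) /\
  mu.-integrable setT (EFin \o (fun x => enorm (g x + k x) `^ p)).
Proof.
move=> p1 mg mk ig ik.
have mgk : measurable_fun setT (fun x => g x + k x).
  apply: measurable_fun_coord => i; under eq_fun do rewrite mxE.
  by apply: measurable_funD; exact: measurable_coord_comp.
split; first exact: mgk.
have igk := integrableZl measurableT (2 `^ p) (integrableD measurableT ig ik).
apply: (integrable_le (G := fun x => 2 `^ p * (enorm (g x) `^ p + enorm (k x) `^ p))) => //.
  exact: measurable_enorm_powR.
move=> x; rewrite ger0_norm ?powR_ge0//.
have p0 : 0 <= p by rewrite (le_trans _ p1).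
rewrite (le_trans (le_powR p0 (enorm_ge0 _) (enormD _ _)))//.
set a := enorm (g x); set b := enorm (k x).
have a0 : 0 <= a := enorm_ge0 _; have b0 : 0 <= b := enorm_ge0 _.
wlog ab : a b a0 b0 / a <= b.
  move=> H; have [|/ltW] := leP a b; first exact: H.
  by rewrite addrC [a `^ p + _]addrC; exact: H.
rewrite (@le_trans _ _ ((2 * b) `^ p))//.
  by rewrite le_powR ?addr_ge0//; lra.
by rewrite powRM// ler_wpM2l ?powR_ge0// lerDr powR_ge0.
Qed.

Lemma enormZ_powR p (c : R) x : enorm (c *: x) `^ p = `|c| `^ p * enorm x `^ p.
Proof. by rewrite enormZ powRM// enorm_ge0. Qed.

Lemma sobolevD p u v g k : 1 <= p -> sobolev p u g -> sobolev p v k ->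
  sobolev p (fun x => u x + v x) (fun x => g x + k x).
Proof.
move=> p1 ug vk; have [cu mg ig wu] := ug; have [cv mk ik wv] := vk.
have [mgk igk] := integrable_enormD p1 mg mk ig ik.
split; [|exact: mgk|exact: igk|].
  by move=> x; apply: (@cvgD _ _ _ (nbhs x)); [exact: cu|exact: cv].
move=> i phi tphi.
have [i1 i2] := sobolev_integrable i p1 ug tphi.
have [i3 i4] := sobolev_integrable i p1 vk tphi.
under eq_Rintegral do rewrite mulrDl; rewrite RintegralD// wu// wv//.
under [in RHS]eq_Rintegral do rewrite mxE mulrDl.
by rewrite RintegralD// opprD.
Qed.

Lemma sobolevZ p u g (c : R) : 1 <= p -> sobolev p u g ->
  sobolev p (fun x => c * u x) (fun x => c *: g x).
Proof.
move=> p1 ug; have [cu mg ig wu] := ug.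
have mcg : measurable_fun setT (fun x => c *: g x).
  apply: measurable_fun_coord => i; under eq_fun do rewrite mxE.
  by apply: measurable_funM => //; exact: measurable_coord_comp.
split; [|exact: mcg| |].
- by move=> x; apply: (@cvgM _ _ (nbhs x)); [exact: continuous_cst_row|exact: cu].
- have := integrableZl measurableT (`|c| `^ p) ig.
  by congr (_.-integrable _ _); apply/funext => x /=; rewrite enormZ_powR.
- move=> i phi tphi; have [i1 i2] := sobolev_integrable i p1 ug tphi.
  under eq_Rintegral do rewrite -mulrA; rewrite RintegralZl// wu// mulrN.
  by rewrite -RintegralZl//; congr (- _); apply: eq_Rintegral => x _; rewrite mxE mulrA.
Qed.

Lemma energyZ p u g (c : R) : sobolev p u g ->
  energy p (fun x => c *: g x) = `|c| `^ p * energy p g.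
Proof.
move=> [_ _ ig _]; rewrite /energy -RintegralZl//.
by apply: eq_Rintegral => x _; rewrite enormZ_powR.
Qed.

Lemma sobolev_cst p (c : R) : 1 <= p -> sobolev p (fun=> c) (fun=> 0).
Proof.
move=> p1; split.
- exact: continuous_cst_row.
- by apply: measurable_fun_coord => i; exact: measurable_cst.
- under eq_fun do rewrite enorm0 powR0 ?gt_eqF ?(lt_le_trans _ p1)//.
  exact: integrable0.
- move=> i phi tphi; rewrite RintegralZl//.
    rewrite Rintegral_partial// mulr0; under eq_Rintegral do rewrite mxE mul0r.
    by rewrite Rintegral_cst// mul0r oppr0.
  have tp := test_partial i tphi.
  have := locint_integrableMc (@locint_cst R n 1) (test_continuous tp) (test_bsupp tp).
  by congr (_.-integrable _ _); apply/funext => x /=; rewrite mul1r.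
Qed.

(** Writing |z|^p as a power p/2 >= 1 of |z|^2, the inequality follows from superadditivity of that
    power, the parallelogram identity and convexity, in this order. *)
Lemma clarkson_pointwise p x y : 2 <= p ->
  enorm (2^-1 *: (x + y)) `^ p + enorm (2^-1 *: (x - y)) `^ p <=
  (enorm x `^ p + enorm y `^ p) / 2.
Proof.
move=> p2; have q1 : 1 <= p / 2 by lra.
have E z : enorm z `^ p = (dot z z) `^ (p / 2).
  by rewrite -sqr_enorm -powR_mulrn ?enorm_ge0// -powRrM mulrCA divff// mulr1.
rewrite !E; apply: le_trans (superadditive_powR q1 (dot_ge0 _) (dot_ge0 _)) _.
apply: le_trans (midpoint_powR q1 (dot_ge0 _) (dot_ge0 _)).
rewrite le_eqVlt; apply/orP; left; apply/eqP; congr (_ `^ _).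
rewrite !(dotZl, dotZr, dotDl, dotDr, dotNl, dotNr) (dotC y x); by field.
Qed.

Lemma clarkson p u v g k : 2 <= p -> sobolev p u g -> sobolev p v k ->
  energy p (fun x => 2^-1 *: (g x + k x)) + energy p (fun x => 2^-1 *: (g x - k x)) <=
  (energy p g + energy p k) / 2.
Proof.
move=> p2 ug vk; have p1 : 1 <= p by lra.
have vk' := sobolevZ (-1) p1 vk.
have [_ _ i1 _] := sobolevZ 2^-1 p1 (sobolevD p1 ug vk).
have [_ _ i2 _] := sobolevZ 2^-1 p1 (sobolevD p1 ug vk').
have [_ _ ig _] := ug; have [_ _ ik _] := vk.
pose f1 x := enorm (2^-1 *: (g x + k x)) `^ p.
pose f2 x := enorm (2^-1 *: (g x - k x)) `^ p.
pose f3 x := enorm (g x) `^ p; pose f4 x := enorm (k x) `^ p.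
have j2 : mu.-integrable setT (EFin \o f2).
  have <- : (fun x => enorm (2^-1 *: (g x + -1 *: k x)) `^ p) = f2.
    by apply/funext => x; rewrite scaleN1r.
  exact: i2.
have E1 := @RintegralD _ _ _ mu setT f1 f2 measurableT i1 j2.
have E2 := @RintegralD _ _ _ mu setT f3 f4 measurableT ig ik.
have igk : mu.-integrable setT (EFin \o (fun x => f3 x + f4 x)).
  exact: (integrableD measurableT ig ik).
have E3 := @RintegralZl _ _ _ mu setT (fun x => f3 x + f4 x) 2^-1 measurableT igk.
have hle : \int[mu]_x (f1 x + f2 x) <= \int[mu]_x (2^-1 * (f3 x + f4 x)).
  apply: (le_Rintegral measurableT).
  - exact: (integrableD measurableT i1 j2).
  - exact: (integrableZl measurableT 2^-1 igk).
  by move=> x _; rewrite mulrC; exact: clarkson_pointwise.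
have E4 := etrans E3 (etrans (congr1 (fun r : R => 2^-1 * r) E2) (mulrC _ _)).
exact: (eq_ind _ (fun r : R => r <= _) (eq_ind _ (fun r : R => _ <= r) hle _ E4) _ E1).
Qed.

Lemma similitude_inv (s : R) (M : 'M[R]_n) : similitude s M ->
  [/\ similitude s M^T, similitude s^-1 (s ^- 2 *: M^T),
    M *m (s ^- 2 *: M^T) = 1%:M & (s ^- 2 *: M^T) *m M = 1%:M].
Proof.
move=> [s0 MM].
have s2 : s ^+ 2 != 0 by rewrite expf_neq0// gt_eqF.
have E1 : M *m (s ^- 2 *: M^T) = 1%:M.
  by rewrite -scalemxAr MM scale_scalar_mx mulVf.
have E2 := mulmx1C E1.
have MtM : M^T *m M = (s ^+ 2)%:M.
  by rewrite -[LHS]scale1r -(divff s2) -scalerA scalemxAl E2 scale_scalar_mx mulr1.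
split => //; first by split => //; rewrite trmxK.
split; first by rewrite invr_gt0.
rewrite linearZ/= trmxK -scalemxAl -scalemxAr MtM scalerA scale_scalar_mx.
by congr (_%:M); field; rewrite gt_eqF.
Qed.

(** For row vectors the chain rule multiplies the gradient by [M^T] on the right. The factor s^(p -
    n) of the energy is the reason for the weight dist^(p - n) in the whole problem. *)
Lemma sobolev_similitude p u g a (s : R) (M : 'M[R]_n) : 1 <= p -> similitude s M ->
  sobolev p u g ->
  sobolev p (u \o aff a M) (fun x => g (aff a M x) *m M^T) /\
  energy p (fun x => g (aff a M x) *m M^T) = s `^ p * s ^- n * energy p g.
Proof.
move=> p1 sM ug; have [cu mg ig wu] := ug.
have [sMT sMi MMi MiM] := similitude_inv sM.
have s0 := sM.1.
have enT x : enorm (g (aff a M x) *m M^T) `^ p = s `^ p * enorm (g (aff a M x)) `^ p.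
  by rewrite (enorm_mulmx _ (ltW s0) sMT.2) powRM// ?enorm_ge0// ltW.
have iT := integrable_similitude a sM ig.
split; last first.
  rewrite /energy; under eq_Rintegral do rewrite enT.
  rewrite (@RintegralZl _ _ _ mu setT (fun x => enorm (g (aff a M x)) `^ p) (s `^ p) measurableT iT).
  by rewrite (Rintegral_similitude a sM ig) mulrA.
have mT : measurable_fun setT (fun x => g (aff a M x)).
  exact: (measurableT_comp mg (measurable_aff a M)).
split.
- by apply: continuous_row_comp => //; exact: continuous_aff.
- apply: measurable_fun_coord => i; under eq_fun do rewrite mxE.
  apply: measurable_sum => j; apply: measurable_funM => //.
  exact: (measurable_coord_comp j mT).
- have := integrableZl measurableT (s `^ p) iT.
  by congr (_.-integrable _ _); apply/funext => x /=; rewrite enT.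
move=> i phi tphi.
(* The test function is transported by the inverse map, so that the weak derivatives of [u] itself
   can be used. *)
pose Mi := s ^- 2 *: M^T; pose a' : 'rV[R]_n := - a *m Mi.
have TT x : aff a' Mi (aff a M x) = x.
  by rewrite /aff mulmxDl -mulmxA MMi mulmx1 addrA -mulmxDl addNr mul0mx add0r.
pose psi := phi \o aff a' Mi.
have tpsi : test_function psi by exact: test_similitude sMi tphi.
have phiE : phi = psi \o aff a M by apply/funext => x; rewrite /psi /= TT.
have spsi : smooth psi by case: ((test_functionP _).1 tpsi).
pose f j x := M i j * (u x * partial j psi x).
pose h j x := M i j * (g x ord0 j * psi x).
have k1 j := (sobolev_integrable j p1 ug tpsi).1.
have k2 j := (sobolev_integrable j p1 ug tpsi).2.
have fi j : mu.-integrable setT (EFin \o f j) := integrableZl measurableT (M i j) (k2 j).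
have hi j : mu.-integrable setT (EFin \o h j) := integrableZl measurableT (M i j) (k1 j).
have fE j : \int[mu]_x f j x = M i j * \int[mu]_x (u x * partial j psi x).
  exact: (RintegralZl _ measurableT (k2 j)).
have hE j : \int[mu]_x h j x = M i j * \int[mu]_x (g x ord0 j * psi x).
  exact: (RintegralZl _ measurableT (k1 j)).
have [fS fSi] := Rintegral_sum fi; have [hS hSi] := Rintegral_sum hi.
transitivity (s ^- n * \int[mu]_x (\sum_j f j x)).
  rewrite -(Rintegral_similitude a sM fSi); apply: eq_Rintegral => x _.
  rewrite [in LHS]phiE partial_aff// mulr_sumr; apply: eq_bigr => j _.
  by rewrite /f mulrCA.
transitivity (- (s ^- n * \int[mu]_x (\sum_j h j x))).
  rewrite fS hS -mulrN -sumrN; congr (_ * _); apply: eq_bigr => j _.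
  by rewrite fE hE wu// mulrN.
rewrite -(Rintegral_similitude a sM hSi); congr (- _); apply: eq_Rintegral => x _.
rewrite mxE mulr_suml; apply: eq_bigr => j _.
by rewrite /h /psi /= TT mxE; ring.
Qed.

End sobolev_pairs.

(** * Relation with [D1p] and with the gradient norm *)

Section sobolev_D1p.
Context {R : realType} {n : nat}.
Local Notation mu := (@lebesgue_row R n).
Implicit Types (x y z a : 'rV[R]_n) (u v phi : 'rV[R]_n -> R)
  (g k : 'rV[R]_n -> 'rV[R]_n) (i : 'I_n) (p : R).

Lemma sobolev_weak_partial p u g i : 1 <= p -> sobolev p u g ->
  is_weak_partial i u (fun x => g x ord0 i).
Proof.
move=> p1 ug; split; last by have [_ _ _ wu] := ug; exact: wu.
by apply/locintE; exact: sobolev_locint p1 ug.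
Qed.

(** [weak_partial] is an arbitrary choice, but weak derivatives are unique almost everywhere, so the
    norm can be computed with any [g]. *)
Lemma sobolev_gradient_norm p u g : 1 <= p -> sobolev p u g ->
  gradient_norm p u `^ p = energy p g.
Proof.
move=> p1 ug; have p0 : p != 0 by rewrite gt_eqF// (lt_le_trans _ p1).
have wP i := sobolev_weak_partial i p1 ug.
have wwP i : is_weak_partial i u (weak_partial i u).
  exact: (xgetPex (cst 0) (ex_intro [set v | is_weak_partial i u v] _ (wP i))).
have mw : measurable_fun setT (weak_gradient u).
  apply: measurable_fun_coord => i; under eq_fun do rewrite mxE.
  by case: (wwP i) => -[].
have ae : {ae mu, forall x, weak_gradient u x = g x}.
  have : {ae mu, forall x, forall i, weak_partial i u x = g x ord0 i}.
    by apply: filter_forall => i; exact: is_weak_partial_unique (wwP i) (wP i).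
  apply: filterS => x h; apply/rowP => i; rewrite mxE; exact: h.
have [_ mg _ _] := ug.
rewrite /gradient_norm -fine_poweR; congr fine.
rewrite powR_Lnorm; last exact: p0.
apply: ae_eq_integral; first exact: measurableT.
- by apply: (measurableT_comp (measurable_poweR p)); apply: measurableT_comp => //;
    apply/measurable_EFinP; exact: (measurableT_comp (continuous_measurable_row (@continuous_enorm R n)) mw).
- by apply/measurable_EFinP; exact: measurable_enorm_powR.
apply: filterS ae => x -> _.
by rewrite abse_EFin poweR_EFin ger0_norm// enorm_ge0.
Qed.

Lemma holder_continuous_continuous (a : R) u : 0 < a -> holder_continuous a u -> continuous u.
Proof.
move=> a0 [C hC]; apply/continuous_rowP => x e e0.
have C0 : 0 < `|C| + 1 by rewrite ltr_wpDl.
have r0 : 0 < (e / (`|C| + 1)) `^ a^-1 by rewrite powR_gt0// divr_gt0.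
exists ((e / (`|C| + 1)) `^ a^-1 / n.+1%:R); split; first by rewrite divr_gt0.
move=> y; rewrite ltr_pdivlMr// => xy; apply: (le_lt_trans (hC x y)).
have le1 : enorm (x - y) < (e / (`|C| + 1)) `^ a^-1.
  rewrite (le_lt_trans (enorm_le_norm _))// mulrC (le_lt_trans _ xy)//.
  by rewrite ler_wpM2l// ler_nat.
have : enorm (x - y) `^ a < e / (`|C| + 1).
  have := gt0_ltr_powR a0 _ _ le1; rewrite !nnegrE enorm_ge0 (ltW r0) => /(_ isT isT).
  by rewrite -powRrM mulVf ?gt_eqF// powRr1// ltW// divr_gt0.
rewrite ltr_pdivlMr//; apply: le_lt_trans.
by rewrite mulrC ler_wpM2l ?powR_ge0// (le_trans (ler_norm C))// lerDl.
Qed.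

Lemma enorm_powR_le_sum p x : 1 <= p ->
  enorm x `^ p <= n%:R `^ p * \sum_i `|x ord0 i| `^ p.
Proof.
move=> p1; have p0 : 0 <= p by rewrite (le_trans _ p1).
rewrite (le_trans (le_powR p0 (enorm_ge0 _) (enorm_le_norm x)))// powRM//.
rewrite ler_wpM2l ?powR_ge0//.
have [x0|x0] := eqVneq `|x| 0.
  rewrite x0 powR0 ?gt_eqF ?(lt_le_trans _ p1)//.
  by apply: sumr_ge0 => i _; exact: powR_ge0.
have [[i j] /= xE] := mx_norm_neq0 x0; rewrite ord1 in xE.
rewrite [`|x|]xE (bigD1 j)//= lerDl.
by apply: sumr_ge0 => k _; exact: powR_ge0.
Qed.

Lemma D1p_sobolev p u : n%:R < p -> 1 <= p -> D1p p u ->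
  exists g, sobolev p u g.
Proof.
move=> np p1 [lu wu hu]; have p0 : 0 < p by exact: lt_le_trans p1.
have cu : continuous u.
  by apply: holder_continuous_continuous hu; rewrite subr_gt0 ltr_pdivrMr// mul1r.
have /choice [v vP] i : exists v, is_weak_partial i u v /\ v \in Lfun mu p%:E.
  by have [v v1 v2] := wu i; exists v.
exists (fun x => \row_i v i x).
have mv i : measurable_fun setT (v i) by case: (vP i) => -[[]].
have mg : measurable_fun setT (fun x => \row_i v i x : 'rV[R]_n).
  by apply: measurable_fun_coord => i; under eq_fun do rewrite mxE; exact: mv.
have mvp i : measurable_fun setT (fun x => `|v i x| `^ p).
  by apply: (measurableT_comp (measurable_powR p)); exact: measurableT_comp.
have iv i : mu.-integrable setT (EFin \o (fun x => `|v i x| `^ p)).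
  apply/integrableP; split.
    by apply/measurable_EFinP; exact: mvp.
  have [_ /sub_Lfun_finLfun] := vP i; rewrite inE /= /finite_norm => h.
  have := poweR_lty p h; rewrite powR_Lnorm ?gt_eqF//.
  apply: le_lt_trans; apply: ge0_le_integral => //.
  - by apply/measurable_EFinP; apply: (measurableT_comp (@normr_measurable _ setT)); exact: mvp.
  - by apply: (measurableT_comp (measurable_poweR p)); apply: measurableT_comp => //; apply/measurable_EFinP.
  by move=> x _; rewrite ger0_norm ?powR_ge0// -poweR_EFin -abse_EFin.
split => //.
- have [_ iS] := Rintegral_sum iv.
  apply: (integrable_le (G := fun x => n%:R `^ p * \sum_i `|v i x| `^ p)).
  + exact: measurable_enorm_powR.
  + move=> x; rewrite ger0_norm ?powR_ge0//.
    have := enorm_powR_le_sum (\row_i v i x) p1.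
    by under eq_bigr do rewrite mxE.
  + exact: (integrableZl measurableT (n%:R `^ p) iS).
- move=> i phi tphi; have [[_ ->//] _] := vP i.
  by congr (- _); apply: eq_Rintegral => x _; rewrite mxE.
Qed.

Lemma test_sobolev p phi : 1 <= p -> test_function phi ->
  sobolev p phi (fun x => \row_i partial i phi x).
Proof.
move=> p1 tphi; have p0 : 0 <= p by rewrite (le_trans _ p1).
have mp i := continuous_measurable_row (test_continuous (test_partial i tphi)).
have mg : measurable_fun setT (fun x => \row_i partial i phi x : 'rV[R]_n).
  by apply: measurable_fun_coord => i; under eq_fun do rewrite mxE; exact: mp.
split => //.
- exact: test_continuous.
- have /choice [C CP] i : exists C, 0 <= C /\ forall x, `|partial i phi x| <= C.
    have tp := test_partial i tphi.
    by have [C C0 hC] := continuous_bsupp_bounded (test_continuous tp) (test_bsupp tp); exists C.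
  pose K := \sum_i C i.
  have K0 : 0 <= K by apply: sumr_ge0 => i _; case: (CP i).
  apply: (@integrable_bsupp R n _ ((n%:R * K) `^ p)).
  + exact: measurable_enorm_powR.
  + have [N phiN] := test_bsupp tphi; exists N => x xN.
    rewrite (_ : \row_i _ = 0) ?enorm0 ?powR0 ?gt_eqF ?(lt_le_trans _ p1)//.
    by apply/rowP => i; rewrite !mxE (partial_eq0 i phiN).
  + move=> x; rewrite ger0_norm ?powR_ge0// le_powR ?enorm_ge0//.
    rewrite (le_trans (enorm_le_norm _))// ler_wpM2l//.
    apply: row_norm_le => // i; rewrite mxE.
    have [Ci0 hCi] := CP i; rewrite (le_trans (hCi x))// /K (bigD1 i)//= lerDl.
    by apply: sumr_ge0 => j _; case: (CP j).
- move=> i psi tpsi; rewrite test_ibp//; congr (- _); apply: eq_Rintegral => x _.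
  by rewrite mxE.
Qed.

Lemma sobolev_bump p : 1 <= p -> exists u g, [/\ sobolev p u g, u 0 = 1,
  forall x, 0 <= u x & forall x, 1 <= enorm x -> u x = 0].
Proof.
move=> p1; have [_ [b [[_ sb] _ _ [_ bge] [bsup b0]]]] := @smooth_step R.
(* The Euclidean norm is at most n times the sup norm, so a cube of half-side 1/(n+1) lies inside
   the unit ball. *)
pose c : R := n.+1%:R.
have c0 : 0 < c by rewrite ltr0n.
pose F (_ : 'I_n) t := (b 0)^-1 * b (c * t + 0).
have FN j t : c^-1 <= `|t| -> F j t = 0.
  move=> ct; have h : 1 <= `|c * t|.
    by rewrite normrM gtr0_norm// -ler_pdivrMl// mulr1.
  by rewrite /F addr0 (bsup _ h) mulr0.
have tF : test_function (prodf F).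
  apply: (@test_prodf R n F c^-1); first by rewrite invr_ge0 ltW.
    by move=> j; apply: smooth1M; [exact: smooth1_cst|exact: smooth1_aff].
  by move=> j t /ltW; exact: FN.
exists (prodf F), (fun x => \row_i partial i (prodf F) x); split.
- exact: test_sobolev.
- rewrite /prodf big1// => j _; rewrite /F mxE mulr0 addr0 mulVf// gt_eqF//.
- by move=> x; apply: prodr_ge0 => j _; rewrite mulr_ge0// invr_ge0 ltW.
- move=> x x1.
  have [/forallP h|] := boolP [forall j, `|x ord0 j| < c^-1].
    exfalso; move: x1; apply/negP; rewrite -ltNge.
    rewrite (le_lt_trans (enorm_le_norm _))//.
    have c'0 : 0 < c^-1 by rewrite invr_gt0.
    have xc : `|x| < c^-1 by exact: row_norm_lt.
    rewrite (@le_lt_trans _ _ (n%:R * c^-1))//; first by rewrite ler_wpM2l// ltW.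
    by rewrite ltr_pdivrMr// mul1r ltr_nat.
  rewrite negb_forall => /existsP[j]; rewrite -leNgt => jN.
  by rewrite /prodf (bigD1 j)//= FN// mul0r.
Qed.

End sobolev_D1p.

(** * Morrey's inequality *)

Section test_integrals.
Context {R : realType} {n : nat}.
Local Notation mu := (@lebesgue_row R n).
Implicit Types (x y z a : 'rV[R]_n) (u v phi : 'rV[R]_n -> R)
  (g k : 'rV[R]_n -> 'rV[R]_n) (i : 'I_n).
Variable p : R.
Hypothesis p1 : 1 <= p.

Lemma continuous_test_integrable u phi : continuous u -> test_function phi ->
  mu.-integrable setT (EFin \o (fun x => u x * phi x)).
Proof.
move=> cu tphi; exact: locint_integrableMc (continuous_locint cu) (test_continuous tphi) (test_bsupp tphi).
Qed.

Lemma Rintegral_indic_cball N : \int[mu]_x (\1_(cball N) x : R) = fine (mu (cball N)).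
Proof. by rewrite /Rintegral integral_indic ?setIT//; exact: measurable_cball. Qed.

Lemma integrable_indic_cball N :
  mu.-integrable setT (EFin \o (\1_(cball N) : 'rV[R]_n -> R)).
Proof.
apply: (@integrable_bsupp R n _ 1).
- by apply: measurable_indic; exact: measurable_cball.
- exists N => x xN; rewrite indicE memNset//= => xN'.
  by move: xN; rewrite ltNge xN'.
- by move=> x; rewrite indicE; case: (_ \in _); rewrite ?normr1 ?normr0.
Qed.

(** The bound |g_i| <= 1 + |g|^p on the support replaces Hoelder's inequality. It is not
    homogeneous, hence the normalized energy, which [product_test_leZ] removes by scaling. *)
Lemma sobolev_test_le u g i phi N C : sobolev p u g -> energy p g <= 1 ->
  test_function phi -> (forall x, N < `|x| -> phi x = 0) ->
  (forall x, `|phi x| <= C) ->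
  `|\int[mu]_x (u x * partial i phi x)| <= C * (fine (mu (cball N)) + 1).
Proof.
move=> ug J1 tphi phiN phiC; have [_ _ ig wu] := ug.
have C0 : 0 <= C by rewrite (le_trans _ (phiC 0)).
have [i1 _] := sobolev_integrable i p1 ug tphi.
rewrite wu// normrN (le_trans (le_normr_Rintegral measurableT i1))//.
have iN := integrable_indic_cball N.
pose G x : R := \1_(cball N) x + enorm (g x) `^ p.
have iG : mu.-integrable setT (EFin \o G) := integrableD measurableT iN ig.
have iCG : mu.-integrable setT (EFin \o (fun x => C * G x)) := integrableZl measurableT C iG.
have hle : \int[mu]_x `|g x ord0 i * phi x| <= \int[mu]_x (C * G x).
  apply: (le_Rintegral measurableT); [exact: integrable_norm i1|exact: iCG|].
  move=> x _; rewrite normrM mulrC.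
  have [xN|xN] := leP `|x| N; last first.
    by rewrite phiN// normr0 mul0r mulr_ge0// addr_ge0 ?powR_ge0// indicE.
  rewrite ler_pM// /G indicE mem_set//= mulr1n.
  by rewrite (le_trans (coord_le_enorm _ _))// le_1_powR// enorm_ge0.
apply: (le_trans hle).
rewrite (RintegralZl C measurableT iG) ler_wpM2l//.
have := @RintegralD _ _ _ mu setT _ _ measurableT iN ig.
rewrite /G => ->; rewrite Rintegral_indic_cball lerD2l; exact: J1.
Qed.

(** Exchanging the factors of a product one coordinate at a time makes the difference telescope.
    Each increment is a partial derivative of a test function, since the difference of the exchanged
    factors has the compactly supported primitive [B j]. *)
Lemma product_test_le (f0 f1 B : 'I_n -> R -> R) (N C : R) :
  0 <= N -> 0 <= C ->
  (forall j, [/\ smooth1 (f0 j), smooth1 (f1 j) & smooth1 (B j)]) ->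
  (forall j (t : R), is_derive t 1 (B j) (f0 j t - f1 j t)) ->
  (forall j t, N < `|t| -> [/\ f0 j t = 0, f1 j t = 0 & B j t = 0]) ->
  (forall j t, [/\ `|f0 j t| <= C, `|f1 j t| <= C & `|B j t| <= C]) ->
  forall u g, sobolev p u g -> energy p g <= 1 ->
  `|\int[mu]_x (u x * prodf f0 x) - \int[mu]_x (u x * prodf f1 x)| <=
    n%:R * (C ^+ n * (fine (mu (cball N)) + 1)).
Proof.
move=> N0 C0 sm dB supp bd u g ug J1; have [cu _ _ _] := ug.
(* In [F k] the first k factors are exchanged; [P i] carries the primitive in place of the factor of
   index i. *)
pose F (k : nat) (j : 'I_n) := if (j < k)%N then f1 j else f0 j.
pose P (i : 'I_n) (j : 'I_n) := if j == i then B i else F i j.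
have sF (k : nat) j : smooth1 (F k j) by rewrite /F; case: ifP => _; case: (sm j).
have FN (k : nat) j (t : R) : N < `|t| -> F k j t = 0.
  by move=> /(supp j) []; rewrite /F; case: ifP.
have tF (k : nat) : test_function (prodf (F k)) by exact: test_prodf N0 (sF k) (FN k).
have sP i j : smooth1 (P i j).
  by rewrite /P; case: eqP => [_|_]; [case: (sm i)|exact: sF].
have PN i j (t : R) : N < `|t| -> P i j t = 0.
  by move=> tN; rewrite /P; case: eqP => [_|_]; [case: (supp i _ tN)|exact: FN].
have tP i : test_function (prodf (P i)) by exact: test_prodf N0 (sP i) (PN i).
have PC i j (t : R) : `|P i j t| <= C.
  by rewrite /P /F; case: eqP => _; [|case: ifP => _]; [case: (bd i t)|case: (bd j t)..].
have dP i : partial i (prodf (P i)) = fun x => prodf (F i) x - prodf (F i.+1) x.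
  have dj j : exists P', forall t : R, is_derive t 1 (P i j) (P' t).
    by have [P' _ dP'] := smooth1_is_derive (sP i j); exists P'.
  have /choice [P' dP'] : forall j, exists P', (forall t : R, is_derive t 1 (P i j) (P' t)).
    exact: dj.
  apply: is_derive_partial => x; have := is_derive_prodf i x dP'.
  suff -> : prodf (fun j => if j == i then P' j else P i j) x =
    prodf (F i) x - prodf (F i.+1) x by [].
  rewrite /prodf !(bigD1 i (P := xpredT))//= eqxx.
  have -> : P' i (x ord0 i) = f0 i (x ord0 i) - f1 i (x ord0 i).
    apply: (is_derive_unique (dP' i _)); rewrite /P eqxx; exact: dB.
  rewrite mulrBl {1 3}/F ltnn ltnSn; congr (_ * _ - _ * _); apply: eq_bigr => j /negbTE ji.
    by rewrite ji /P ji.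
  by rewrite ji /P ji /F ltnS [in RHS]leq_eqVlt val_eqE ji.
pose A (k : nat) := \int[mu]_x (u x * prodf (F k) x).
have AE (i : 'I_n) : A i - A i.+1 = \int[mu]_x (u x * partial i (prodf (P i)) x).
  rewrite /A -(RintegralB measurableT (continuous_test_integrable cu (tF i))
    (continuous_test_integrable cu (tF i.+1))).
  by apply: eq_Rintegral => x _; rewrite dP mulrBr.
have PsuppN i x : N < `|x| -> prodf (P i) x = 0.
  move=> xN.
  have [/forallP h|] := boolP [forall j, `|x ord0 j| <= N].
    by have := row_norm_le N0 h; rewrite leNgt xN.
  rewrite negb_forall => /existsP[j]; rewrite -ltNge => jN.
  by rewrite /prodf (bigD1 j)//= PN// mul0r.
have -> : \int[mu]_x (u x * prodf f0 x) = A 0%N by [].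
have -> : \int[mu]_x (u x * prodf f1 x) = A n.
  apply: eq_Rintegral => x _; congr (_ * _); apply: eq_bigr => j _.
  by rewrite /F ltn_ord.
rewrite distrC -(telescope_sumr _ (leq0n n)) big_mkord.
rewrite (le_trans (ler_norm_sum _ _ _))//.
have -> : n%:R * (C ^+ n * (fine (mu (cball N)) + 1)) =
    \sum_(i < n) (C ^+ n * (fine (mu (cball N)) + 1)).
  by rewrite sumr_const card_ord mulr_natl.
apply: ler_sum => i _; rewrite distrC AE.
exact: (@sobolev_test_le u g i (prodf (P i)) N (C ^+ n) ug J1 (tP i) (PsuppN i)
  (fun x => prodf_le x C0 (PC i))).
Qed.

Lemma product_test_leZ (f0 f1 B : 'I_n -> R -> R) (N C : R) :
  0 <= N -> 0 <= C ->
  (forall j, [/\ smooth1 (f0 j), smooth1 (f1 j) & smooth1 (B j)]) ->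
  (forall j (t : R), is_derive t 1 (B j) (f0 j t - f1 j t)) ->
  (forall j t, N < `|t| -> [/\ f0 j t = 0, f1 j t = 0 & B j t = 0]) ->
  (forall j t, [/\ `|f0 j t| <= C, `|f1 j t| <= C & `|B j t| <= C]) ->
  forall u g (c : R), sobolev p u g -> 0 < c -> energy p g <= c `^ p ->
  `|\int[mu]_x (u x * prodf f0 x) - \int[mu]_x (u x * prodf f1 x)| <=
    n%:R * (C ^+ n * (fine (mu (cball N)) + 1)) * c.
Proof.
move=> N0 C0 sm dB supp bd u g c ug c0 Jc; have [cu _ _ _] := ug.
have cpos : 0 < c `^ p by rewrite powR_gt0.
have J1 : energy p (fun x => c^-1 *: g x) <= 1.
  rewrite (energyZ c^-1 ug) gtr0_norm ?invr_gt0// -[c^-1]powR_inv1 ?(ltW c0)//.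
  rewrite -powRrM mulN1r powRN mulrC ler_pdivrMr// mul1r; exact: Jc.
have tf (f : 'I_n -> R -> R) : (forall j, smooth1 (f j)) ->
    (forall j t, N < `|t| -> f j t = 0) ->
    \int[mu]_x (c^-1 * u x * prodf f x) = c^-1 * \int[mu]_x (u x * prodf f x).
  move=> sf fN; have tp := test_prodf N0 sf fN.
  rewrite -(RintegralZl c^-1 measurableT (continuous_test_integrable cu tp)).
  by apply: eq_Rintegral => x _; rewrite mulrA.
have := product_test_le N0 C0 sm dB supp bd (sobolevZ c^-1 p1 ug) J1.
rewrite (tf f0); [|by move=> j; case: (sm j)|by move=> j t /(supp j) []].
rewrite (tf f1); [|by move=> j; case: (sm j)|by move=> j t /(supp j) []].
by rewrite -mulrBr normrM gtr0_norm ?invr_gt0// mulrC ler_pdivrMr.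
Qed.

Lemma Rintegral_gt0 u : continuous u -> (forall x, 0 <= u x) -> 0 < u 0 ->
  mu.-integrable setT (EFin \o u) -> 0 < \int[mu]_x u x.
Proof.
move=> cu u0 upos iu; have u2 : 0 < u 0 / 2 by rewrite divr_gt0.
have [d [d0 hd]] := (continuous_rowP u).1 cu 0 _ u2.
have d2 : 0 < d / 2 by rewrite divr_gt0.
have iT := integrable_similitude 0 (similitude_scalar d2) iu.
have E := Rintegral_similitude 0 (similitude_scalar d2) iu.
rewrite -(@pmulr_rgt0 _ ((d / 2) ^- n)) ?invr_gt0 ?exprn_gt0// -E.
have iN := integrable_indic_cball 1.
apply: (@lt_le_trans _ _ (\int[mu]_x (u 0 / 2 * \1_(cball 1) x))).
  rewrite (RintegralZl (u 0 / 2) measurableT iN) mulr_gt0// Rintegral_indic_cball.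
  rewrite fine_gt0// lebesgue_cball_lty andbT (lt_le_trans (@lebesgue_eball_gt0 R n))//.
  apply: le_measure; rewrite ?inE; [exact: measurable_eball|exact: measurable_cball|].
  by move=> x /ltW; exact: le_trans (norm_le_enorm x).
apply: (le_Rintegral measurableT).
- exact: (integrableZl measurableT (u 0 / 2) iN).
- exact: iT.
move=> x _; rewrite indicE; case: (boolP (x \in cball 1)) => [|_]; last by rewrite mulr0.
rewrite inE /cball/= => x1; rewrite mulr1.
have : `|u 0 - u (d / 2 *: x)| < u 0 / 2.
  apply: hd; rewrite sub0r normrN mx_normZ gtr0_norm//.
  by rewrite (le_lt_trans (ler_pM _ _ (lexx _) x1))// ?(ltW d2)//; lra.
rewrite /aff add0r mul_mx_scalar => /ltr_normlP[]; lra.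
Qed.

Lemma is_derive_aff_comp (c d : R) (f f' : R -> R) :
  (forall t : R, is_derive t 1 f (f' t)) ->
  forall t : R, is_derive t 1 (fun t : R => f (c * t + d)) (c * f' (c * t + d)).
Proof.
move=> ff' t.
have daff : is_derive t 1 (fun t => c * t + d) c.
  have := @is_deriveD _ _ _ (fun t => c * t) (cst d) t 1 _ _
    (@is_deriveZ _ _ _ id c t 1 1 (is_derive_id _ _)) (is_derive_cst d t 1).
  by rewrite addr0 -[c *: (1 : R)]/(c * 1) mulr1.
rewrite mulrC; exact: (@is_derive1_comp R f (fun t => c * t + d) t _ _ (ff' _) daff).
Qed.

Lemma continuous_scale_row (c : R) : continuous (fun x => c *: x).
Proof.
rewrite (_ : (fun x => _) = aff 0 c%:M); first exact: continuous_aff.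
by apply/funext => x; rewrite /aff add0r mul_mx_scalar.
Qed.

End test_integrals.

(** * Morrey's inequality by dyadic averages *)

Section morrey.
Context {R : realType} {n : nat}.
Local Notation mu := (@lebesgue_row R n).
Implicit Types (x y z a : 'rV[R]_n) (u v phi : 'rV[R]_n -> R)
  (g k : 'rV[R]_n -> 'rV[R]_n) (i : 'I_n).
Variable p : R.
Hypothesis p1 : 1 <= p.
Hypothesis np : n%:R < p.

Lemma dist_le_weighted (m A B X Y K1 K2 c : R) : 0 < m -> `|A - m * X| <= K2 * c ->
  `|A - B| <= K1 * c -> `|B - m * Y| <= K2 * c -> `|X - Y| <= (K1 + 2 * K2) / m * c.
Proof.
move=> m0 /ler_normlP[h11 h12] /ler_normlP[h21 h22] /ler_normlP[h31 h32].
have -> : (K1 + 2 * K2) / m * c = (K1 * c + 2 * (K2 * c)) / m by ring.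
rewrite ler_pdivlMr// -[X in _ * X <= _](gtr0_norm m0) -normrM ler_norml.
by rewrite mulrBl (mulrC X) (mulrC Y); lra.
Qed.

Section mollifier.
Variables beta b : R -> R.
Hypothesis sbeta : smooth1 beta.
Hypothesis sb : smooth1 b.
Hypothesis dbeta : forall t : R, is_derive t 1 beta (b t).
Hypothesis beta0 : forall t, t <= -1 -> beta t = 0.
Hypothesis beta1 : forall t, 1 <= t -> beta t = 1.
Hypothesis beta01 : forall t, 0 <= beta t <= 1.
Hypothesis b_ge0 : forall t, 0 <= b t.
Hypothesis bsup : forall t, 1 <= `|t| -> b t = 0.
Hypothesis b0 : 0 < b 0.

Let rho := prodf (fun _ : 'I_n => b).

Let b_bounded : exists2 C, 1 <= C & forall t, `|b t| <= C.
Proof.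
have cb : continuous b by exact: smooth1_continuous.
have : compact (b @` `[-1, 1]).
  by apply: continuous_compact; [exact: continuous_subspaceT|exact: segment_compact].
move=> /compact_bounded [C [_ hC]].
exists (`|C| + 1); first by rewrite lerDr.
move=> t; have [t1|t1] := leP 1 `|t|; first by rewrite bsup// normr0 addr_ge0.
apply: (hC (`|C| + 1)); first by rewrite (le_lt_trans (ler_norm C))// ltrDl.
by exists t => //=; rewrite in_itv/= -ler_norml ltW.
Qed.

Let trho : test_function rho.
Proof. by apply: (@test_prodf R n _ 1) => // j t /ltW; exact: bsup. Qed.

Let rho_ge0 x : 0 <= rho x.
Proof. by apply: prodr_ge0. Qed.

Let rho_eq0 x : 1 < `|x| -> rho x = 0.
Proof.
move=> x1; have [/forallP h|] := boolP [forall j, `|x ord0 j| <= 1].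
  by have := row_norm_le ler01 h; rewrite leNgt x1.
rewrite negb_forall => /existsP[j]; rewrite -ltNge => /ltW jN.
by rewrite /rho /prodf (bigD1 j)//= bsup// mul0r.
Qed.

Let rho_at0 : 0 < rho 0.
Proof. by apply: prodr_gt0 => j _; rewrite mxE. Qed.

Let irho : mu.-integrable setT (EFin \o rho).
Proof.
have := @continuous_test_integrable R n (fun=> 1) rho (@continuous_cst_row R n 1) trho.
by congr (_.-integrable _ _); apply/funext => x /=; rewrite mul1r.
Qed.

Let mass := \int[mu]_x rho x.

Let mass_gt0 : 0 < mass := Rintegral_gt0 (test_continuous trho) rho_ge0 rho_at0 irho.

Let moll u := \int[mu]_x (u x * rho x).

Let iu u : continuous u -> mu.-integrable setT (EFin \o (fun x => u x * rho x)).
Proof. by move=> cu; exact: continuous_test_integrable cu trho. Qed.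

(** Averaging u(x/2) against [b] amounts to averaging [u] against 2 b(2t) in each variable; the
    difference of the two profiles has the primitive beta(t) - beta(2t), which is compactly
    supported because both profiles have the same integral. *)
Let moll_half : exists2 K, 0 <= K & forall u g c, sobolev p u g -> 0 < c ->
  energy p g <= c `^ p -> `|moll u - moll (fun x => u (2^-1 *: x))| <= K * c.
Proof.
have [C C1 bC] := b_bounded.
have C0 : 0 <= C by exact: le_trans C1.
(* Twice the bound of [b], for the rescaled profile. *)
pose C' := 2 * C.
have CC' : C <= C' by rewrite /C' ler_peMl// ler1n.
have C'0 : 0 <= C' by exact: le_trans CC'.
exists (n%:R * (C' ^+ n * (fine (mu (cball 1)) + 1))).
  by rewrite !mulr_ge0 ?exprn_ge0// addr_ge0// fine_ge0.
move=> u g c ug c0 Jc; have [cu _ _ _] := ug.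
pose f1 (_ : 'I_n) (t : R) := 2 * b (2 * t + 0).
pose B (_ : 'I_n) (t : R) := beta t - beta (2 * t + 0).
have norm2 (t : R) : 1 < `|t| -> 1 <= `|2 * t + 0|.
  by move=> t1; rewrite addr0 normrM gtr0_norm//; lra.
have := @product_test_leZ R n p p1 (fun=> b) f1 B 1 C' ler01 C'0 _ _ _ _ u g c ug c0 Jc.
have -> : \int[mu]_x (u x * prodf f1 x) = moll (fun x => u (2^-1 *: x)).
  have i1 := iu (continuous_row_comp (@continuous_scale_row R n 2^-1) cu).
  have t0 : 0 < (2 : R) by [].
  have := Rintegral_similitude 0 (similitude_scalar t0) i1.
  rewrite -/(moll _) => /(congr1 (fun r => 2 ^+ n * r)).
  rewrite mulrA divff ?expf_neq0// mul1r => <-.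
  have i2 := integrable_similitude 0 (similitude_scalar t0) i1.
  rewrite -(RintegralZl (2 ^+ n) measurableT i2); apply: eq_Rintegral => x _.
  have affE : aff 0 2%:M x = 2 *: x by rewrite /aff add0r mul_mx_scalar.
  rewrite /= affE scalerA mulVf// scale1r mulrCA; congr (_ * _).
  rewrite /rho /prodf big_split/= prodr_const card_ord; congr (_ * _).
  by apply: eq_bigr => j _; rewrite mxE addr0.
apply.
- move=> j; split; first exact: sb.
    by apply: smooth1M; [exact: smooth1_cst|exact: smooth1_aff].
  apply: smooth1D => //; rewrite (_ : (fun t => _) = fun t => -1 * beta (2 * t + 0)).
    by apply: smooth1M; [exact: smooth1_cst|exact: smooth1_aff].
  by apply/funext => t; rewrite mulN1r.
- move=> j t; rewrite /B /f1.
  have d2 := is_derive_aff_comp 2 0 dbeta t.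
  exact: is_deriveB.
- move=> j t t1; rewrite /f1 /B (bsup (ltW t1)) (bsup (norm2 _ t1)) mulr0; split => //.
  move: t1; rewrite ltr_normr => /orP[t1|t1].
    by rewrite !beta1 ?subrr//; lra.
  by rewrite !beta0 ?subrr//; lra.
- move=> j t; rewrite /f1 /B normrM gtr0_norm//; split.
  + exact: le_trans CC'.
  + by rewrite ler_wpM2l.
  + have /andP[h1 h2] := beta01 t; have /andP[h3 h4] := beta01 (2 * t + 0).
    by rewrite (le_trans _ (le_trans C1 CC'))// ler_norml; lra.
Qed.

(** As for [moll_half], with translated profiles and the primitives beta(t) - beta(t - y_j), all
    supported in [-2, 2]. *)
Let moll_shift : exists2 K, 0 <= K & forall u g c y, sobolev p u g -> 0 < c ->
  energy p g <= c `^ p -> `|y| <= 1 -> `|moll u - moll (fun x => u (x + y))| <= K * c.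
Proof.
have [C C1 bC] := b_bounded.
have C0 : 0 <= C by exact: le_trans C1.
exists (n%:R * (C ^+ n * (fine (mu (cball 2)) + 1))).
  by rewrite !mulr_ge0 ?exprn_ge0// addr_ge0// fine_ge0.
move=> u g c y ug c0 Jc y1; have [cu _ _ _] := ug.
pose f1 (j : 'I_n) (t : R) := b (1 * t + - y ord0 j).
pose B (j : 'I_n) (t : R) := beta t - beta (1 * t + - y ord0 j).
have yj j : -1 <= y ord0 j <= 1.
  by rewrite -ler_norml (le_trans (coord_ler_norm y j)).
have norm2 j (t : R) : 2 < `|t| -> 1 <= `|1 * t + - y ord0 j|.
  move=> t1; have /andP[h1 h2] := yj j; rewrite mul1r ler_normr.
  by move: t1; rewrite ltr_normr => /orP[t1|t1]; apply/orP; [left|right]; lra.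
have := @product_test_leZ R n p p1 (fun=> b) f1 B 2 C (ler0n R 2) C0 _ _ _ _ u g c ug c0 Jc.
have -> : \int[mu]_x (u x * prodf f1 x) = moll (fun x => u (x + y)).
  have tr1 : test_function (prodf f1).
    apply: (@test_prodf R n _ 2) => // [j|j t t2]; first exact: smooth1_aff.
    by rewrite /f1 bsup// norm2.
  rewrite -(Rintegral_translate y (continuous_test_integrable cu tr1)).
  apply: eq_Rintegral => x _; congr (_ * _).
  by apply: eq_bigr => j _; rewrite /f1 mxE mul1r addrK.
apply.
- move=> j; split; [exact: sb|exact: smooth1_aff|].
  apply: smooth1D => //; rewrite (_ : (fun t => _) = fun t => -1 * beta (1 * t + - y ord0 j)).
    by apply: smooth1M; [exact: smooth1_cst|exact: smooth1_aff].
  by apply/funext => t; rewrite mulN1r.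
- move=> j t; rewrite /B /f1.
  have d2 := is_derive_aff_comp 1 (- y ord0 j) dbeta t.
  by rewrite mul1r in d2; exact: is_deriveB.
- move=> j t t1; have t1' : 1 <= `|t| by lra.
  rewrite /f1 /B (bsup t1') (bsup (norm2 j _ t1)); split => //.
  have /andP[h1 h2] := yj j.
  move: t1; rewrite ltr_normr => /orP[t1|t1].
    by rewrite !beta1 ?subrr//; lra.
  by rewrite !beta0 ?subrr//; lra.
- move=> j t; rewrite /f1 /B; split; [exact: bC|exact: bC|].
  have /andP[h1 h2] := beta01 t; have /andP[h3 h4] := beta01 (1 * t + - y ord0 j).
  by rewrite (le_trans _ C1)// ler_norml; lra.
Qed.

(** The factor by which the p-th root of the energy shrinks when u(x) is replaced by u(x/2); it is
    less than 1 because p > n. *)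
Let th : R := 2^-1 `^ (1 - n%:R / p).

(** The averages of u(x/2^k) tend to [mass * u 0] by continuity, and by [moll_half] consecutive ones
    differ by at most K th^k c, so the total difference is bounded by a geometric series. *)
Let moll_point : exists2 K, 0 <= K & forall u g c, sobolev p u g -> 0 < c ->
  energy p g <= c `^ p -> `|moll u - mass * u 0| <= K * c.
Proof.
have p0 : 0 < p by exact: lt_le_trans p1.
have al0 : 0 < 1 - n%:R / p by rewrite subr_gt0 ltr_pdivrMr// mul1r.
have th0 : 0 < th by rewrite powR_gt0.
have th1 : th < 1.
  have <- : 1 `^ (1 - n%:R / p) = 1 :> R by rewrite powR1.
  rewrite gt0_ltr_powR ?nnegrE//.
  by rewrite invf_lt1 ?ltr1n.
have thp : th `^ p = 2^-1 `^ p * (2^-1) ^- n.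
  rewrite -powRrM mulrBl mul1r divfK ?gt_eqF// powRB; last by rewrite invr_eq0 pnatr_eq0 implybT.
  by rewrite powR_mulrn.
have [K K0 half] := moll_half.
exists (K / (1 - th)); first by rewrite divr_ge0// subr_ge0 ltW.
move=> u g c ug c0 Jc; have [cu _ _ _] := ug.
have step (k : nat) : exists g', sobolev p (fun x => u (2^-1 ^+ k *: x)) g' /\
    energy p g' <= (th ^+ k * c) `^ p.
  elim: k => [|k [g' [sg' Jg']]].
    by exists g; split; [under eq_fun do rewrite scale1r|rewrite mul1r].
  have h0 : 0 < (2^-1 : R) by [].
  have [s1 J1] := sobolev_similitude 0 p1 (similitude_scalar h0) sg'.
  exists (fun x => g' (aff 0 2^-1%:M x) *m (2^-1%:M)^T); split.
    suff <- : ((fun x => u (2^-1 ^+ k *: x)) \o aff 0 2^-1%:M) =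
      (fun x => u (2^-1 ^+ k.+1 *: x)) by exact: s1.
    by apply/funext => x /=; rewrite /aff add0r mul_mx_scalar scalerA -exprSr.
  rewrite J1 exprS -(mulrA th) [leRHS]powRM ?(ltW th0)//; last by rewrite ltW// mulr_gt0// exprn_gt0.
  by rewrite thp ler_wpM2l// mulr_ge0 ?powR_ge0// invr_ge0 exprn_ge0.
pose a (k : nat) := moll (fun x => u (2^-1 ^+ k *: x)).
have aS (k : nat) : `|a k - a k.+1| <= K * (th ^+ k * c).
  have [g' [sg' Jg']] := step k.
  have := half _ _ _ sg' _ Jg'; rewrite mulr_gt0 ?exprn_gt0// => /(_ isT).
  suff -> : a k.+1 = moll (fun x => u (2^-1 ^+ k *: (2^-1 *: x))) by [].
  by congr moll; apply/funext => x; rewrite scalerA -exprSr.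
have aB (k : nat) : `|a 0%N - a k| <= K / (1 - th) * c * (1 - th ^+ k).
  elim: k => [|k IH]; first by rewrite subrr normr0 expr0 subrr mulr0.
  rewrite -(subrKA (a k)) (le_trans (ler_normD _ _))//.
  rewrite (le_trans (lerD IH (aS k)))// le_eqVlt; apply/orP; left; apply/eqP.
  by rewrite exprS; field; rewrite subr_eq0 gt_eqF.
apply/ler_addgt0Pr => e e0.
have e'0 : 0 < e / mass by rewrite divr_gt0.
have [d [d0 hd]] := (continuous_rowP u).1 cu 0 _ e'0.
have [k kd] : exists k : nat, (2^-1 : R) ^+ k < d.
  have : (fun k : nat => (2^-1 : R) ^+ k) @ \oo --> (0 : R).
    by apply: cvg_expr; rewrite ger0_norm// invf_lt1// ltr1n.
  move=> /cvgrPdist_lt /(_ d d0) [N _ /(_ N (leqnn N))].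
  by rewrite sub0r normrN ger0_norm ?exprn_ge0// => h; exists N.
have ik := iu (continuous_row_comp (@continuous_scale_row R n (2^-1 ^+ k)) cu).
have im : mu.-integrable setT (EFin \o (fun x => u 0 * rho x)).
  exact: (integrableZl measurableT (u 0) irho).
have ak : `|a k - mass * u 0| <= e.
  have -> : a k - mass * u 0 = \int[mu]_x (u (2^-1 ^+ k *: x) * rho x - u 0 * rho x).
    by rewrite (RintegralB measurableT ik im) (RintegralZl (u 0) measurableT irho) [mass * _]mulrC.
  have id := integrableB measurableT ik im.
  rewrite (le_trans (le_normr_Rintegral measurableT id))//.
  have -> : e = \int[mu]_x (e / mass * rho x).
    by rewrite (RintegralZl (e / mass) measurableT irho) divfK// gt_eqF.
  apply: (le_Rintegral measurableT).
  - exact: integrable_norm id.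
  - exact: (integrableZl measurableT (e / mass) irho).
  move=> x _; rewrite -mulrBl normrM (ger0_norm (rho_ge0 x)).
  have [x1|x1] := leP `|x| 1; last by rewrite rho_eq0// !mulr0.
  rewrite ler_wpM2r// distrC ltW// hd// sub0r normrN.
  by rewrite mx_normZ ger0_norm ?exprn_ge0// (le_lt_trans _ kd)// ler_piMr// exprn_ge0.
have -> : moll u = a 0%N by congr moll; apply/funext => x; rewrite expr0 scale1r.
rewrite -(subrKA (a k)) (le_trans (ler_normD _ _))// lerD//.
rewrite (le_trans (aB k))// ler_piMr//; last by rewrite gerBl exprn_ge0// ltW.
by rewrite mulr_ge0 ?(ltW c0)// divr_ge0// subr_ge0 ltW.
Qed.

Lemma morrey_mollifier : exists2 K, 0 <= K & forall u g c y, sobolev p u g -> 0 < c ->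
  energy p g <= c `^ p -> `|y| <= 1 -> `|u 0 - u y| <= K * c.
Proof.
have [K1 K10 h1] := moll_shift; have [K2 K20 h2] := moll_point.
exists ((K1 + 2 * K2) / mass); first by rewrite divr_ge0 ?(ltW mass_gt0)// addr_ge0// mulr_ge0.
move=> u g c y ug c0 Jc y1.
have [s1 J1] := sobolev_similitude y p1 (similitude_scalar ltr01) ug.
have sE : u \o aff y 1%:M = fun x => u (x + y).
  by apply/funext => x /=; rewrite /aff mulmx1 addrC.
rewrite sE in s1; rewrite powR1 expr1n invr1 !mul1r in J1; rewrite -J1 in Jc.
have := h2 _ _ _ s1 c0 Jc; rewrite add0r => b2.
rewrite J1 in Jc; have b1 := h2 _ _ _ ug c0 Jc; have b3 := h1 _ _ _ _ ug c0 Jc y1.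
exact: (dist_le_weighted mass_gt0 b1 b3 b2).
Qed.

End mollifier.

(** The general case reduces to x = 0 and |x - y| = 1 by an affine change of variables. The bound on
    the p-th root of the energy is a separate [c > 0], so that functions of zero energy need no
    special treatment. *)
Lemma morrey : exists2 K, 0 <= K & forall u g x y c, sobolev p u g -> 0 < c ->
  energy p g <= c `^ p -> `|u x - u y| <= K * (enorm (x - y) `^ (1 - n%:R / p) * c).
Proof.
have [beta [b [[sbeta sb] dbeta [beta0 beta1] [beta01 bge] [bsup b0]]]] := @smooth_step R.
have [K K0 hK] := morrey_mollifier sbeta sb dbeta beta0 beta1 beta01 bge bsup b0.
exists K => // u g x y c ug c0 Jc.
have [->|xy] := eqVneq x y; first by rewrite subrr normr0 !mulr_ge0 ?powR_ge0 ?(ltW c0).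
set r := enorm (x - y).
have r0 : 0 < r by apply: enorm_gt0; rewrite subr_eq0.
have p0 : 0 < p by exact: lt_le_trans p1.
have [s1 J1] := sobolev_similitude x p1 (similitude_scalar r0) ug.
have c'0 : 0 < r `^ (1 - n%:R / p) * c by rewrite mulr_gt0 ?powR_gt0.
have Jc' : energy p (fun z => g (aff x r%:M z) *m (r%:M)^T) <= (r `^ (1 - n%:R / p) * c) `^ p.
  rewrite J1 powRM ?powR_ge0 ?(ltW c0)// -powRrM mulrBl mul1r divfK ?gt_eqF//.
  rewrite powRB; last by rewrite (gt_eqF r0) implybT.
  by rewrite powR_mulrn ?(ltW r0)// ler_wpM2l// mulr_ge0 ?powR_ge0// invr_ge0 exprn_ge0// ltW.
have := hK _ _ _ (r^-1 *: (y - x)) s1 c'0 Jc'; rewrite /aff/= !mul_mx_scalar scaler0 addr0.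
have -> : x + r *: (r^-1 *: (y - x)) = y.
  by rewrite scalerA divff ?gt_eqF// scale1r addrC subrK.
apply; rewrite (le_trans (norm_le_enorm _))// enormZ gtr0_norm ?invr_gt0// enormB.
by rewrite mulVf// gt_eqF.
Qed.

Lemma sobolev_holder u g : sobolev p u g -> holder_continuous (1 - n%:R / p) u.
Proof.
move=> ug; have [K K0 hK] := morrey.
have p0 : 0 < p by exact: lt_le_trans p1.
have E1 : 0 < energy p g + 1 by rewrite ltr_wpDl// energy_ge0.
exists (K * (energy p g + 1) `^ p^-1) => x y.
rewrite -mulrA [_ `^ p^-1 * _]mulrC; apply: (hK u g) => //; first by rewrite powR_gt0.
by rewrite -powRrM mulVf ?gt_eqF// powRr1 ?(ltW E1)// lerDl.
Qed.

Lemma sobolev_D1p u g : sobolev p u g -> D1p p u.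
Proof.
move=> ug; have [cu mg ig _] := ug; split; last exact: sobolev_holder ug.
  by apply/locintE; exact: continuous_locint.
move=> i; exists (fun x => g x ord0 i); first exact: sobolev_weak_partial p1 ug.
have p0 : 0 < p by exact: lt_le_trans p1.
have mgi := measurable_coord_comp i mg.
rewrite inE/=; apply/andP; split; rewrite inE//=.
rewrite /finite_norm.
rewrite ltNge leye_eq; apply/negP => /eqP Ny.
have p'0 : p != 0 by rewrite gt_eqF.
have := powR_Lnorm mu (fun x => (g x ord0 i)%:E) p'0.
rewrite -[fun x => _]/(EFin \o (fun x => g x ord0 i)) Ny poweRyr// => Iy.
have /integrableP[_] := ig; apply/negP; rewrite -leNgt leye_eq; apply/eqP.
apply/eqP; rewrite -leye_eq Iy; apply: ge0_le_integral => //.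
- by move=> x _; exact: poweR_ge0.
- by apply: (measurableT_comp (measurable_poweR p)); apply: measurableT_comp => //; apply/measurable_EFinP.
- by apply: measurableT_comp => //; apply/measurable_EFinP; exact: measurable_enorm_powR.
move=> x _; rewrite abse_EFin poweR_EFin lee_fin [leRHS]ger0_norm ?powR_ge0// le_powR ?(ltW p0)//.
exact: coord_le_enorm.
Qed.

Lemma energy_eq0_cst u g x y : sobolev p u g -> energy p g = 0 -> u x = u y.
Proof.
move=> ug J0; have [K K0 hK] := morrey.
apply/eqP; rewrite -subr_eq0 -normr_le0; apply/ler_addgt0Pr => e e0; rewrite add0r.
set r := enorm (x - y) `^ (1 - n%:R / p); have r0 : 0 <= r := powR_ge0 _ _.
have Kr : 0 < K * r + 1 by rewrite ltr_wpDl// mulr_ge0.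
have c0 : 0 < e / (K * r + 1) by rewrite divr_gt0.
apply: (le_trans (hK u g x y _ ug c0 _)); first by rewrite J0 powR_ge0.
by rewrite mulrA mulrCA ler_piMr ?(ltW e0)// ler_pdivrMr// mul1r lerDl.
Qed.

End morrey.

(** * Completeness and minimizers *)

Section limit_theorems.
Context {R : realType} {n : nat}.
Local Notation mu := (@lebesgue_row R n).
Implicit Types (x y z a : 'rV[R]_n) (u v phi : 'rV[R]_n -> R)
  (g k : 'rV[R]_n -> 'rV[R]_n) (i : 'I_n).
Variable p : R.
Hypothesis p1 : 1 <= p.

Lemma cvg_real_EFin (f : nat -> R) (l : R) : f @ \oo --> l ->
  (fun k : nat => (f k)%:E) @ \oo --> l%:E.
Proof. by move=> fl; apply: cvg_EFin => //; exact: nearW. Qed.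

Lemma Rintegral_dominated (f_ : nat -> 'rV[R]_n -> R) u v :
  (forall k : nat, measurable_fun setT (f_ k)) ->
  (forall x, (fun k : nat => f_ k x) @ \oo --> u x) ->
  mu.-integrable setT (EFin \o v) -> (forall (k : nat) x, `|f_ k x| <= v x) ->
  mu.-integrable setT (EFin \o u) /\
  (fun k : nat => \int[mu]_x f_ k x) @ \oo --> \int[mu]_x u x.
Proof.
move=> mf fu iv fv.
have mu_ : measurable_fun setT u.
  by apply: (measurable_fun_cvg mf) => x _; exact: fu.
have [iu _ cv] := @dominated_convergence _ _ _ mu setT measurableT
  (fun (k : nat) x => (f_ k x)%:E) (EFin \o u) (EFin \o v)
  (fun k : nat => (measurable_EFinP _ _).2 (mf k))
  ((measurable_EFinP _ _).2 mu_)
  (aeW mu (fun x _ => cvg_real_EFin (fu x)))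
  iv
  (aeW mu (fun x (k : nat) _ => fv k x)).
split; first exact: iu.
apply: (@fine_cvg _ _ _ _ (fun k : nat => \int[mu]_x (f_ k x)%:E)%E).
by rewrite /Rintegral fineK//; exact: integrable_fin_num.
Qed.

Lemma fatou_le (f_ : nat -> 'rV[R]_n -> R) u (C : R) (N : nat) :
  (forall k : nat, measurable_fun setT (f_ k)) -> (forall (k : nat) x, 0 <= f_ k x) ->
  (forall x, (fun k : nat => f_ k x) @ \oo --> u x) ->
  (forall k : nat, (N <= k)%N -> mu.-integrable setT (EFin \o f_ k) /\ \int[mu]_x f_ k x <= C) ->
  mu.-integrable setT (EFin \o u) /\ \int[mu]_x u x <= C.
Proof.
move=> mf f0 fu fC.
have mu_ : measurable_fun setT u.
  by apply: (measurable_fun_cvg mf) => x _; exact: fu.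
have u0 x : 0 <= u x.
  by apply: (cvgr_to_ge (fu x)); near=> k; exact: f0.
pose F (k : nat) x := (f_ (k + N)%N x)%:E.
have := @fatou _ _ _ mu setT measurableT F
  (fun k : nat => (measurable_EFinP _ _).2 (mf (k + N)%N))
  (fun (k : nat) x _ => f0 (k + N)%N x).
have -> : (\int[mu]_x limn_einf (F ^~ x) = \int[mu]_x (u x)%:E)%E.
  apply: eq_integral => x _.
  have cF : F ^~ x @ \oo --> (u x)%:E.
    by apply: cvg_real_EFin; have := fu x; rewrite -(cvg_shiftn N).
  by rewrite is_cvg_limn_einfE; [apply/cvg_lim|apply/cvg_ex; eexists; exact: cF].
move=> h.
have uC : (\int[mu]_x (u x)%:E <= C%:E)%E.
  apply: (le_trans h); rewrite limn_einf_lim; apply: lime_le; first exact: is_cvg_einfs.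
  near=> k; apply: (@le_trans _ _ (\int[mu]_x (f_ (k + N)%N x)%:E)%E).
    by apply: ereal_inf_lbound; exists k => /=.
  have [ik kC] := fC _ (leq_addl k N).
  by rewrite -(fineK (integrable_fin_num measurableT ik)) lee_fin.
have iu : mu.-integrable setT (EFin \o u).
  apply/integrableP; split; first exact/measurable_EFinP.
  apply: le_lt_trans (ltry C); apply: le_trans uC; apply: ge0_le_integral => //=.
  - by apply/measurable_EFinP; exact: measurableT_comp.
  - by apply/measurable_EFinP.
  - by move=> x _; rewrite lee_fin ger0_norm.
split; first exact: iu.
by rewrite -lee_fin /Rintegral fineK//; exact: integrable_fin_num.
Unshelve. all: by end_near. Qed.

Lemma Rintegral_ae_eq u v : measurable_fun setT u -> measurable_fun setT v ->
  {ae mu, forall x, u x = v x} -> \int[mu]_x u x = \int[mu]_x v x.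
Proof.
move=> mu_ mv uv; rewrite /Rintegral; congr fine; apply: ae_eq_integral => //.
- exact/measurable_EFinP.
- exact/measurable_EFinP.
- by apply: filterS uv => x -> _.
Qed.

Lemma sobolev_ae u g k : sobolev p u g -> measurable_fun setT k ->
  {ae mu, forall x, k x = g x} -> sobolev p u k /\ energy p k = energy p g.
Proof.
move=> ug mk kg; have [cu mg ig wu] := ug.
have E : energy p k = energy p g.
  apply: Rintegral_ae_eq; [exact: measurable_enorm_powR|exact: measurable_enorm_powR|].
  by apply: filterS kg => x ->.
split; last exact: E.
split; [exact: cu|exact: mk| |].
- apply/integrableP; split; first by apply/measurable_EFinP; exact: measurable_enorm_powR.
  have /integrableP[_] := ig; apply: le_lt_trans; rewrite le_eqVlt; apply/orP; left; apply/eqP.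
  pose f (h : 'rV[R]_n -> 'rV[R]_n) x : \bar R := `|(enorm (h x) `^ p)%:E|%E.
  have mf (h : 'rV[R]_n -> 'rV[R]_n) : measurable_fun setT h -> measurable_fun setT (f h).
    move=> mh; apply: (measurableT_comp (@abse_measurable R setT)).
    by apply/measurable_EFinP; exact: measurable_enorm_powR.
  have kgf : ae_eq mu setT (f k) (f g) by apply: filterS kg => x xE _; rewrite /f xE.
  exact: (@ae_eq_integral _ _ R mu setT (f g) (f k) measurableT (mf _ mk) (mf _ mg) kgf).
- move=> i phi tphi; rewrite (wu _ _ tphi); congr (- _).
  have mphi := continuous_measurable_row (test_continuous tphi).
  apply: Rintegral_ae_eq.
  + exact: (measurable_funM (measurable_coord_comp i mg) mphi).
  + exact: (measurable_funM (measurable_coord_comp i mk) mphi).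
  + by apply: filterS kg => x ->.
Qed.

Lemma cvg_half_steps (a : nat -> R) (C : R) : 0 <= C ->
  (forall k : nat, `|a k.+1 - a k| <= C * 2^-1 ^+ k) -> cvgn a.
Proof.
move=> C0 aC.
have E (k : nat) : a k = a 0%N + series (fun j => a j.+1 - a j) k.
  by rewrite /series/= telescope_sumr// addrC subrK.
rewrite (funext E); apply: is_cvgD; first exact: is_cvg_cst.
apply: normed_cvg; apply: (@series_le_cvg _ _ (geometric C 2^-1)) => //.
- by move=> k; exact: normr_ge0.
- by move=> k; rewrite /geometric/= mulr_ge0// exprn_ge0.
- by apply: is_cvg_geometric_series; rewrite ger0_norm// invf_lt1// ltr1n.
Qed.

Lemma sum_half_le (k : nat) : \sum_(0 <= j < k) (2^-1 : R) ^+ j <= 2.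
Proof.
suff -> : \sum_(0 <= j < k) (2^-1 : R) ^+ j = 2 - 2 * 2^-1 ^+ k.
  by rewrite gerBl mulr_ge0// exprn_ge0.
elim: k => [|k IH]; first by rewrite big_nil expr0 mulr1 subrr.
by rewrite big_nat_recr//= IH exprS; lra.
Qed.

(* Summable differences: [F] is finite almost everywhere, and where it is finite
   the functions [g_ k] converge geometrically. *)
Lemma fast_cauchy (g_ : nat -> 'rV[R]_n -> 'rV[R]_n) :
  (forall k : nat, measurable_fun setT (g_ k)) ->
  (forall k : nat, mu.-integrable setT (EFin \o (fun x => enorm (g_ k.+1 x - g_ k x) `^ p)) /\
    \int[mu]_x (enorm (g_ k.+1 x - g_ k x) `^ p) <= (2 ^+ k) `^ (- p) * 2^-1 ^+ k) ->
  exists (D : set 'rV[R]_n) (F : 'rV[R]_n -> R),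
    [/\ measurable D, {ae mu, forall x, D x}, mu.-integrable setT (EFin \o F),
      (forall x, D x -> forall i, cvgn (fun k : nat => g_ k x ord0 i)) &
      forall (k : nat) x, D x -> enorm (g_ k x) <= enorm (g_ 0%N x) + 2 * (1 + F x) /\ 0 <= F x].
Proof.
move=> mg Jg.
(* The weights are as large as the hypothesis allows: the integrals are at most 2^-k, and a finite
   sum at x bounds each increment by a multiple of 2^-k. *)
pose f (k : nat) x : \bar R := ((2 ^+ k) `^ p * enorm (g_ k.+1 x - g_ k x) `^ p)%:E.
have f0 (k : nat) x : (0 <= f k x)%E by rewrite lee_fin mulr_ge0 ?powR_ge0.
have md (k : nat) : measurable_fun setT (fun x => g_ k.+1 x - g_ k x).
  apply: measurable_fun_coord => i; under eq_fun do rewrite !mxE.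
  by apply: measurable_funB; exact: measurable_coord_comp.
have mf (k : nat) : measurable_fun setT (f k).
  by apply/measurable_EFinP; apply: measurable_funM => //; exact: measurable_enorm_powR.
pose Fe x := (\sum_(0 <= k <oo) f k x)%E.
have F0 x : (0 <= Fe x)%E by apply: nneseries_ge0.
have mF : measurable_fun setT Fe by apply: ge0_emeasurable_sum => //.
have IF : (\int[mu]_x Fe x <= 2%:E)%E.
  rewrite integral_nneseries//; apply: lime_le.
    by apply: is_cvg_nneseries => k _ _; exact: integral_ge0.
  near=> m; apply: (@le_trans _ _ (\sum_(0 <= j < m) (2^-1 ^+ j)%:E)%E).
    apply: lee_sum => k _; have [ik kle] := Jg k.
    have pos : 0 < (2 ^+ k) `^ p :> R by rewrite powR_gt0// exprn_gt0.
    have fin := integrable_fin_num measurableT (integrableZl measurableT ((2 ^+ k) `^ p) ik).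
    rewrite /f -(fineK fin) lee_fin.
    suff E : \int[mu]_x ((2 ^+ k) `^ p * enorm (g_ k.+1 x - g_ k x) `^ p) <= 2^-1 ^+ k by exact: E.
    by rewrite (RintegralZl ((2 ^+ k) `^ p) measurableT ik) -ler_pdivlMl// -powRN.
  by rewrite sumEFin lee_fin sum_half_le.
have iF : mu.-integrable setT Fe.
  apply/integrableP; split; first exact: mF.
  apply: le_lt_trans (ltry 2); apply: le_trans IF.
  by rewrite le_eqVlt; apply/orP; left; apply/eqP; apply: eq_integral => x _; rewrite gee0_abs.
pose D := [set x | Fe x \is a fin_num].
have mD : measurable D.
  have := emeasurable_fin_num measurableT mF; by rewrite setTI.
have FD (k : nat) x : D x -> enorm (g_ k.+1 x - g_ k x) <= (1 + fine (Fe x)) * 2^-1 ^+ k.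
  move=> Dx; have h : (f k x <= Fe x)%E.
    apply: le_trans (nneseries_lim_ge k.+1 _) => //.
    by rewrite big_nat_recr//= leeDr// sume_ge0.
  have h2 : (2 ^+ k * enorm (g_ k.+1 x - g_ k x)) `^ p <= fine (Fe x).
    by rewrite powRM ?enorm_ge0 ?exprn_ge0// -lee_fin fineK.
  have h3 := le_1_powR p1 (mulr_ge0 (exprn_ge0 k (ler0n R 2)) (enorm_ge0 (g_ k.+1 x - g_ k x))).
  rewrite exprVn ler_pdivlMr ?exprn_gt0// mulrC (le_trans h3)//.
  by rewrite lerD2l.
exists D, (fine \o Fe); split.
- exact: mD.
- by apply: filterS (integrable_ae measurableT iF) => x; exact.
- apply: (le_integrable measurableT _ _ iF).
    by apply/measurable_EFinP; exact: measurableT_comp.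
  move=> x _ /=; rewrite [leRHS]gee0_abs//.
  have := F0 x; case: (Fe x) => [r|_|//]; last by rewrite normr0 leey.
  by rewrite lee_fin => r0; rewrite ger0_norm.
- move=> x Dx i; apply: (@cvg_half_steps _ (1 + fine (Fe x))).
    by rewrite addr_ge0// fine_ge0.
  move=> k; apply: le_trans (FD k x Dx).
  have := coord_le_enorm (g_ k.+1 x - g_ k x) i; by rewrite !mxE.
- move=> k x Dx; have F'0 : 0 <= fine (Fe x) by rewrite fine_ge0.
  split; last exact: F'0.
  have : enorm (g_ k x) <= enorm (g_ 0%N x) + (1 + fine (Fe x)) * \sum_(0 <= j < k) 2^-1 ^+ j.
    elim: k => [|k IH]; first by rewrite big_nil mulr0 addr0.
    rewrite big_nat_recr//= mulrDr addrA.
    have := enormD (g_ k x) (g_ k.+1 x - g_ k x).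
    by rewrite addrCA subrr addr0 => /le_trans; apply; rewrite lerD// FD.
  move=> /le_trans; apply; rewrite lerD2l mulrC ler_wpM2r ?sum_half_le// addr_ge0//.
Unshelve. all: by end_near. Qed.

End limit_theorems.

(** * Completeness for the energy *)

Section closure.
Context {R : realType} {n : nat}.
Local Notation mu := (@lebesgue_row R n).
Implicit Types (x y z a : 'rV[R]_n) (u v phi : 'rV[R]_n -> R)
  (g k : 'rV[R]_n -> 'rV[R]_n) (i : 'I_n).
Variable p : R.
Hypothesis p1 : 1 <= p.
Hypothesis np : n%:R < p.

Lemma cvg_powR (a : nat -> R) (l q : R) : 0 < q -> (forall k : nat, 0 <= a k) ->
  a @ \oo --> l -> (fun k : nat => a k `^ q) @ \oo --> l `^ q.
Proof.
move=> q0 a0 al.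
have l0 : 0 <= l by apply: (cvgr_to_ge al); near=> k; exact: a0.
have inv (t : R) : 0 <= t -> (t `^ q^-1) `^ q = t.
  by move=> t0; rewrite -powRrM mulVf ?gt_eqF// powRr1.
have mono (s t : R) : 0 <= s -> s < t -> s `^ q < t `^ q.
  by move=> s0 st; rewrite gt0_ltr_powR ?nnegrE// (le_trans s0 (ltW st)).
have anti (s t : R) : 0 <= s -> 0 <= t -> s `^ q < t `^ q -> s < t.
  by move=> s0 t0; apply: contraTT; rewrite -!leNgt => ts; exact: le_powR (ltW q0) t0 ts.
apply/cvgrPdist_lt => e e0.
have le0 : 0 <= l `^ q + e by rewrite addr_ge0 ?powR_ge0// ltW.
have up : l < (l `^ q + e) `^ q^-1.
  by apply: anti => //; [exact: powR_ge0|rewrite inv// ltrDl].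
have dn : \forall k \near \oo, l `^ q - e < a k `^ q.
  have [neg|pos] := ltP (l `^ q - e) 0.
    by near=> k; rewrite (lt_le_trans neg)// powR_ge0.
  have lo : (l `^ q - e) `^ q^-1 < l.
    by apply: anti => //; [exact: powR_ge0|rewrite inv// gtrBl].
  near=> k; rewrite -(inv _ pos); apply: mono; first exact: powR_ge0.
  by near: k; exact: cvgr_gt al _ lo.
near=> k.
have h1 : a k `^ q < l `^ q + e.
  rewrite -(inv _ le0) mono//.
  by near: k; exact: cvgr_lt al _ up.
have h2 : l `^ q - e < a k `^ q by near: k.
by move: h1 h2; move: (a k `^ q) (l `^ q) => s t h1 h2; rewrite ltr_norml; lra.
Unshelve. all: by end_near. Qed.

Lemma cvg_enorm (a : nat -> 'rV[R]_n) x :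
  (forall i, (fun k : nat => a k ord0 i) @ \oo --> x ord0 i) ->
  (fun k : nat => enorm (a k)) @ \oo --> enorm x.
Proof.
move=> ax; rewrite /enorm; apply: (@cvg_comp _ _ _
    (fun k : nat => \sum_i a k ord0 i ^+ 2) Num.sqrt); last exact: sqrt_continuous.
elim: (index_enum _) => [|i s IH].
  rewrite (_ : (fun k : nat => _) = fun=> 0); last by apply/funext => k; rewrite big_nil.
  by rewrite big_nil; exact: cvg_cst.
rewrite (_ : (fun k : nat => _) =
  (fun k : nat => a k ord0 i * a k ord0 i) \+ (fun k : nat => \sum_(j <- s) a k ord0 j ^+ 2)).
  by rewrite big_cons expr2; apply: cvgD; [apply: cvgM|exact: IH].
by apply/funext => k; rewrite big_cons expr2.
Qed.

Lemma sobolevB u v g k : sobolev p u g -> sobolev p v k ->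
  sobolev p (fun x => u x - v x) (fun x => g x - k x).
Proof.
move=> ug vk; have := sobolevD p1 ug (sobolevZ (-1) p1 vk).
have -> : (fun x => u x + -1 * v x) = (fun x => u x - v x).
  by apply/funext => x; rewrite mulN1r.
suff -> : (fun x => g x + -1 *: k x) = (fun x => g x - k x) by [].
by apply/funext => x; rewrite scaleN1r.
Qed.

(** Along a fast subsequence the gradients converge almost everywhere, and Fatou's lemma bounds the
    energy of the limit. The functions converge at every point by Morrey's inequality, the common
    zero [z] fixing the additive constants. Dominated convergence passes the weak derivatives to the
    limit. *)
Lemma sobolev_cauchy (u_ : nat -> 'rV[R]_n -> R) (g_ : nat -> 'rV[R]_n -> 'rV[R]_n) z (M : R) :
  (forall k : nat, sobolev p (u_ k) (g_ k)) -> (forall k : nat, u_ k z = 0) ->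
  (forall e : R, 0 < e -> exists N : nat, forall k l : nat, (N <= k)%N -> (N <= l)%N ->
    energy p (fun x => g_ k x - g_ l x) <= e) ->
  (forall e : R, 0 < e -> exists N : nat, forall k : nat, (N <= k)%N -> energy p (g_ k) <= M + e) ->
  exists (f : nat -> nat) u g, [/\ forall k : nat, (k <= f k)%N, sobolev p u g,
    energy p g <= M & forall x, (fun k : nat => u_ (f k) x) @ \oo --> u x].
Proof.
move=> ug uz cau bdM.
have p0 : 0 < p by exact: lt_le_trans p1.
(* The rate demanded by [fast_cauchy]; being at most (2^-k)^p, it also gives geometric increments of
   the functions through Morrey's inequality. *)
pose eps (k : nat) : R := (2 ^+ k) `^ (- p) * 2^-1 ^+ k.
have eps0 (k : nat) : 0 < eps k by rewrite mulr_gt0 ?powR_gt0 ?exprn_gt0// invr_gt0.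
have [N1 hN1] := bdM 1 ltr01.
have /choice [Ns hNs] : forall k : nat, exists N : nat, forall j l : nat,
    (N <= j)%N -> (N <= l)%N -> energy p (fun x => g_ j x - g_ l x) <= eps k.
  by move=> k; exact: cau.
(* The maximum puts f l beyond the threshold of every k <= l, the term k gives f k >= k, and [N1]
   keeps the energies below M + 1. *)
pose f (k : nat) := (\max_(j < k.+1) Ns j + k + N1)%N.
have fN (k l : nat) : (k <= l)%N -> (Ns k <= f l)%N.
  move=> kl; rewrite /f -addnA (leq_trans _ (leq_addr _ _))//.
  have kl' : (k < l.+1)%N by [].
  exact: (leq_bigmax (Ordinal kl')).
have fk (k : nat) : (k <= f k)%N by rewrite /f addnAC leq_addl.
have fN1 (k : nat) : (N1 <= f k)%N by rewrite /f leq_addl.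
pose h (k : nat) := g_ (f k).
have sh (k : nat) : sobolev p (u_ (f k)) (h k) by exact: ug.
have mh (k : nat) : measurable_fun setT (h k) by case: (sh k).
have Jh (k : nat) : energy p (h k) <= M + 1 by apply: hN1.
have sd (k : nat) := sobolevB (sh k.+1) (sh k).
have Jd (k : nat) : energy p (fun x => h k.+1 x - h k x) <= eps k by apply: hNs; exact: fN.
have [D [F [mD aeD iF cvD domD]]] := fast_cauchy p1 mh
  (fun k : nat => conj (let: And4 _ _ i _ := sd k in i) (Jd k)).
(* Setting the gradients to 0 on the exceptional null set makes them converge everywhere. *)
pose h' (k : nat) x : 'rV[R]_n := (\1_D x : R) *: h k x.
have mh' (k : nat) : measurable_fun setT (h' k).
  apply: measurable_fun_coord => i; under eq_fun do rewrite mxE.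
  exact: (measurable_funM (measurable_indic mD) (measurable_coord_comp i (mh k))).
have ae' (k : nat) : {ae mu, forall x, h' k x = h k x}.
  by apply: filterS aeD => x Dx; rewrite /h' indicE mem_set//= scale1r.
have sh' (k : nat) := sobolev_ae (sh k) (mh' k) (ae' k).
have cvh' x i : cvgn (fun k : nat => h' k x ord0 i).
  have [Dx|Dx] := pselect (D x).
    suff -> : (fun k : nat => h' k x ord0 i) = (fun k : nat => h k x ord0 i) by exact: cvD.
    by apply/funext => k; rewrite /h' indicE mem_set//= scale1r.
  suff -> : (fun k : nat => h' k x ord0 i) = (fun=> 0) by exact: is_cvg_cst.
  by apply/funext => k; rewrite /h' indicE memNset//= scale0r mxE.
pose g x : 'rV[R]_n := \row_i limn (fun k : nat => h' k x ord0 i).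
have hg x i : (fun k : nat => h' k x ord0 i) @ \oo --> g x ord0 i.
  by rewrite mxE; exact: cvh'.
have mg : measurable_fun setT g.
  apply: measurable_fun_coord => i.
  apply: (@measurable_fun_cvg _ _ R setT (fun (k : nat) x => h' k x ord0 i)) => [k|x _].
    exact: measurable_coord_comp.
  exact: hg.
have mhp (k : nat) := measurable_enorm_powR p (mh' k).
have hgp x : (fun k : nat => enorm (h' k x) `^ p) @ \oo --> enorm (g x) `^ p.
  apply: cvg_powR => // [k|]; first exact: enorm_ge0.
  by apply: cvg_enorm => i; exact: hg.
have fat (N : nat) (e : R) : (forall k : nat, (N <= k)%N -> energy p (g_ k) <= M + e) ->
    mu.-integrable setT (EFin \o (fun x => enorm (g x) `^ p)) /\ energy p g <= M + e.
  move=> hN; apply: (fatou_le mhp (fun (k : nat) x => powR_ge0 _ _) hgp (N := N)) => k Nk.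
  have [[_ _ i1 _] E1] := sh' k; split; first exact: i1.
  exact: (eq_ind _ (fun r : R => r <= M + e) (hN _ (leq_trans Nk (fk k))) _ (esym E1)).
have ig := (fat N1 1 hN1).1.
have gM : energy p g <= M.
  by apply/ler_addgt0Pr => e e0; have [N hN] := bdM e e0; exact: (fat N e hN).2.
have [K K0 hK] := morrey p1 np.
pose al : R := 1 - n%:R / p.
have al0 : 0 < al by rewrite subr_gt0 ltr_pdivrMr// mul1r.
have M1 : 0 < `|M| + 1 by rewrite ltr_wpDl.
pose c : R := (`|M| + 1) `^ p^-1.
have c0 : 0 < c by rewrite powR_gt0.
have cp : c `^ p = `|M| + 1 by rewrite -powRrM mulVf ?gt_eqF// powRr1 ?(ltW M1).
have hol (k : nat) x y : `|u_ (f k) x - u_ (f k) y| <= K * (enorm (x - y) `^ al * c).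
  apply: (hK _ _ _ _ _ (sh k) c0).
  by rewrite cp (le_trans (Jh k))// lerD2r ler_norm.
have cvu x : cvgn (fun k : nat => u_ (f k) x).
  apply: (@cvg_half_steps R _ (K * enorm (x - z) `^ al)); first by rewrite mulr_ge0 ?powR_ge0.
  move=> k; rewrite -mulrA.
  have c2 : 0 < (2^-1 : R) ^+ k by rewrite exprn_gt0// invr_gt0.
  have := hK _ _ x z _ (sd k) c2; rewrite !uz !subr0; apply.
  apply: (le_trans (Jd k)); rewrite /eps exprVn -[(2 ^+ k)^-1]powR_inv1 ?exprn_ge0//.
  rewrite -powRrM mulN1r ler_piMr ?powR_ge0// powR_inv1 ?exprn_ge0// invf_le1 ?exprn_gt0//.
  by rewrite exprn_ege1// ler1n.
pose u x := limn (fun k : nat => u_ (f k) x).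
have hu x : (fun k : nat => u_ (f k) x) @ \oo --> u x by exact: cvu.
have hol_u : holder_continuous al u.
  exists (K * c) => x y; rewrite -mulrA [c * _]mulrC.
  have : (fun k : nat => `|u_ (f k) x - u_ (f k) y|) @ \oo --> `|u x - u y|.
    by apply: cvg_norm; apply: cvgB; exact: hu.
  by move=> /cvgr_to_le; apply; near=> k; exact: hol.
exists f, u, g; split => //.
split => //; first exact: holder_continuous_continuous al0 hol_u.
move=> i phi tphi.
have tp := test_partial i tphi.
have [N phiN] := test_bsupp tp.
have mphi := continuous_measurable_row (test_continuous tphi).
have mpp := continuous_measurable_row (test_continuous tp).
have cf (k : nat) : continuous (u_ (f k)) by case: (sh k).
have E1 : (fun k : nat => \int[mu]_x (u_ (f k) x * partial i phi x)) @ \oo -->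
    \int[mu]_x (u x * partial i phi x).
  pose C := K * ((n%:R * (N + `|z|)) `^ al * c).
  have iv : mu.-integrable setT (EFin \o (fun x => C * `|partial i phi x|)).
    have i1 : mu.-integrable setT (EFin \o partial i phi).
      have [B B0 hB] := continuous_bsupp_bounded (test_continuous tp) (test_bsupp tp).
      exact: integrable_bsupp mpp (test_bsupp tp) hB.
    exact: (integrableZl measurableT C (integrable_norm i1)).
  apply: (Rintegral_dominated _ _ iv _).2 => [k|x|k x].
  - exact: (measurable_funM (continuous_measurable_row (cf k)) mpp).
  - by apply: cvgMr_tmp; exact: hu.
  - rewrite normrM; have [xN|xN] := leP `|x| N; last by rewrite phiN// normr0 !mulr0.
    rewrite ler_wpM2r//; have := hol k x z; rewrite uz subr0 => /le_trans; apply.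
    rewrite ler_wpM2l// ler_wpM2r ?(ltW c0)// le_powR ?(ltW al0) ?enorm_ge0//.
    rewrite (le_trans (enorm_le_norm _))// ler_wpM2l//.
    by rewrite (le_trans (ler_normB _ _))// lerD2r.
have E2 : (fun k : nat => \int[mu]_x (h' k x ord0 i * phi x)) @ \oo -->
    \int[mu]_x (g x ord0 i * phi x).
  have [B B0 hB] := continuous_bsupp_bounded (test_continuous tphi) (test_bsupp tphi).
  have me0 : measurable_fun setT (fun x => enorm (h 0%N x)).
    exact: (measurableT_comp (continuous_measurable_row (@continuous_enorm R n)) (mh 0%N)).
  have le0 : locint (fun x => enorm (h 0%N x)).
    apply: (powR_locint p1 me0); have [_ _ i0 _] := sh 0%N.
    by move: i0; congr (_.-integrable _ _); apply/funext => x /=; rewrite ger0_norm ?enorm_ge0.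
  have i1 : mu.-integrable setT (EFin \o (fun x => enorm (h 0%N x) * phi x)).
    exact: locint_integrableMc le0 (test_continuous tphi) (test_bsupp tphi).
  have i2 : mu.-integrable setT (EFin \o phi) := integrable_bsupp mphi (test_bsupp tphi) hB.
  pose V x := (`|enorm (h 0%N x) * phi x| + 2 * `|phi x|) + 2 * B * `|F x|.
  have iv : mu.-integrable setT (EFin \o V).
    have j1 := integrableD measurableT (integrable_norm i1) (integrableZl measurableT 2 (integrable_norm i2)).
    exact: (integrableD measurableT j1 (integrableZl measurableT (2 * B) (integrable_norm iF))).
  apply: (Rintegral_dominated _ _ iv _).2 => [k|x|k x].
  - exact: (measurable_funM (measurable_coord_comp i (mh' k)) mphi).
  - by apply: cvgMr_tmp; exact: hg.
  - rewrite normrM /V normrM (ger0_norm (enorm_ge0 _)).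
    have [Dx|Dx] := pselect (D x); last first.
      rewrite /h' indicE memNset//= scale0r mxE normr0 mul0r.
      by rewrite !addr_ge0 ?mulr_ge0 ?enorm_ge0.
    have [le1 F0] := domD k x Dx.
    have e1 := le_trans (coord_le_enorm (h' k x) i) _.
    have hh : `|h' k x ord0 i| <= enorm (h 0%N x) + 2 * (1 + F x).
      by apply: e1; rewrite /h' indicE mem_set//= scale1r.
    rewrite (le_trans (ler_wpM2r (normr_ge0 _) hh))// (ger0_norm F0).
    have := ler_wpM2l F0 (hB x).
    move: (`|phi x|) (enorm _) (F x) => *; lra.
have E3 (k : nat) : \int[mu]_x (u_ (f k) x * partial i phi x) = - \int[mu]_x (h' k x ord0 i * phi x).
  by have [[_ _ _ w] _] := sh' k; exact: w.
rewrite (_ : (fun k : nat => _) = (fun k : nat => - \int[mu]_x (h' k x ord0 i * phi x))) in E1.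
  exact: (norm_cvg_unique E1 (cvgN E2)).
exact/funext.
Unshelve. all: by end_near. Qed.

End closure.

(** * Minimizing the energy under a point constraint *)

Section minimization.
Context {R : realType} {n : nat}.
Implicit Types (x y z a : 'rV[R]_n) (u v phi : 'rV[R]_n -> R)
  (g k : 'rV[R]_n -> 'rV[R]_n) (i : 'I_n).
Variable p : R.
Hypothesis p2 : 2 <= p.
Hypothesis np : n%:R < p.

Let p1 : 1 <= p. Proof. by apply: le_trans p2; rewrite ler1n. Qed.

(** The Rayleigh quotient is invariant under scaling of the function, so the value at the point [x]
    where the weighted function is evaluated can be normalized to 1. *)
Definition competitor (Omega : set 'rV[R]_n) x u g :=
  [/\ sobolev p u g, forall y, ~ Omega y -> u y = 0 & u x = 1].

Definition admissible (Omega : set 'rV[R]_n) x (M : R) :=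
  exists u g, competitor Omega x u g /\ energy p g <= M.

Lemma competitor_sub Omega Omega' x u g : Omega `<=` Omega' ->
  competitor Omega x u g -> competitor Omega' x u g.
Proof. by move=> OO' [ug u0 ux]; split => // y Oy; apply: u0 => /OO'. Qed.

Lemma competitor_midpoint Omega x u v g k : competitor Omega x u g ->
  competitor Omega x v k ->
  competitor Omega x (fun y => 2^-1 * (u y + v y)) (fun y => 2^-1 *: (g y + k y)).
Proof.
move=> [ug u0 ux] [vk v0 vx]; split.
- exact: sobolevZ p1 (sobolevD p1 ug vk).
- by move=> y Oy; rewrite u0// v0// addr0 mulr0.
- by rewrite ux vx; lra.
Qed.

Let half_diff_le (a b c d m e1 e2 : R) : a + b <= (c + d) / 2 -> m <= a ->
  c <= m + e1 -> d <= m + e2 -> b <= (e1 + e2) / 2.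
Proof. by move=> *; lra. Qed.

(** Uniform convexity: if the midpoint has energy at least m and both functions nearly reach m,
    Clarkson's inequality leaves little energy for the difference. *)
Lemma energy_half_diff u v g k (m e1 e2 : R) : sobolev p u g -> sobolev p v k ->
  m <= energy p (fun y => 2^-1 *: (g y + k y)) ->
  energy p g <= m + e1 -> energy p k <= m + e2 ->
  energy p (fun y => g y - k y) <= 2 `^ p * ((e1 + e2) / 2).
Proof.
move=> ug vk mle Jg Jk; have cl := clarkson p2 ug vk.
have := energyZ 2^-1 (sobolevB p1 ug vk).
rewrite gtr0_norm ?invr_gt0// => E.
have two : (2 : R) `^ p * (2^-1) `^ p = 1 by rewrite -powRM// divff// powR1.
have -> : energy p (fun y => g y - k y) = 2 `^ p * energy p (fun y => 2^-1 *: (g y - k y)).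
  by rewrite E mulrA two mul1r.
rewrite ler_wpM2l ?powR_ge0//.
exact: half_diff_le cl mle Jg Jk.
Qed.

(** The infima [m k] increase to a limit at most M. For k, l >= N, near-minimizers for [Omega k] and
    [Omega l] are both competitors for [Omega N], so their midpoint has energy at least [m N], and
    they are close when [m N] is near the limit. No continuity of the domains is assumed, so the
    lemma also covers a blow-up. *)
Lemma admissible_bigcap (Omega : nat -> set 'rV[R]_n) x z (M_ : nat -> R) (M : R) :
  (forall k l : nat, (k <= l)%N -> Omega l `<=` Omega k) -> ~ Omega 0%N z ->
  (forall k : nat, admissible (Omega k) x (M_ k)) -> M_ @ \oo --> M ->
  admissible (\bigcap_k Omega k) x M.
Proof.
move=> Odec Oz adm MM.
pose E (k : nat) : set R := [set J | exists u g, competitor (Omega k) x u g /\ J = energy p g].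
have E0 (k : nat) : has_inf (E k).
  split; last by exists 0 => _ [u [g [_ ->]]]; exact: energy_ge0.
  by have [u [g [cu _]]] := adm k; exists (energy p g), u, g.
pose m (k : nat) := inf (E k).
have mle (k : nat) u g : competitor (Omega k) x u g -> m k <= energy p g.
  by move=> cu; apply: ge_inf; [exact: (E0 k).2|exists u, g].
have mM_ (k : nat) : m k <= M_ k.
  by have [u [g [cu Jg]]] := adm k; exact: le_trans (mle _ _ _ cu) Jg.
have mnd (k l : nat) : (k <= l)%N -> m k <= m l.
  move=> kl; apply: lb_le_inf; first exact: (E0 l).1.
  by move=> _ [u [g [cu ->]]]; apply: (mle k u g); exact: competitor_sub (Odec _ _ kl) cu.
have mM (k : nat) : m k <= M.
  apply: (cvgr_to_ge MM); exists k => // l kl.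
  exact: le_trans (mnd _ _ kl) (mM_ l).
have mc : cvgn m.
  by apply: nondecreasing_is_cvgn; [move=> k l; exact: mnd|exists M => _ [k _ <-]].
have ml (k : nat) : m k <= limn m.
  by apply: nondecreasing_cvgn_le => // a b; exact: mnd.
have mlM : limn m <= M by apply: limr_le => //; near=> k.
pose ep (k : nat) : R := k.+1%:R^-1.
have ep0 (k : nat) : 0 < ep k by rewrite invr_gt0 ltr0n.
have epc : ep @ \oo --> (0 : R) by exact: cvg_harmonic.
have pick (k : nat) : exists ug : ('rV[R]_n -> R) * ('rV[R]_n -> 'rV[R]_n),
    competitor (Omega k) x ug.1 ug.2 /\ energy p ug.2 <= m k + ep k.
  have [_ [u [g [cu ->]]] Jlt] := inf_adherent (ep0 k) (E0 k).
  by exists (u, g); split => //; exact: ltW.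
have [ug ugP] := choice pick.
pose u_ (k : nat) := (ug k).1; pose g_ (k : nat) := (ug k).2.
have cu (k : nat) : competitor (Omega k) x (u_ k) (g_ k) by case: (ugP k).
have Jg (k : nat) : energy p (g_ k) <= m k + ep k by case: (ugP k).
have s_ (k : nat) : sobolev p (u_ k) (g_ k) by case: (cu k).
have uz (k : nat) : u_ k z = 0.
  by case: (cu k) => _ u0 _; apply: u0 => /(Odec _ _ (leq0n k)).
have diff (N k l : nat) : (N <= k)%N -> (N <= l)%N ->
    energy p (fun y => g_ k y - g_ l y) <= 2 `^ p * ((limn m - m N) + ep N).
  move=> Nk Nl.
  have c1 := competitor_sub (Odec _ _ Nk) (cu k).
  have c2 := competitor_sub (Odec _ _ Nl) (cu l).
  have h0 := mle N _ _ (competitor_midpoint c1 c2).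
  have epN (j : nat) : (N <= j)%N -> energy p (g_ j) <= m N + ((limn m - m N) + ep N).
    move=> Nj; apply: (le_trans (Jg j)).
    have : ep j <= ep N by rewrite lef_pV2 ?posrE ?ltr0n// ler_nat.
    have := ml j; move: (m j) (m N) (limn m) (ep j) (ep N) => *; lra.
  have := energy_half_diff (s_ k) (s_ l) h0 (epN _ Nk) (epN _ Nl).
  move=> /le_trans; apply; rewrite ler_wpM2l ?powR_ge0//.
  by move: (limn m - m N + ep N) => t; lra.
have [| |f [u [g [fk su Jle ul]]]] := @sobolev_cauchy R n p p1 np u_ g_ z M s_ uz.
- move=> e e0.
  have cv : (fun N : nat => 2 `^ p * ((limn m - m N) + ep N)) @ \oo --> (0 : R).
    rewrite -(mulr0 (2 `^ p)); apply: cvgMl_tmp.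
    rewrite -[X in _ --> X](addr0 0) -{1}(subrr (limn m)).
    by apply: cvgD => //; apply: cvgB; [exact: cvg_cst|exact: mc].
  have [N _ /(_ N (leqnn N)) hN] := cvgr_lt _ cv _ e0.
  exists N => k l Nk Nl; exact: le_trans (diff _ _ _ Nk Nl) (ltW hN).
- move=> e e0; have [N _ hN] := cvgr_lt _ epc _ e0.
  exists N => k Nk; apply: (le_trans (Jg k)).
  by rewrite lerD ?mM// ltW// hN.
exists u, g; split; last exact: Jle.
split; first exact: su.
- move=> y Oy; have [j Oj] : exists j : nat, ~ Omega j y.
    by apply: contrapT => /forallNP h; apply: Oy => j _; exact: contrapT (h j).
  have : (fun k : nat => u_ (f k) y) @ \oo --> (0 : R).
    apply: cvg_near_cst; exists j => // k jk.
    case: (cu (f k)) => _ u0 _; apply: u0 => /(Odec _ _ (leq_trans jk (fk k))).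
    exact: Oj.
  exact: cvg_unique (ul y).
- have : (fun k : nat => u_ (f k) x) @ \oo --> (1 : R).
    by apply: cvg_near_cst; near=> k; case: (cu (f k)).
  exact: cvg_unique (ul x).
Unshelve. all: by end_near. Qed.

(** The case of a constant sequence of domains: infima are attained. *)
Lemma admissible_min (Omega : set 'rV[R]_n) x z (M : R) : ~ Omega z ->
  (forall e : R, 0 < e -> admissible Omega x (M + e)) -> admissible Omega x M.
Proof.
move=> Oz adm.
have := @admissible_bigcap (fun=> Omega) x z (fun k : nat => M + k.+1%:R^-1) M.
rewrite (_ : \bigcap_(k in [set: nat]) _ = Omega); last first.
  by apply/seteqP; split=> [y /(_ 0%N I)//|y Oy j _].
apply => //; first by move=> j l _.
  by move=> k; apply: adm; rewrite invr_gt0 ltr0n.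
rewrite -[X in _ --> X]addr0; apply: cvgD; [exact: cvg_cst|exact: cvg_harmonic].
Qed.

Lemma competitor_unique (Omega : set 'rV[R]_n) x z u v g k (m : R) : ~ Omega z ->
  competitor Omega x u g -> competitor Omega x v k ->
  (forall w h, competitor Omega x w h -> m <= energy p h) ->
  energy p g <= m -> energy p k <= m -> u = v.
Proof.
move=> Oz cu cv mle Jg Jk; have [ug u0 _] := cu; have [vk v0 _] := cv.
have := @energy_half_diff u v g k m 0 0 ug vk (mle _ _ (competitor_midpoint cu cv)).
rewrite !addr0 mul0r mulr0 => /(_ Jg Jk) J0.
have {}J0 : energy p (fun y => g y - k y) = 0.
  by apply/eqP; rewrite eq_le J0 energy_ge0.
apply/funext => y; apply/eqP; rewrite -subr_eq0.
by rewrite (energy_eq0_cst p1 np y z (sobolevB p1 ug vk) J0) u0// v0// subrr.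
Qed.

End minimization.

(** * Maxima and minima *)

Section mollification.
Context {R : realType} {n : nat}.
Local Notation mu := (@lebesgue_row R n).
Implicit Types (x y z a : 'rV[R]_n) (u v phi psi chi : 'rV[R]_n -> R)
  (g k : 'rV[R]_n -> 'rV[R]_n) (i : 'I_n).
Local Notation ev i := (delta_mx (@ord0 0) i : 'rV[R]_n).

Lemma uniform_continuous_cball u (N e : R) : continuous u -> 0 < e ->
  exists2 d, 0 < d & forall x y, `|x| <= N -> `|x - y| < d -> `|u x - u y| < e.
Proof.
move=> /continuous_rowP cu e0.
have cov := (@compact_near_coveringP _ _).1 (@compact_cball R n N).
have := cov _ (0 : R)^'+ (fun (d : R) x => forall y, `|x - y| < d -> `|u x - u y| < e) _ _.
case=> [x _|d d0 hd].
  have e2 : 0 < e / 2 by rewrite divr_gt0.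
  have [d [d0 hd]] := cu x _ e2; have d2 : 0 < d / 2 by rewrite divr_gt0.
  exists ([set x' | `|x - x'| < d / 2], [set t | 0 < t < d / 2]) => /=.
    split; first by apply/nbhs_ballP; exists (d / 2) => // x'; rewrite -ball_normE.
    exists (d / 2) => //= t; rewrite /ball_ /= sub0r normrN => td t0.
    by rewrite t0 (le_lt_trans (ler_norm _) td).
  move=> [x' t] /= [xx' /andP[t0 td]] y x'y.
  have h1 : `|u x - u x'| < e / 2 by apply: hd; rewrite (lt_trans xx')// ltr_pdivrMr// ltr_pMr// ltr1n.
  have h2 : `|u x - u y| < e / 2.
    apply: hd; rewrite -(subrKA x') (le_lt_trans (ler_normD _ _))//.
    by rewrite [ltRHS](splitr d) ltrD// (lt_trans x'y).
  rewrite -(subrKA (u x)) (le_lt_trans (ler_normD _ _))// distrC [ltRHS](splitr e).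
  exact: ltrD.
exists (d / 2); first by rewrite divr_gt0.
move=> x y xN xy; apply: (hd (d / 2)) => //=.
  by rewrite sub0r normrN gtr0_norm ?divr_gt0// ltr_pdivrMr// ltr_pMr// ltr1n.
by rewrite divr_gt0.
Qed.

Lemma uniform_continuous_bsupp u (e : R) : continuous u -> bsupp u -> 0 < e ->
  exists2 d, 0 < d & forall x y, `|x - y| < d -> `|u x - u y| < e.
Proof.
move=> cu [N uN] e0; have [d d0 hd] := @uniform_continuous_cball u (N + 1) e cu e0.
exists (Num.min d 1); first by rewrite lt_min d0 ltr01.
move=> x y; rewrite lt_min => /andP[xy xy1].
have [xN|xN] := leP `|x| (N + 1); first exact: hd.
have := ler_distD 0 x y; rewrite !subr0 => h.
have yN : N < `|y|.
  have := ler_normB x (x - y); rewrite subKr => h1.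
  have := ler_normD (x - y) y; rewrite subrK.
  move: xN xy1; move: (`|x|) (`|x - y|) (`|y|) => *; lra.
by rewrite uN ?uN ?subrr ?normr0// (lt_trans _ xN)// ltrDl.
Qed.

Lemma test_scale (c : R) phi : test_function phi -> test_function (fun x => c * phi x).
Proof.
move=> /test_functionP[sphi [N phiN]]; apply/test_functionP; split; last first.
  by exists N => x /phiN ->; rewrite mulr0.
apply: (@smooth_class R n [set f | exists2 g0, smooth g0 & f = fun x => c * g0 x]).
- move=> _ [g0 sg ->] x; apply: (@cvgM _ _ (nbhs x)); first exact: continuous_cst_row.
  exact: smooth_continuous sg x.
- move=> _ i [g0 sg ->]; exists (fun x => c * partial i g0 x).
    exact: (ex_intro2 _ _ (partial i g0) (smooth_partial i sg) erefl).
  by move=> x; apply: (@is_deriveZ _ _ _ g0 c x (ev i)); exact: smooth_is_derive.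
- by exists phi.
Qed.

Lemma mollifier_ex : exists rho, [/\ test_function rho, forall x, 0 <= rho x,
  \int[mu]_x rho x = 1 & forall x, 1 < `|x| -> rho x = 0].
Proof.
have [_ [b [[_ sb] _ _ [_ bge] [bsup b0]]]] := @smooth_step R.
pose r := prodf (fun _ : 'I_n => b).
have tr : test_function r by apply: (@test_prodf R n _ 1) => // j t /ltW; exact: bsup.
have r0 x : 0 <= r x by apply: prodr_ge0.
have rN x : 1 < `|x| -> r x = 0.
  move=> x1; have [/forallP h|] := boolP [forall j, `|x ord0 j| <= 1].
    by have := row_norm_le ler01 h; rewrite leNgt x1.
  rewrite negb_forall => /existsP[j]; rewrite -ltNge => /ltW jN.
  by rewrite /r /prodf (bigD1 j)//= bsup// mul0r.
have [C C0 hC] := continuous_bsupp_bounded (test_continuous tr) (test_bsupp tr).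
have ir := integrable_bsupp (continuous_measurable_row (test_continuous tr)) (test_bsupp tr) hC.
have rat0 : 0 < r 0 by apply: prodr_gt0 => j _; rewrite mxE.
have m0 := Rintegral_gt0 (test_continuous tr) r0 rat0 ir.
exists (fun x => (\int[mu]_y r y)^-1 * r x); split.
- exact: test_scale.
- by move=> x; rewrite mulr_ge0// invr_ge0 ltW.
- by rewrite (RintegralZl _ measurableT ir) mulVf// gt_eqF.
- by move=> x /rN ->; rewrite mulr0.
Qed.

(** Derivatives fall on [phi] by [is_derive_int_translate], so correlations with [psi] form a class
    stable under partial derivatives. The form x + y, rather than a convolution, matches that
    lemma. *)
Lemma test_correlation psi phi : continuous psi -> bsupp psi -> test_function phi ->
  test_function (fun x => \int[mu]_y (psi y * phi (x + y))).
Proof.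
move=> cpsi bpsi tphi.
have lpsi := continuous_locint cpsi.
have [N psiN] := bpsi; have [N' phiN] := test_bsupp tphi.
pose A : set ('rV[R]_n -> R) := [set f | exists2 chi, test_function chi &
  f = fun x => \int[mu]_y (psi y * chi (x + y))].
have ic chi x : test_function chi ->
    mu.-integrable setT (EFin \o (fun y => psi y * chi (x + y))).
  move=> tchi; have tt := test_translate x tchi.
  exact: locint_integrableMc lpsi (test_continuous tt) (test_bsupp tt).
apply/test_functionP; split; last first.
  exists (N + N') => x xN; rewrite (_ : (fun y => _) = fun=> 0).
    by rewrite Rintegral_cst// mul0r.
  apply/funext => y; have [yN|yN] := leP `|y| N; last by rewrite psiN// mul0r.
  rewrite phiN ?mulr0//; have := ler_normB (x + y) y; rewrite addrK.
  by move: xN yN; move: (`|x|) (`|y|) (`|x + y|) => *; lra.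
apply: (@smooth_class R n A); last by exists phi.
- move=> _ [chi tchi ->]; apply/continuous_rowP => x e e0.
  have [C C0 hC] := continuous_bsupp_bounded cpsi bpsi.
  have ipsi := integrable_norm (integrable_bsupp (continuous_measurable_row cpsi) bpsi hC).
  pose I := \int[mu]_y `|psi y|.
  have I0 : 0 <= I by apply: Rintegral_ge0 => y _.
  have I1 : 0 < I + 1 by rewrite ltr_wpDl.
  have e'0 : 0 < e / (I + 1) by rewrite divr_gt0.
  have [d d0 hd] := uniform_continuous_bsupp (test_continuous tchi) (test_bsupp tchi) e'0.
  exists d; split => // y xy.
  rewrite -(RintegralB measurableT (ic _ x tchi) (ic _ y tchi)).
  have id := integrableB measurableT (ic _ x tchi) (ic _ y tchi).
  apply: (le_lt_trans (le_normr_Rintegral measurableT id)).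
  apply: (@le_lt_trans _ _ (\int[mu]_y (e / (I + 1) * `|psi y|))).
    apply: (le_Rintegral measurableT).
    - exact: integrable_norm id.
    - exact: (integrableZl measurableT (e / (I + 1)) ipsi).
    move=> z _; rewrite -mulrBr normrM mulrC ler_wpM2r// ltW//.
    by apply: hd; rewrite opprD addrACA subrr addr0.
  rewrite (RintegralZl (e / (I + 1)) measurableT ipsi) mulrAC ltr_pdivrMr//.
  by rewrite ltr_pM2l// ltrDl.
- move=> _ i [chi tchi ->].
  exists (fun x => \int[mu]_y (psi y * partial i chi (x + y))).
    by exists (partial i chi) => //; exact: test_partial.
  move=> x.
  have := is_derive_int_translate i 0 lpsi (test_translate x tchi).
  have [schi _] := (test_functionP _).1 tchi.
  rewrite (partial_translate x i schi).
  have -> : (fun t : R => \int[mu]_y (psi y * chi (x + (t *: ev i + y)))) =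
      fun t : R => (fun x => \int[mu]_y (psi y * chi (x + y))) (t *: ev i + x).
    by apply/funext => t; apply: eq_Rintegral => y _; rewrite addrCA addrA.
  pose c x' := \int[mu]_y (psi y * chi (x' + y)).
  move=> /(is_derive_lineP c x (ev i) 0 _).1; rewrite scale0r add0r => h.
  have -> : \int[mu]_y (psi y * partial i chi (x + y)) =
      \int[mu]_y (psi y * partial i chi (x + (0 + y))) by apply: eq_Rintegral => y _; rewrite add0r.
  exact: h.
Qed.

Lemma test_approx psi (N e : R) : continuous psi -> (forall x, N < `|x| -> psi x = 0) -> 0 < e ->
  exists chi, [/\ test_function chi, forall x, `|chi x - psi x| <= e &
    forall x, N + 1 < `|x| -> chi x = 0].
Proof.
move=> cpsi psiN e0; have bpsi : bsupp psi by exists N.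
have [rho [trho rho0 rho1 rhoN]] := mollifier_ex.
have [d d0 hd] := uniform_continuous_bsupp cpsi bpsi e0.
pose s := Num.min (d / 2) 1.
have s0 : 0 < s by rewrite lt_min divr_gt0 ?ltr01.
have sd : s < d by rewrite (@le_lt_trans _ _ (d / 2)) ?ge_min ?lexx// ltr_pdivrMr// ltr_pMr// ltr1n.
have s1 : s <= 1 by rewrite ge_min lexx orbT.
have si0 : 0 < s^-1 by rewrite invr_gt0.
pose phi := rho \o aff 0 s^-1%:M.
have tphi : test_function phi by apply: test_similitude trho; exact: similitude_scalar si0.
pose F x y := psi y * phi (- x + y).
have iF x : mu.-integrable setT (EFin \o F x).
  have tt := test_translate (- x) tphi.
  exact: locint_integrableMc (continuous_locint cpsi) (test_continuous tt) (test_bsupp tt).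
have Fs x y : F x (aff x s%:M y) = psi (x + s *: y) * rho y.
  rewrite /F /phi /= /aff !mul_mx_scalar add0r addKr scalerA mulVf ?gt_eqF//.
  by rewrite scale1r.
pose chi x := s ^- n * \int[mu]_y F x y.
have chiE x : chi x = \int[mu]_y (psi (x + s *: y) * rho y).
  rewrite /chi -(Rintegral_similitude x (similitude_scalar s0) (iF x)).
  by apply: eq_Rintegral => y _; exact: Fs.
have iFs x : mu.-integrable setT (EFin \o (fun y => psi (x + s *: y) * rho y)).
  have := integrable_similitude x (similitude_scalar s0) (iF x).
  by congr (_.-integrable _ _); apply/funext => y /=; rewrite Fs.
have irho : mu.-integrable setT (EFin \o rho).
  have [C C0 hC] := continuous_bsupp_bounded (test_continuous trho) (test_bsupp trho).
  exact: integrable_bsupp (continuous_measurable_row (test_continuous trho)) (test_bsupp trho) hC.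
exists chi; split.
(* [chi] is a correlation evaluated at -x, up to a factor; x -> -x is a similitude of ratio 1. *)
- have t1 := test_correlation cpsi bpsi tphi.
  have N1 : @similitude R n 1 (-1)%:M.
    by split => //; rewrite tr_scalar_mx -scalar_mxM mulrNN mulr1 expr1n.
  have := test_scale (s ^- n) (test_similitude 0 N1 t1).
  congr test_function; apply/funext => x; rewrite /chi/= /aff; congr (_ * _).
  by apply: eq_Rintegral => y _; rewrite add0r mul_mx_scalar scaleN1r.
- move=> x; have ip := integrableZl measurableT (psi x) irho.
  have -> : psi x = \int[mu]_y (psi x * rho y).
    by rewrite (RintegralZl (psi x) measurableT irho) rho1 mulr1.
  rewrite chiE -(RintegralB measurableT (iFs x) ip).
  have id := integrableB measurableT (iFs x) ip.
  apply: (le_trans (le_normr_Rintegral measurableT id)).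
  have -> : e = \int[mu]_y (e * rho y) by rewrite (RintegralZl e measurableT irho) rho1 mulr1.
  apply: (le_Rintegral measurableT).
  - exact: integrable_norm id.
  - exact: (integrableZl measurableT e irho).
  move=> y _; rewrite -mulrBl normrM (ger0_norm (rho0 y)).
  have [y1|y1] := leP `|y| 1; last by rewrite rhoN// !mulr0.
  rewrite ler_wpM2r// distrC ltW// hd// opprD addrA subrr sub0r normrN.
  by rewrite mx_normZ gtr0_norm// (le_lt_trans _ sd)// ler_piMr// ltW.
- move=> x xN; rewrite chiE (_ : (fun y => _) = fun=> 0).
    by rewrite Rintegral_cst// mul0r.
  apply/funext => y; have [y1|y1] := leP `|y| 1; last by rewrite rhoN// mulr0.
  rewrite psiN ?mul0r//; have := ler_normB (x + s *: y) (s *: y); rewrite addrK.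
  have : `|s *: y| <= 1 by rewrite mx_normZ gtr0_norm// mulr_ile1// ltW.
  by move: xN; move: (`|x|) (`|s *: y|) (`|x + _|) => *; lra.
Qed.

End mollification.

(** * Difference quotients tested against continuous functions *)

Section difference_quotients.
Context {R : realType} {n : nat}.
Local Notation mu := (@lebesgue_row R n).
Variable p : R.
Hypothesis p1 : 1 <= p.
Implicit Types (x y z a : 'rV[R]_n) (u v phi psi chi : 'rV[R]_n -> R)
  (g k : 'rV[R]_n -> 'rV[R]_n) (i : 'I_n).
Local Notation ev i := (delta_mx (@ord0 0) i : 'rV[R]_n).

Definition local_mass (v : 'rV[R]_n -> R) N : R := \int[mu]_x `|v x * \1_(cball N) x|.

Lemma local_mass_ge0 v N : 0 <= local_mass v N.
Proof. by apply: Rintegral_ge0 => x _; exact: normr_ge0. Qed.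

Lemma integrable_local v N : locint v ->
  mu.-integrable setT (EFin \o (fun x => `|v x * \1_(cball N) x|)).
Proof.
move=> lv; apply: integrable_norm; apply: (@locint_integrableM R n v _ 1) => //.
- by apply: measurable_indic; exact: measurable_cball.
- exists N => x xN; rewrite indicE memNset//= => xN'.
  by move: xN; rewrite ltNge xN'.
- by move=> x; rewrite indicE; case: (_ \in _); rewrite ?normr1 ?normr0.
Qed.

Lemma Rintegral_bsupp_le v (f : 'rV[R]_n -> R) (N C : R) : locint v -> measurable_fun setT f ->
  (forall x, N < `|x| -> f x = 0) -> (forall x, `|f x| <= C) ->
  mu.-integrable setT (EFin \o (fun x => v x * f x)) /\
  `|\int[mu]_x (v x * f x)| <= C * local_mass v N.
Proof.
move=> lv mf fN fC.
have ivf := locint_integrableM lv mf (ex_intro _ N fN) fC.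
split; first exact: ivf.
have C0 : 0 <= C by exact: le_trans (fC 0).
have il := integrable_local N lv.
apply: (le_trans (le_normr_Rintegral measurableT ivf)).
rewrite -(RintegralZl C measurableT il); apply: (le_Rintegral measurableT).
- exact: integrable_norm ivf.
- exact: (integrableZl measurableT C il).
move=> x _; rewrite !normrM indicE; have [xN|xN] := leP `|x| N; last first.
  by rewrite fN// normr0 mulr0 mulr_ge0.
by rewrite mem_set// normr1 mulr1 mulrC ler_wpM2r.
Qed.

Lemma continuous_row_shift psi a : continuous psi -> continuous (fun x => psi (a + x)).
Proof.
have -> : (fun x => psi (a + x)) = (fun x => psi (aff a 1%:M x)).
  by apply/funext => x; rewrite /aff mulmx1.
by move=> cpsi; exact: continuous_row_comp (@continuous_aff R n a 1%:M) cpsi.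
Qed.

Lemma shift_eq0 psi (N t : R) i x : (forall x, N < `|x| -> psi x = 0) -> `|t| <= 1 ->
  N + 1 < `|x| -> psi (t *: ev i + x) = 0.
Proof.
move=> psiN t1 xN; apply: psiN; have := ler_normB (t *: ev i + x) (t *: ev i).
rewrite addrC addKr; have := norm_scale_delta t i.
by move: xN t1; move: (`|x|) (`|t|) (`|t *: _|) (`|_ + _|) => *; lra.
Qed.

(** After a translation of the variable, this is the integral against [psi] of the backward quotient
    (u(x - t e_i) - u(x)) / t. *)
Definition dquot u i (t : R) psi : R :=
  t^-1 * (\int[mu]_x (u x * psi (t *: ev i + x)) - \int[mu]_x (u x * psi x)).

Lemma integrable_shift u psi (N t : R) i : continuous u -> continuous psi ->
  (forall x, N < `|x| -> psi x = 0) -> `|t| <= 1 ->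
  mu.-integrable setT (EFin \o (fun x => u x * psi (t *: ev i + x))).
Proof.
move=> cu cpsi psiN t1; apply: locint_integrableMc (continuous_locint cu) _ _.
- exact: continuous_row_shift.
- by exists (N + 1) => x; exact: shift_eq0.
Qed.

Lemma integrable_cbsupp u psi (N : R) : continuous u -> continuous psi ->
  (forall x, N < `|x| -> psi x = 0) ->
  mu.-integrable setT (EFin \o (fun x => u x * psi x)).
Proof.
by move=> cu cpsi psiN; apply: locint_integrableMc (continuous_locint cu) cpsi _; exists N.
Qed.

Lemma dquotB u i (t N : R) psi chi : continuous u -> continuous psi -> continuous chi ->
  (forall x, N < `|x| -> psi x = 0) -> (forall x, N < `|x| -> chi x = 0) -> `|t| <= 1 ->
  dquot u i t (fun x => psi x - chi x) = dquot u i t psi - dquot u i t chi.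
Proof.
move=> cu cp cc pN cN t1.
have a1 := integrable_shift i cu cp pN t1; have a2 := integrable_shift i cu cc cN t1.
have b1 := integrable_cbsupp cu cp pN; have b2 := integrable_cbsupp cu cc cN.
have E1 : \int[mu]_x (u x * (psi (t *: ev i + x) - chi (t *: ev i + x))) =
    \int[mu]_x (u x * psi (t *: ev i + x)) - \int[mu]_x (u x * chi (t *: ev i + x)).
  rewrite -(RintegralB measurableT a1 a2); apply: eq_Rintegral => x _; exact: mulrBr.
have E2 : \int[mu]_x (u x * (psi x - chi x)) = \int[mu]_x (u x * psi x) - \int[mu]_x (u x * chi x).
  rewrite -(RintegralB measurableT b1 b2); apply: eq_Rintegral => x _; exact: mulrBr.
rewrite /dquot E1 E2; ring.
Qed.

Lemma dquot_crude u i (t N C : R) psi : continuous u -> continuous psi -> 0 <= N ->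
  (forall x, N < `|x| -> psi x = 0) -> (forall x, `|psi x| <= C) -> 0 < t <= 1 ->
  `|dquot u i t psi| <= t^-1 * (2 * C * local_mass u (N + 1)).
Proof.
move=> cu cp N0 pN pC /andP[t0 t1]; have t1' : `|t| <= 1 by rewrite gtr0_norm.
have lu := continuous_locint cu.
have m1 := continuous_measurable_row (@continuous_row_shift psi (t *: ev i) cp).
have [_ h1] := Rintegral_bsupp_le lu m1 (fun x => @shift_eq0 psi N t i x pN t1') (fun x => pC _).
have pN' x : N + 1 < `|x| -> psi x = 0 by move=> xN; apply: pN; lra.
have [_ h2] := Rintegral_bsupp_le lu (continuous_measurable_row cp) pN' pC.
rewrite /dquot normrM gtr0_norm ?invr_gt0// ler_wpM2l ?invr_ge0 ?(ltW t0)//.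
apply: (le_trans (ler_normB _ _)); move: (lerD h1 h2) => /le_trans; apply.
by rewrite -mulrA mulr2n mulrDl mul1r.
Qed.

(** By the mean value theorem in the translation parameter, the quotient is a weak derivative tested
    against one translate of [phi]; hence a bound independent of t and of the derivatives of
    [phi]. *)
Lemma dquot_test_le u g i (t N C : R) phi : sobolev p u g -> test_function phi ->
  (forall x, N < `|x| -> phi x = 0) -> (forall x, `|phi x| <= C) -> 0 < t <= 1 ->
  `|dquot u i t phi| <= C * local_mass (fun x => g x ord0 i) (N + 1).
Proof.
move=> ug tphi phiN phiC /andP[t0 t1]; have [cu _ _ wu] := ug.
have [sphi _] := (test_functionP _).1 tphi.
have lu := continuous_locint cu.
have [s /andP[s0 st]] := MVT_is_derive (ltW t0) (fun s => is_derive_int_translate i s lu tphi).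
rewrite subr0 => E.
have s1 : `|s| <= 1 by rewrite ger0_norm// (le_trans st).
have tt := test_translate (s *: ev i) tphi.
have m1 := continuous_measurable_row (test_continuous tt).
have [_ h] := Rintegral_bsupp_le (sobolev_locint i p1 ug) m1
  (fun x => @shift_eq0 phi N s i x phiN s1) (fun x => phiC _).
have W := wu i _ tt; rewrite (partial_translate _ i sphi) in W.
rewrite W in E.
have z : \int[mu]_x (u x * phi (0 *: ev i + x)) = \int[mu]_x (u x * phi x).
  by apply: eq_Rintegral => x _; rewrite scale0r add0r.
rewrite z in E.
by rewrite /dquot E mulrC mulfK ?gt_eqF// normrN.
Qed.

(** For fixed t, [psi] is replaced by a test function so close that even the crude bound, with its
    factor 1/t, is negligible on the difference. *)
Lemma dquot_le u g i (t N C : R) psi : sobolev p u g -> continuous psi -> 0 <= N ->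
  (forall x, N < `|x| -> psi x = 0) -> (forall x, `|psi x| <= C) -> 0 < t <= 1 ->
  `|dquot u i t psi| <= C * local_mass (fun x => g x ord0 i) (N + 2).
Proof.
move=> ug cp N0 pN pC t01; have [cu _ _ _] := ug.
have /andP[t0 t1] := t01; have t1' : `|t| <= 1 by rewrite gtr0_norm.
set G := local_mass _ _; pose A := t^-1 * (2 * local_mass u (N + 1 + 1)).
have G0 : 0 <= G by exact: local_mass_ge0.
have A0 : 0 <= A by rewrite !mulr_ge0 ?local_mass_ge0// invr_ge0 ltW.
apply/ler_addgt0Pr => e e0.
have AG : 0 < A + G + 1 by rewrite ltr_wpDl// addr_ge0.
have d0 : 0 < e / (A + G + 1) by rewrite divr_gt0.
have [chi [tchi dchi chiN]] := test_approx cp pN d0.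
set d := e / (A + G + 1) in d0 dchi *.
have cc := test_continuous tchi.
have pN1 x : N + 1 < `|x| -> psi x = 0 by move=> xN; apply: pN; lra.
have B := @dquotB u i t (N + 1) psi chi cu cp cc pN1 chiN t1'.
have N1 : 0 <= N + 1 by rewrite addr_ge0.
have cd : continuous (fun x => psi x - chi x).
  by move=> x; apply: (@cvgB _ _ _ (nbhs x)); [exact: cp|exact: cc].
have dN x : N + 1 < `|x| -> psi x - chi x = 0 by move=> xN; rewrite pN1// chiN// subrr.
have dd x : `|psi x - chi x| <= d by rewrite distrC.
have h1 := dquot_crude i cu cd N1 dN dd t01.
have chiC x : `|chi x| <= C + d.
  by rewrite -(subrK (psi x) (chi x)) (le_trans (ler_normD _ _))// addrC lerD.
have h2 := dquot_test_le i ug tchi chiN chiC t01.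
have G2 : local_mass (fun x => g x ord0 i) (N + 1 + 1) = G by rewrite /G -addrA.
rewrite G2 in h2; rewrite B in h1.
have : d * (A + G + 1) = e by rewrite /d divfK// gt_eqF.
have h3 : `|dquot u i t psi| <= `|dquot u i t psi - dquot u i t chi| + `|dquot u i t chi|.
  by rewrite -{1}(subrK (dquot u i t chi) (dquot u i t psi)) ler_normD.
have h1' : `|dquot u i t psi - dquot u i t chi| <= d * A.
  by apply: (le_trans h1); rewrite /A; lra.
move: h3 h2 h1' d0; move: (`|dquot u i t psi|) (`|dquot u i t chi|) (`|_ - _|) => x y z *.
nra.
Qed.

(** The limit is known for test functions; the bound of [dquot_le], uniform in t, extends it to
    continuous functions, even varying uniformly with t. That variation is needed because the
    discrete chain rule produces weights depending on t. *)
Lemma dquot_cvg u g i (N : R) (t_ : nat -> R) (psi_ : nat -> 'rV[R]_n -> R) psi :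
  sobolev p u g -> 0 <= N -> (forall k : nat, 0 < t_ k <= 1) -> t_ @ \oo --> (0 : R) ->
  (forall k : nat, continuous (psi_ k)) -> continuous psi ->
  (forall (k : nat) x, N < `|x| -> psi_ k x = 0) -> (forall x, N < `|x| -> psi x = 0) ->
  (forall e : R, 0 < e -> \forall k \near \oo, forall x, `|psi_ k x - psi x| <= e) ->
  (fun k : nat => dquot u i (t_ k) (psi_ k)) @ \oo --> - \int[mu]_x (g x ord0 i * psi x).
Proof.
move=> ug N0 t01 t0 cp_ cp pN_ pN unif; have [cu _ _ wu] := ug.
have lg := sobolev_locint i p1 ug.
set G := local_mass (fun x => g x ord0 i) (N + 1 + 2).
set G1 := local_mass (fun x => g x ord0 i) (N + 1).
have G0 : 0 <= G by exact: local_mass_ge0. have G10 : 0 <= G1 by exact: local_mass_ge0.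
apply/cvgrPdist_le => e e0.
have S0 : 0 < 2 * G + G1 + 1 by rewrite ltr_wpDl// addr_ge0// mulr_ge0.
have d0 : 0 < e / (2 * G + G1 + 1) by rewrite divr_gt0.
have [chi [tchi dchi chiN]] := test_approx cp pN d0.
set d := e / (2 * G + G1 + 1) in d0 dchi *.
have cc := test_continuous tchi.
have der := is_derive_int_translate i 0 (continuous_locint cu) tchi.
have /is_derive_epsP/(_ _ d0) [r [r0 hr]] := der.
have psiN1 x : N + 1 < `|x| -> psi x = 0 by move=> xN; apply: pN; lra.
have E1 : \int[mu]_x (u x * partial i chi (0 *: ev i + x)) = - \int[mu]_x (g x ord0 i * chi x).
  by rewrite -(wu i chi tchi); apply: eq_Rintegral => x _; rewrite scale0r add0r.
have z : \int[mu]_x (u x * chi (0 *: ev i + x)) = \int[mu]_x (u x * chi x).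
  by apply: eq_Rintegral => x _; rewrite scale0r add0r.
have ic : mu.-integrable setT (EFin \o (fun x => g x ord0 i * chi x)).
  by apply: (locint_integrableMc lg cc); exists (N + 1).
have ip : mu.-integrable setT (EFin \o (fun x => g x ord0 i * psi x)).
  by apply: (locint_integrableMc lg cp); exists N.
have h3 : `|\int[mu]_x (g x ord0 i * chi x) - \int[mu]_x (g x ord0 i * psi x)| <= d * G1.
  have cd : continuous (fun x => chi x - psi x).
    by move=> x; apply: (@cvgB _ _ _ (nbhs x)); [exact: cc|exact: cp].
  have dN x : N + 1 < `|x| -> chi x - psi x = 0 by move=> xN; rewrite psiN1// chiN// subrr.
  have [_] := Rintegral_bsupp_le lg (continuous_measurable_row cd) dN dchi.
  suff -> : \int[mu]_x (g x ord0 i * (chi x - psi x)) =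
    \int[mu]_x (g x ord0 i * chi x) - \int[mu]_x (g x ord0 i * psi x) by [].
  by rewrite -(RintegralB measurableT ic ip); apply: eq_Rintegral => x _; exact: mulrBr.
near=> k; have tk := t01 k; have /andP[tk0 tk1] := tk.
have t1' : `|t_ k| <= 1 by rewrite gtr0_norm.
have h2 : `|dquot u i (t_ k) chi - - \int[mu]_x (g x ord0 i * chi x)| < d.
  have tr : `|t_ k| < r by near: k; have := cvgr_norm_lt _ t0 r; rewrite normr0; apply.
  have := hr (t_ k) (lt0r_neq0 tk0) tr; rewrite E1 z.
  have -> : t_ k *: (1 : R) + 0 = t_ k by rewrite addr0; exact: mulr1.
  exact.
have N1 : 0 <= N + 1 by rewrite addr_ge0.
have pkN1 x : N + 1 < `|x| -> psi_ k x = 0 by move=> xN; apply: pN_; lra.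
have h1 : `|dquot u i (t_ k) (psi_ k) - dquot u i (t_ k) chi| <= 2 * d * G.
  rewrite -(@dquotB u i (t_ k) (N + 1) (psi_ k) chi cu (cp_ k) cc pkN1 chiN t1').
  apply: dquot_le => //.
  - by move=> x; apply: (@cvgB _ _ _ (nbhs x)); [exact: cp_|exact: cc].
  - by move=> x xN; rewrite pkN1// chiN// subrr.
  - move=> x; rewrite -(subrKA (psi x)) (le_trans (ler_normD _ _))// mulr2n mulrDl mul1r.
    rewrite lerD//; last by rewrite distrC.
    by move: x; near: k; exact: (unif d d0).
have eE : d * (2 * G + G1 + 1) = e by rewrite /d divfK// gt_eqF.
move: h1 h2 h3; rewrite -eE.
move: (\int[mu]_x (g x ord0 i * psi x)) (\int[mu]_x (g x ord0 i * chi x)) => I J.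
move: (dquot u i (t_ k) (psi_ k)) (dquot u i (t_ k) chi) => X Y.
move=> /ler_normlP[h11 h12] /ltr_normlP[h21 h22] /ler_normlP[h31 h32].
rewrite ler_norml; apply/andP; split; lra.
Unshelve. all: by end_near. Qed.

End difference_quotients.

(** * Absolute value, maximum and minimum of Sobolev functions *)

Section lattice.
Context {R : realType} {n : nat}.
Local Notation mu := (@lebesgue_row R n).
Variable p : R.
Hypothesis p1 : 1 <= p.
Implicit Types (x y z a : 'rV[R]_n) (u v phi psi chi : 'rV[R]_n -> R)
  (g k : 'rV[R]_n -> 'rV[R]_n) (i : 'I_n).
Local Notation ev i := (delta_mx (@ord0 0) i : 'rV[R]_n).

Definition soft (e t : R) : R := Num.sqrt (t ^+ 2 + e ^+ 2).

Section soft.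
Variable e : R.
Hypothesis e0 : 0 < e.

Let s2_ge0 (t : R) : 0 <= t ^+ 2 + e ^+ 2.
Proof. by rewrite addr_ge0// sqr_ge0. Qed.

Lemma soft_sqr (t : R) : soft e t ^+ 2 = t ^+ 2 + e ^+ 2.
Proof. by rewrite sqr_sqrtr. Qed.

Lemma soft_ge (t : R) : e <= soft e t.
Proof.
by rewrite -(ler_pXn2r (n := 2))// ?nnegrE ?sqrtr_ge0 ?(ltW e0)// soft_sqr lerDr sqr_ge0.
Qed.

Lemma soft_gt0 (t : R) : 0 < soft e t.
Proof. exact: lt_le_trans e0 (soft_ge t). Qed.

Lemma norm_le_soft (t : R) : `|t| <= soft e t.
Proof.
rewrite -(ler_pXn2r (n := 2))// ?nnegrE ?sqrtr_ge0// soft_sqr -normrX ger0_norm ?sqr_ge0//.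
by rewrite lerDl sqr_ge0.
Qed.

Lemma soft_le (t : R) : soft e t <= `|t| + e.
Proof.
rewrite -(ler_pXn2r (n := 2))// ?nnegrE ?sqrtr_ge0 ?addr_ge0 ?(ltW e0)//.
rewrite soft_sqr sqrrD -normrX ger0_norm ?sqr_ge0//.
by rewrite lerD2r lerDl mulrn_wge0// mulr_ge0// ltW.
Qed.

Lemma soft_lip (a b : R) : `|soft e a - soft e b| <= `|a - b|.
Proof.
have ab : 0 < soft e a + soft e b by rewrite addr_gt0 ?soft_gt0.
rewrite -(ler_pM2r ab) -{1}(gtr0_norm ab) -normrM -subr_sqr !soft_sqr.
rewrite opprD addrACA subrr addr0 subr_sqr normrM ler_wpM2l//.
by rewrite (le_trans (ler_normD _ _))// lerD// norm_le_soft.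
Qed.

(** The divided difference of [soft e] between a and b, in a form that is also defined and
    continuous at a = b, where it is the derivative. *)
Definition soft_slope (a b : R) : R := (a + b) / (soft e a + soft e b).

Lemma soft_slopeE (a b : R) : (a - b) * soft_slope a b = soft e a - soft e b.
Proof.
have ab : soft e a + soft e b != 0 by rewrite gt_eqF// addr_gt0 ?soft_gt0.
rewrite /soft_slope mulrA -subr_sqr; apply: (mulIf ab).
rewrite divfK// -subr_sqr !soft_sqr; ring.
Qed.

Lemma soft_slope_near (a b : R) : `|soft_slope a b - b / soft e b| <= `|a - b| / e.
Proof.
have a0 := soft_gt0 a; have b0 := soft_gt0 b.
have ab : 0 < soft e a + soft e b by rewrite addr_gt0.
have -> : soft_slope a b - b / soft e b =
    ((a - b) * soft e b + b * (soft e b - soft e a)) / ((soft e a + soft e b) * soft e b).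
  rewrite /soft_slope; field; rewrite !gt_eqF//.
rewrite normrM normfV (gtr0_norm (mulr_gt0 ab b0)) ler_pdivrMr ?mulr_gt0//.
apply: (@le_trans _ _ (`|a - b| * soft e b + soft e b * `|a - b|)).
  apply: (le_trans (ler_normD _ _)); apply: lerD; first by rewrite normrM (gtr0_norm b0).
  rewrite normrM; apply: ler_pM => //; first exact: norm_le_soft.
  by rewrite distrC; exact: soft_lip.
rewrite (mulrC (soft e b)) -mulr2n -mulr_natr -!mulrA ler_wpM2l//.
rewrite ler_pdivlMl// mulrCA (mulrC (_ + _)) ler_wpM2l ?(ltW b0)//.
have := soft_ge a; have := soft_ge b; move: (soft e a) (soft e b) => *; lra.
Qed.

Lemma soft_ratio_le1 (b : R) : `|b / soft e b| <= 1.
Proof.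
by rewrite normrM normfV (gtr0_norm (soft_gt0 b)) ler_pdivrMr ?soft_gt0// mul1r norm_le_soft.
Qed.

Lemma continuous_soft u : continuous u -> continuous (fun x => soft e (u x)).
Proof.
move=> /continuous_rowP cu; apply/continuous_rowP => x d d0.
have [r [r0 hr]] := cu x d d0; exists r; split => // y xy.
by rewrite (le_lt_trans (soft_lip _ _))// hr.
Qed.

Lemma continuous_soft_slope u v : continuous u -> continuous v ->
  continuous (fun x => soft_slope (u x) (v x)).
Proof.
move=> cu cv x; apply: (@cvgM _ _ (nbhs x)).
  by apply: (@cvgD _ _ _ (nbhs x)); [exact: cu|exact: cv].
apply: (@cvgV _ _ (nbhs x)); first by rewrite gt_eqF// addr_gt0 ?soft_gt0.
by apply: (@cvgD _ _ _ (nbhs x)); exact: continuous_soft.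
Qed.

Lemma continuous_soft_ratio u : continuous u -> continuous (fun x => u x / soft e (u x)).
Proof.
move=> cu x; apply: (@cvgM _ _ (nbhs x)); first exact: cu.
apply: (@cvgV _ _ (nbhs x)); first by rewrite gt_eqF ?soft_gt0.
exact: continuous_soft.
Qed.

End soft.

Lemma continuous_bsupp_integrable f : continuous f -> bsupp f ->
  mu.-integrable setT (EFin \o f).
Proof.
move=> cf bf; have [C C0 hC] := continuous_bsupp_bounded cf bf.
exact: integrable_bsupp (continuous_measurable_row cf) bf hC.
Qed.

Let continuousM u v : continuous u -> continuous v -> continuous (fun x => u x * v x).
Proof. by move=> cu cv x; apply: (@cvgM _ _ (nbhs x)); [exact: cu|exact: cv]. Qed.

(** Discrete chain rule, an exact identity: the quotient of soft(u) is that of [u] with the slope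
    moved into the weight. *)
Lemma soft_shift u i (e t N : R) phi : 0 < e -> continuous u -> continuous phi ->
  (forall x, N < `|x| -> phi x = 0) ->
  dquot u i t (fun x => soft_slope e (u (- t *: ev i + x)) (u x) * phi x) =
  t^-1 * (\int[mu]_x (soft e (u x) * phi (t *: ev i + x)) -
          \int[mu]_x (soft e (u x) * phi x)).
Proof.
move=> e0 cu cphi phiN; rewrite /dquot; congr (_ * _).
pose a := - t *: ev i; pose m x := soft_slope e (u (a + x)) (u x).
have ca : continuous (fun x => u (a + x)) := @continuous_row_shift R n u a cu.
have cm : continuous m by exact: continuous_soft_slope.
have sh (F : 'rV[R]_n -> R) : continuous F -> (forall x, N < `|x| -> F x = 0) ->
    \int[mu]_x F (t *: ev i + x) = \int[mu]_x F x.
  move=> cF FN; rewrite -(Rintegral_translate (t *: ev i) (continuous_bsupp_integrable cF (ex_intro _ N FN))).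
  by apply: eq_Rintegral => x _; rewrite addrC.
have aK x : a + (t *: ev i + x) = x by rewrite /a scaleNr addKr.
pose F1 x := u (a + x) * (m x * phi x); pose F2 x := soft e (u (a + x)) * phi x.
pose F3 x := u x * (m x * phi x); pose F4 x := soft e (u x) * phi x.
have cmp := continuousM cm cphi.
have c1 : continuous F1 := continuousM ca cmp.
have c2 : continuous F2 := continuousM (continuous_soft e0 ca) cphi.
have c3 : continuous F3 := continuousM cu cmp.
have c4 : continuous F4 := continuousM (continuous_soft e0 cu) cphi.
have N1 x : N < `|x| -> F1 x = 0 by move=> xN; rewrite /F1 phiN// !mulr0.
have N2 x : N < `|x| -> F2 x = 0 by move=> xN; rewrite /F2 phiN// !mulr0.
have N3 x : N < `|x| -> F3 x = 0 by move=> xN; rewrite /F3 phiN// !mulr0.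
have N4 x : N < `|x| -> F4 x = 0 by move=> xN; rewrite /F4 phiN// !mulr0.
have i1 := continuous_bsupp_integrable c1 (ex_intro _ N N1).
have i2 := continuous_bsupp_integrable c2 (ex_intro _ N N2).
have i3 := continuous_bsupp_integrable c3 (ex_intro _ N N3).
have i4 := continuous_bsupp_integrable c4 (ex_intro _ N N4).
have E1 : \int[mu]_x (u x * (m (t *: ev i + x) * phi (t *: ev i + x))) = \int[mu]_x F1 x.
  by rewrite -(sh F1 c1 N1); apply: eq_Rintegral => x _; rewrite /F1 aK.
have E2 : \int[mu]_x (soft e (u x) * phi (t *: ev i + x)) = \int[mu]_x F2 x.
  by rewrite -(sh F2 c2 N2); apply: eq_Rintegral => x _; rewrite /F2 aK.
have E12 : \int[mu]_x F1 x - \int[mu]_x F3 x = \int[mu]_x F2 x - \int[mu]_x F4 x.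
  rewrite -(RintegralB measurableT i1 i3) -(RintegralB measurableT i2 i4).
  apply: eq_Rintegral => x _; rewrite /F1 /F2 /F3 /F4 /m -!mulrBl mulrA.
  by rewrite -(soft_slopeE e0) !mulrA.
exact: etrans (congr1 (fun r : R => r - _) E1) (etrans E12 (congr1 (fun r : R => r - _) (esym E2))).
Qed.

(** Serves both as the step of the difference quotients and as the parameter of [soft]. *)
Let t_ (k : nat) : R := k.+1%:R^-1.

Let t01 (k : nat) : 0 < t_ k <= 1.
Proof. by rewrite invr_gt0 ltr0n/= invf_le1 ?ltr0n// ler1n. Qed.

Let t_cvg : t_ @ \oo --> (0 : R).
Proof. exact: cvg_harmonic. Qed.

Let t_small (r : R) : 0 < r -> \forall k \near \oo, `|t_ k| < r.
Proof. by move=> r0; apply: (cvgr_norm_lt _ t_cvg); rewrite normr0. Qed.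

(** Both sides are limits of one sequence: through [soft_shift] it is a difference quotient of
    soft(u), and through [dquot_cvg] it tends to the integral with the weak gradient of [u]. *)
Lemma soft_weak u g i (e : R) phi : 0 < e -> sobolev p u g -> test_function phi ->
  \int[mu]_x (soft e (u x) * partial i phi x) =
  - \int[mu]_x (g x ord0 i * (u x / soft e (u x) * phi x)).
Proof.
move=> e0 ug tphi; have [cu _ _ _] := ug.
have cphi := test_continuous tphi; have [N0 phiN0] := test_bsupp tphi.
pose N := `|N0|; have N_ge0 : 0 <= N := normr_ge0 _.
have phiN x : N < `|x| -> phi x = 0 by move=> xN; apply: phiN0; exact: le_lt_trans (ler_norm _) xN.
have [C C0 hC] := continuous_bsupp_bounded cphi (test_bsupp tphi).
pose psi_ (k : nat) x := soft_slope e (u (- t_ k *: ev i + x)) (u x) * phi x.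
pose psi x := u x / soft e (u x) * phi x.
have c_ (k : nat) : continuous (psi_ k).
  by apply: continuousM cphi; apply: continuous_soft_slope => //; exact: continuous_row_shift.
have cpsi : continuous psi by apply: continuousM cphi; exact: continuous_soft_ratio.
have pN_ (k : nat) x : N < `|x| -> psi_ k x = 0 by move=> xN; rewrite /psi_ phiN// mulr0.
have pN x : N < `|x| -> psi x = 0 by move=> xN; rewrite /psi phiN// mulr0.
have unif (d : R) : 0 < d -> \forall k \near \oo, forall x, `|psi_ k x - psi x| <= d.
  move=> d0; have C1 : 0 < C + 1 by rewrite ltr_wpDl.
  have d'0 : 0 < d * e / (C + 1) by rewrite divr_gt0// mulr_gt0.
  have [r r0 hr] := @uniform_continuous_cball R n u N _ cu d'0.
  apply: filterS (t_small r0) => k tk x.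
  have [xN|xN] := leP `|x| N; last by rewrite pN_// pN// subrr normr0 ltW.
  rewrite /psi_ /psi -mulrBl normrM.
  have h1 : `|u (- t_ k *: ev i + x) - u x| <= d * e / (C + 1).
    rewrite distrC ltW// hr// opprD addrCA subrr addr0 scaleNr opprK.
    exact: le_lt_trans (norm_scale_delta _ _) tk.
  have h2 := soft_slope_near e0 (u (- t_ k *: ev i + x)) (u x).
  have h3 : `|soft_slope e (u (- t_ k *: ev i + x)) (u x) - u x / soft e (u x)| <= d / (C + 1).
    apply: (le_trans h2); rewrite ler_pdivrMr// mulrAC; exact: h1.
  apply: (le_trans (ler_pM (normr_ge0 _) (normr_ge0 _) h3 (hC x))).
  by rewrite mulrAC ler_pdivrMr// ler_wpM2l ?(ltW d0)// lerDl.
have L1 := @dquot_cvg R n p p1 u g i N t_ psi_ psi ug N_ge0 t01 t_cvg c_ cpsi pN_ pN unif.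
have der := is_derive_int_translate i 0 (continuous_locint (continuous_soft e0 cu)) tphi.
have z (f : 'rV[R]_n -> R) : \int[mu]_x (soft e (u x) * f (0 *: ev i + x)) = \int[mu]_x (soft e (u x) * f x).
  by apply: eq_Rintegral => x _; rewrite scale0r add0r.
have L2 : (fun k : nat => dquot u i (t_ k) (psi_ k)) @ \oo -->
    \int[mu]_x (soft e (u x) * partial i phi x).
  apply/cvgrPdist_lt => d d0.
  have /is_derive_epsP/(_ _ d0) [r [r0 hr]] := der.
  apply: filterS (t_small r0) => k tk.
  have /andP[tk0 _] := t01 k.
  have := hr (t_ k) (lt0r_neq0 tk0) tk; rewrite !z.
  have -> : t_ k *: (1 : R) + 0 = t_ k by rewrite addr0; exact: mulr1.
  by rewrite -(soft_shift i (t_ k) e0 cu cphi phiN) distrC.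
exact: norm_cvg_unique L2 L1.
Qed.

Let soft_cvg (s : R) : (fun k : nat => soft (t_ k) s) @ \oo --> `|s|.
Proof.
apply/cvgrPdist_le => e e0; apply: filterS (t_small e0) => k tk; have /andP[tk0 _] := t01 k.
have := norm_le_soft (t_ k) s; have := soft_le tk0 s.
have := le_lt_trans (ler_norm (t_ k)) tk.
move: (soft (t_ k) s) (`|s|) (t_ k) => a b c *; rewrite ler_norml; apply/andP; split; lra.
Qed.

Let ratio_cvg (s : R) : (fun k : nat => s / soft (t_ k) s) @ \oo --> Num.sg s.
Proof.
have [->|s0] := eqVneq s 0.
  rewrite sgr0 (_ : (fun k : nat => _) = fun=> 0); first exact: cvg_cst.
  by apply/funext => k; rewrite mul0r.
have -> : Num.sg s = s / `|s|.
  by rewrite {2}[s]numEsg mulfK// normr_eq0.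
apply: cvgM; first exact: cvg_cst.
by apply: cvgV; [rewrite normr_eq0|exact: soft_cvg].
Qed.

(** The parameter of [soft] tends to 0 in [soft_weak]. The ratio u / soft(u) tends to the sign, with
    value 0 on the zero set, where the gradient of |u| is accordingly set to 0. *)
Lemma sobolev_abs u g : sobolev p u g ->
  sobolev p (fun x => `|u x|) (fun x => Num.sg (u x) *: g x).
Proof.
move=> ug; have [cu mg ig _] := ug.
have cr (k : nat) := continuous_soft_ratio (andP (t01 k)).1 cu.
have ms : measurable_fun setT (fun x => Num.sg (u x)).
  apply: (@measurable_fun_cvg _ _ R setT (fun (k : nat) x => u x / soft (t_ k) (u x))) => [k|x _].
    exact: continuous_measurable_row (cr k).
  exact: ratio_cvg.
have msg : measurable_fun setT (fun x => Num.sg (u x) *: g x).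
  apply: measurable_fun_coord => i; under eq_fun do rewrite mxE.
  exact: (measurable_funM ms (measurable_coord_comp i mg)).
have p0 : 0 <= p by exact: le_trans p1.
split; [|exact: msg| |].
- apply/continuous_rowP => x e e0; have [d [d0 hd]] := (continuous_rowP u).1 cu x e e0.
  by exists d; split => // y /hd; apply: le_lt_trans; exact: ler_dist_dist.
- apply: integrable_le ig; first exact: measurable_enorm_powR.
  move=> x; rewrite ger0_norm ?powR_ge0// le_powR ?enorm_ge0// enormZ.
  by rewrite normr_sg ler_piMl ?enorm_ge0// lern1 leq_b1.
move=> i phi tphi; have tp := test_partial i tphi.
have mphi := continuous_measurable_row (test_continuous tphi).
have lg := sobolev_locint i p1 ug.
have A : (fun k : nat => \int[mu]_x (soft (t_ k) (u x) * partial i phi x)) @ \oo -->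
    \int[mu]_x (`|u x| * partial i phi x).
  have iv : mu.-integrable setT (EFin \o (fun x => `|soft 1 (u x) * partial i phi x| + `|partial i phi x|)).
    have c1 := continuousM (continuous_soft ltr01 cu) (test_continuous tp).
    have j1 := continuous_bsupp_integrable c1 (bsuppMr _ (test_bsupp tp)).
    have j2 := continuous_bsupp_integrable (test_continuous tp) (test_bsupp tp).
    exact: (integrableD measurableT (integrable_norm j1) (integrable_norm j2)).
  apply: (Rintegral_dominated _ _ iv _).2 => [k|x|k x].
  - apply: continuous_measurable_row; apply: continuousM (test_continuous tp).
    exact: (@continuous_soft (t_ k) (andP (t01 k)).1 u cu).
  - by apply: cvgMr_tmp; exact: soft_cvg.
  - have /andP[tk0 tk1] := t01 k.
    rewrite !normrM (gtr0_norm (soft_gt0 tk0 _)) (gtr0_norm (soft_gt0 ltr01 _)).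
    have le1 : soft (t_ k) (u x) <= soft 1 (u x) + 1; last first.
      by have := ler_wpM2r (normr_ge0 (partial i phi x)) le1; rewrite mulrDl mul1r.
    have := soft_le tk0 (u x); have := norm_le_soft 1 (u x); lra.
have B : (fun k : nat => \int[mu]_x (g x ord0 i * (u x / soft (t_ k) (u x) * phi x))) @ \oo -->
    \int[mu]_x ((Num.sg (u x) *: g x) ord0 i * phi x).
  have j := locint_integrableMc lg (test_continuous tphi) (test_bsupp tphi).
  apply: (Rintegral_dominated _ _ (integrable_norm j) _).2 => [k|x|k x].
  - apply: measurable_funM; first exact: measurable_coord_comp.
    exact: (measurable_funM (continuous_measurable_row (cr k)) mphi).
  - rewrite mxE -mulrA mulrCA; apply: cvgMl_tmp.
    by apply: cvgMr_tmp; exact: ratio_cvg.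
  - rewrite /= !normrM ler_wpM2l// ler_piMl// -normrM.
    exact: soft_ratio_le1 (andP (t01 k)).1 _.
have E (k : nat) : \int[mu]_x (soft (t_ k) (u x) * partial i phi x) =
    - \int[mu]_x (g x ord0 i * (u x / soft (t_ k) (u x) * phi x)).
  exact: soft_weak (andP (t01 k)).1 ug tphi.
rewrite (_ : (fun k : nat => _) =
  (fun k : nat => - \int[mu]_x (g x ord0 i * (u x / soft (t_ k) (u x) * phi x)))) in A.
  exact: norm_cvg_unique A (cvgN B).
exact/funext.
Qed.

Let le_half_double (a b c d : R) : 0 <= b -> a + b <= (c + d) / 2 -> a + a <= c + d.
Proof. by move=> *; lra. Qed.

(** Pointwise, the gradients of maximum and minimum are those of [u] and [v] in some order, except
    where u = v: there both are the mean (g + k)/2, and Clarkson's pointwise inequality gives the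
    bound. *)
Lemma sobolev_max_min u v g k : 2 <= p -> sobolev p u g -> sobolev p v k ->
  exists G H, [/\ sobolev p (fun x => Num.max (u x) (v x)) G,
    sobolev p (fun x => Num.min (u x) (v x)) H &
    energy p G + energy p H <= energy p g + energy p k].
Proof.
move=> p2 ug vk; have sD := sobolevD p1 ug vk; have sB := sobolevB p1 ug vk.
have sA := sobolev_abs sB.
pose s x : R := Num.sg (u x - v x).
pose G x := 2^-1 *: ((g x + k x) + s x *: (g x - k x)).
pose H x := 2^-1 *: ((g x + k x) - s x *: (g x - k x)).
have sG : sobolev p (fun x => 2^-1 * ((u x + v x) + `|u x - v x|)) G.
  exact: sobolevZ p1 (sobolevD p1 sD sA).
have sH : sobolev p (fun x => 2^-1 * ((u x + v x) - `|u x - v x|)) H.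
  exact: sobolevZ p1 (sobolevB p1 sD sA).
exists G, H; split.
- suff -> : (fun x => Num.max (u x) (v x)) = (fun x => 2^-1 * ((u x + v x) + `|u x - v x|)) by [].
  by apply/funext => x; rewrite maxr_absE mulrC.
- suff -> : (fun x => Num.min (u x) (v x)) = (fun x => 2^-1 * ((u x + v x) - `|u x - v x|)) by [].
  by apply/funext => x; rewrite minr_absE mulrC.
have [_ _ iG _] := sG; have [_ _ iH _] := sH; have [_ _ ig _] := ug; have [_ _ ik _] := vk.
have E1 := @RintegralD _ _ _ mu setT _ _ measurableT iG iH.
have E2 := @RintegralD _ _ _ mu setT _ _ measurableT ig ik.
have hle : \int[mu]_x (enorm (G x) `^ p + enorm (H x) `^ p) <=
    \int[mu]_x (enorm (g x) `^ p + enorm (k x) `^ p).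
  apply: (le_Rintegral measurableT).
  - exact: (integrableD measurableT iG iH).
  - exact: (integrableD measurableT ig ik).
  move=> x _; rewrite /G /H /s; case: (sgrP (u x - v x)) => _.
  - rewrite scale0r addr0 subr0.
    have := clarkson_pointwise (g x) (k x) p2.
    have := powR_ge0 (enorm (2^-1 *: (g x - k x))) p.
    exact: le_half_double.
  - have -> : 2^-1 *: (g x + k x + 1 *: (g x - k x)) = g x.
      by apply/rowP => j; rewrite !mxE; field.
    have -> : 2^-1 *: (g x + k x - 1 *: (g x - k x)) = k x.
      by apply/rowP => j; rewrite !mxE; field.
    exact: lexx.
  - have -> : 2^-1 *: (g x + k x + -1 *: (g x - k x)) = k x.
      by apply/rowP => j; rewrite !mxE; field.
    have -> : 2^-1 *: (g x + k x - -1 *: (g x - k x)) = g x.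
      by apply/rowP => j; rewrite !mxE; field.
    by rewrite addrC.
exact: (eq_ind _ (fun r : R => r <= _) (eq_ind _ (fun r : R => _ <= r) hle _ E2) _ E1).
Qed.

End lattice.

(** * Rayleigh quotients *)

Section rayleigh.
Context {R : realType} {n : nat}.
Implicit Types (x y z a : 'rV[R]_n) (u v phi : 'rV[R]_n -> R)
  (g k : 'rV[R]_n -> 'rV[R]_n) (i : 'I_n).
Variable p : R.
Hypothesis p2 : 2 <= p.
Hypothesis np : n%:R < p.

Let p1 : 1 <= p. Proof. by apply: le_trans p2; rewrite ler1n. Qed.
Let p0 : 0 < p. Proof. exact: lt_le_trans ltr01 p1. Qed.
Local Notation al := (1 - n%:R / p).
Local Notation q := (p - n%:R).
Implicit Types Omega : set 'rV[R]_n.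

Let al0 : 0 < al.
Proof. by rewrite subr_gt0 ltr_pdivrMr// mul1r. Qed.

Let alp : al * p = q.
Proof. by rewrite mulrBl mul1r divfK// gt_eqF. Qed.

Let powR_inv (a r : R) : 0 <= a -> a^-1 `^ r = (a `^ r)^-1.
Proof. by move=> a0; rewrite -powR_inv1// -powRrM mulN1r powRN. Qed.

Lemma bdry_dist_le Omega x y : ~ Omega y -> bdry_dist Omega x <= enorm (x - y).
Proof.
move=> Oy; apply: ge_inf; last by exists y.
by exists 0 => _ [z _ <-]; exact: enorm_ge0.
Qed.

Lemma bdry_dist_ge Omega x z (d : R) : ~ Omega z ->
  (forall y, ~ Omega y -> d <= enorm (x - y)) -> d <= bdry_dist Omega x.
Proof.
move=> Oz h; apply: lb_le_inf; first by exists (enorm (x - z)), z.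
by move=> _ [y Oy <-]; exact: h.
Qed.

Lemma bdry_dist_ge0 Omega x : 0 <= bdry_dist Omega x.
Proof.
have [[z Oz]|Ono] := pselect (exists z, ~ Omega z).
  by apply: (bdry_dist_ge Oz) => y _; exact: enorm_ge0.
rewrite /bdry_dist (_ : [set _ | _ in _] = set0) ?inf0//.
by rewrite -subset0 => t [y Oy _]; apply: Ono; exists y.
Qed.

(** Hoelder continuity bounds |u(x)| by each boundary point; taking powers 1/al makes the bound
    linear in |x - y|, so that the infimum over y can be taken. *)
Lemma weighted_bounded Omega z u : ~ Omega z -> D1p0 p Omega u ->
  exists2 C, 0 < C & forall x, `|u x| <= C * bdry_dist Omega x `^ al.
Proof.
move=> Oz [[_ _ [C0 hC0]] u0].
pose C := `|C0| + 1; have C_gt0 : 0 < C by rewrite ltr_wpDl.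
exists C => // x; rewrite -ler_pdivrMl//.
have t0 : 0 <= C^-1 * `|u x| by rewrite mulr_ge0// invr_ge0 ltW.
have -> : C^-1 * `|u x| = ((C^-1 * `|u x|) `^ al^-1) `^ al.
  by rewrite -powRrM mulVf ?gt_eqF// powRr1.
apply: le_powR; [exact: ltW al0|exact: powR_ge0|].
apply: (bdry_dist_ge Oz) => y Oy.
have -> : enorm (x - y) = (enorm (x - y) `^ al) `^ al^-1.
  by rewrite -powRrM mulfV ?gt_eqF// powRr1// enorm_ge0.
apply: le_powR; [by rewrite invr_ge0 ltW|exact: t0|].
rewrite ler_pdivrMl//; have := hC0 x y; rewrite (u0 y Oy) subr0 => /le_trans; apply.
by rewrite ler_wpM2r ?powR_ge0// (le_trans (ler_norm _))// lerDl.
Qed.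

(** Needed before any use of [weighted_sup]: a real supremum takes a default value on unbounded
    sets. *)
Lemma weighted_has_ubound Omega z u : ~ Omega z -> D1p0 p Omega u ->
  has_ubound [set `|u x / bdry_dist Omega x `^ al| | x in Omega].
Proof.
move=> Oz uD; have [C C0 hC] := weighted_bounded Oz uD.
exists C => _ [x Ox <-]; rewrite normrM normfV (ger0_norm (powR_ge0 _ _)).
(* Where the weight vanishes, the quotient has the default value 0. *)
have [d0|d0] := eqVneq (bdry_dist Omega x `^ al) 0.
  by rewrite d0 invr0 mulr0 ltW.
by rewrite ler_pdivrMr ?hC// lt0r d0 powR_ge0.
Qed.

Lemma rayleigh_ge0 Omega u : 0 <= rayleigh p Omega u.
Proof. by rewrite mulr_ge0 ?powR_ge0. Qed.

Lemma competitor_D1p0 Omega x u g : competitor p Omega x u g ->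
  D1p0 p Omega u /\ u <> cst 0.
Proof.
move=> [ug u0 ux]; split; first by split; [exact: sobolev_D1p ug|exact: u0].
by move=> uE; move: ux; rewrite uE => /eqP; rewrite eq_sym oner_eq0.
Qed.

(** The weighted supremum is bounded below by its value at [x] alone, and al p = q. *)
Lemma lambda_le_competitor Omega x z u g : ~ Omega z -> Omega x ->
  0 < bdry_dist Omega x -> competitor p Omega x u g ->
  lambda_p p Omega <= bdry_dist Omega x `^ q * energy p g.
Proof.
move=> Oz Ox d0 cu; have [ug u0 ux] := cu.
have [uD un0] := competitor_D1p0 cu.
apply: (@le_trans _ _ (rayleigh p Omega u)).
  by apply: ge_inf; [exists 0 => _ [v _ <-]; exact: rayleigh_ge0|exists u].
rewrite /rayleigh (sobolev_gradient_norm p1 ug) ler_wpM2r ?energy_ge0//.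
set d := bdry_dist Omega x in d0 *.
have da : 0 < d `^ al by rewrite powR_gt0.
have Sge : (d `^ al)^-1 <= weighted_sup p Omega u.
  apply: (ub_le_sup (weighted_has_ubound Oz uD)); exists x => //.
  by rewrite ux mul1r normfV gtr0_norm.
have Sp : (d `^ al)^-1 `^ p <= weighted_sup p Omega u `^ p.
  by apply: le_powR => //; [exact: ltW|rewrite invr_ge0 ltW].
have dp : 0 < (d `^ al)^-1 `^ p by rewrite powR_gt0// invr_gt0.
rewrite powRN -alp powRrM -[leRHS]invrK lef_pV2 ?posrE//.
- by rewrite -powR_inv ?(ltW da).
- exact: lt_le_trans dp Sp.
- by rewrite invr_gt0 powR_gt0.
Qed.

Lemma competitor_scale Omega x u g : sobolev p u g -> (forall y, ~ Omega y -> u y = 0) ->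
  u x != 0 -> exists v k, competitor p Omega x v k /\
    energy p k = `|u x| `^ (- p) * energy p g.
Proof.
move=> ug u0 ux; exists (fun y => (u x)^-1 * u y), (fun y => (u x)^-1 *: g y); split.
  split; first exact: sobolevZ p1 ug.
  - by move=> y Oy; rewrite (u0 y Oy) mulr0.
  - by rewrite mulVf.
rewrite (energyZ _ ug) normfV powRN; congr (_ * _).
by rewrite -[`|u x|^-1]powR_inv1// -powRrM mulN1r powRN.
Qed.

(** The inequality being strict, a point where the weighted value is close to the supremum suffices.
    The existence of some competitor makes the infimum one over a nonempty set. *)
Lemma lambda_lt_competitor Omega z (m : R) : ~ Omega z ->
  (forall x, Omega x -> 0 < bdry_dist Omega x) ->
  (exists x u g, competitor p Omega x u g) -> lambda_p p Omega < m ->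
  exists x u g, [/\ Omega x, competitor p Omega x u g &
    bdry_dist Omega x `^ q * energy p g < m].
Proof.
move=> Oz dpos [x0 [u0 [g0 c0]]] lm.
have hi : has_inf [set rayleigh p Omega u | u in [set u | D1p0 p Omega u /\ u <> cst 0]].
  split; last by exists 0 => _ [v _ <-]; exact: rayleigh_ge0.
  by exists (rayleigh p Omega u0), u0 => //; exact: competitor_D1p0 c0.
have e0 : 0 < m - lambda_p p Omega by rewrite subr_gt0.
have [_ [u [uD un0] <-]] := inf_adherent e0 hi.
rewrite -/(lambda_p p Omega) addrC subrK => Rm.
have [[Du u0z] ] := (uD, un0); have [g ug] := D1p_sobolev np p1 Du => _.
have [x1 ux1] : exists x, u x != 0.
  apply: contrapT => h; apply: un0; apply/funext => x; apply/eqP.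
  by apply: contrapT => /negP ux; apply: h; exists x.
have Ox1 : Omega x1 by apply: contrapT => /u0z; exact/eqP.
pose W := [set `|u x / bdry_dist Omega x `^ al| | x in Omega].
have Wub : has_ubound W := weighted_has_ubound Oz uD.
have Wx x : Omega x -> `|u x / bdry_dist Omega x `^ al| = `|u x| / bdry_dist Omega x `^ al.
  by move=> Ox; rewrite normrM normfV (ger0_norm (powR_ge0 _ _)).
have S0 : 0 < weighted_sup p Omega u.
  apply: (@lt_le_trans _ _ (`|u x1 / bdry_dist Omega x1 `^ al|)).
    by rewrite Wx// divr_gt0 ?normr_gt0// powR_gt0// dpos.
  by apply: (ub_le_sup Wub); exists x1.
set S := weighted_sup p Omega u in S0 *.
have m0 : 0 < m by exact: le_lt_trans (rayleigh_ge0 Omega u) Rm.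
have J0 := energy_ge0 p g.
move: Rm; rewrite /rayleigh (sobolev_gradient_norm p1 ug) -/S powRN.
rewrite mulrC ltr_pdivrMr ?powR_gt0// -ltr_pdivrMl// => Rm.
have S1 : (m^-1 * energy p g) `^ p^-1 < S.
  rewrite -[ltRHS](powRr1 (ltW S0)) -(mulfV (lt0r_neq0 p0)) powRrM.
  by apply: gt0_ltr_powR; rewrite ?nnegrE ?invr_gt0 ?powR_ge0 ?mulr_ge0 ?invr_ge0 ?(ltW m0).
have hW : has_sup W by split; [exists (`|u x1 / bdry_dist Omega x1 `^ al|), x1|exact: Wub].
have S2 : 0 < S - (m^-1 * energy p g) `^ p^-1 by rewrite subr_gt0.
have [_ [x Ox <-]] := sup_adherent S2 hW.
rewrite -[sup W]/S subKr Wx// => hx.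
have dx := dpos x Ox; have da : 0 < bdry_dist Omega x `^ al by rewrite powR_gt0.
have ux : 0 < `|u x|.
  have := le_lt_trans (powR_ge0 _ _) hx; rewrite pmulr_lgt0// invr_gt0//.
have ux0 : u x != 0 by rewrite -normr_gt0.
have [v [k [cv Jk]]] := competitor_scale ug u0z ux0.
exists x, v, k; split => //; rewrite Jk.
have h2 : m^-1 * energy p g < (`|u x| / bdry_dist Omega x `^ al) `^ p.
  have h3 : 0 <= m^-1 * energy p g by rewrite mulr_ge0// invr_ge0 ltW.
  have {1}-> : m^-1 * energy p g = ((m^-1 * energy p g) `^ p^-1) `^ p.
    by rewrite -powRrM mulVf ?gt_eqF// powRr1.
  by apply: gt0_ltr_powR; rewrite ?nnegrE ?powR_ge0// divr_ge0// ltW.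
move: h2; rewrite powRM ?invr_ge0 ?(ltW da)//.
rewrite powR_inv ?(ltW da)// -powRrM alp.
set D := bdry_dist Omega x `^ q; have D0 : 0 < D by rewrite powR_gt0.
set U := `|u x| `^ p; have U0 : 0 < U by rewrite powR_gt0.
rewrite ltr_pdivlMr// mulrC -ltr_pdivlMl ?mulr_gt0 ?invr_gt0// => h2.
rewrite powRN -/U mulrCA ltr_pdivrMl// mulrC.
rewrite -ltr_pdivlMr// (_ : U * m / D = m * (D^-1 * U)); last by ring.
by move: h2; rewrite ltr_pdivrMl.
Qed.

End rayleigh.

(** * Reflections and comparison with the half-space *)

Section geometry.
Context {R : realType} {n : nat}.
Implicit Types (x y z a : 'rV[R]_n) (u v phi : 'rV[R]_n -> R)
  (g k : 'rV[R]_n -> 'rV[R]_n) (i : 'I_n).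
Variable p : R.
Hypothesis p2 : 2 <= p.
Hypothesis np : n%:R < p.

Let p1 : 1 <= p. Proof. by apply: le_trans p2; rewrite ler1n. Qed.

Local Notation q := (p - n%:R).
Local Notation ev i := (delta_mx (@ord0 0) i : 'rV[R]_n).
Implicit Types (Omega : set 'rV[R]_n) (M : 'M[R]_n).

Lemma dot_mx x y : x *m y^T = (dot x y)%:M.
Proof.
by rewrite [LHS]mx11_scalar mxE; congr (_%:M); apply: eq_bigr => i _; rewrite mxE.
Qed.

Lemma dot_delta x i : dot x (ev i) = x ord0 i.
Proof.
rewrite /dot (bigD1 i)//= mxE !eqxx mulr1 big1 ?addr0// => j ji.
by rewrite mxE (negbTE ji) andbF mulr0.
Qed.

Lemma enorm_delta i : enorm (ev i) = 1.
Proof. by rewrite enormE dot_delta mxE !eqxx sqrtr1. Qed.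

(* The Householder reflection exchanging [a] and [b]. *)
Lemma reflection_ex a z : enorm a = enorm z ->
  exists M, [/\ similitude 1 M, M^T = M, a *m M = z & z *m M = a].
Proof.
move=> az; have [->|nz] := eqVneq a z.
  exists 1%:M; rewrite trmx1 !mulmx1; split => //.
  by split => //; rewrite trmx1 mulmx1 expr1n.
pose v := a - z; have v0 : v != 0 by rewrite subr_eq0.
have dv : dot v v != 0.
  by rewrite -sqr_enorm expf_neq0// gt_eqF// enorm_gt0.
pose V := v^T *m v; pose c := 2 / dot v v.
have VV : V *m V = dot v v *: V.
  by rewrite /V mulmxA -[v^T *m v *m v^T]mulmxA dot_mx -mulmxA mul_scalar_mx scalemxAr.
have VT : V^T = V by rewrite trmx_mul trmxK.
pose M := 1%:M - c *: V.
have MT : M^T = M by rewrite /M linearB/= linearZ/= trmx1 VT.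
have MM : M *m M = 1%:M.
  rewrite /M mulmxBl mul1mx mulmxBr mulmx1 -scalemxAl -scalemxAr VV !scalerA.
  have -> : c * c * dot v v = c + c by rewrite -mulrA {2}/c divfK// mulr_natr mulr2n.
  by rewrite scalerDl opprB addrK subrK.
have aM : a *m M = z.
  rewrite /M mulmxBr mulmx1 -scalemxAr /V mulmxA dot_mx mul_scalar_mx scalerA.
  have -> : c * dot a v = 1.
    have h : dot a a = dot z z by rewrite -!sqr_enorm az.
    have -> : dot a v = dot v v / 2.
      by rewrite /v !(dotDr, dotDl, dotNl, dotNr) (dotC z a) -h; field.
    by rewrite /c mulrA divfK// divff// pnatr_eq0.
  by rewrite scale1r /v opprB addrCA subrr addr0.
exists M; split => //; first by split => //; rewrite MT MM expr1n.
by rewrite -aM -mulmxA MM mulmx1.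
Qed.

Lemma competitor_aff Omega Omega' x y u g a (s : R) M : similitude s M ->
  (forall z, Omega (aff a M z) -> Omega' z) -> aff a M y = x ->
  competitor p Omega x u g ->
  exists k, competitor p Omega' y (u \o aff a M) k /\ energy p k = s `^ q * energy p g.
Proof.
move=> sM OO yx [ug u0 ux]; have [sv Jv] := sobolev_similitude a p1 sM ug.
exists (fun x => g (aff a M x) *m M^T); split; last first.
  rewrite Jv; congr (_ * _); have s0 := sM.1.
  by rewrite powRB ?(gt_eqF s0) ?implybT// powR_mulrn ?ltW.
split; first exact: sv.
- by move=> z Oz /=; apply: u0 => /OO.
- by rewrite /= yx ux.
Qed.

(** Extends the vanishing of a function from an open region to a boundary point, along a segment. *)
Lemma continuous_ray u y w : continuous u ->
  (forall t : R, 0 < t < 1 -> u (y + t *: w) = 0) -> u y = 0.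
Proof.
move=> /continuous_rowP cu h; apply: contrapT => /eqP uy.
have uy0 : 0 < `|u y| by rewrite normr_gt0.
have [d [d0 hd]] := cu y _ uy0.
pose t : R := Num.min (d / (`|w| + 1)) 1 / 2.
have w1 : 0 < `|w| + 1 by rewrite ltr_wpDl.
have dw : 0 < d / (`|w| + 1) by rewrite divr_gt0.
have m0 : 0 < Num.min (d / (`|w| + 1)) 1 by rewrite lt_min dw ltr01.
have m1 : Num.min (d / (`|w| + 1)) 1 <= 1 by rewrite ge_min lexx orbT.
have m2 : Num.min (d / (`|w| + 1)) 1 <= d / (`|w| + 1) by rewrite ge_min lexx.
have t0 : 0 < t by rewrite divr_gt0.
have t1 : t < 1 by rewrite /t; move: m1; move: (Num.min _ _) => m *; lra.
have td : t < d / (`|w| + 1) by apply: lt_le_trans m2; rewrite /t ltr_pdivrMr// ltr_pMr// ltr1n.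
suff wd : `|y - (y + t *: w)| < d.
  by have := hd _ wd; rewrite h ?t0// subr0 ltxx.
rewrite opprD addrA subrr sub0r normrN mx_normZ gtr0_norm//.
by move: td; rewrite ltr_pdivlMr// mulrDr; apply: lt_trans; rewrite ltrDl mulr1.
Qed.

(** * Energy bounds from the half-space *)

Section half_space.
Variable i0 : 'I_n.
Hypothesis i0n : i0.+1 = n.
Local Notation e0 := (ev i0).

Definition half_energy : R := lambda_p p (@half_space R n).

Lemma half_spaceE z : half_space z <-> 0 < z ord0 i0.
Proof.
split=> [[i iN]|z0]; last by exists i0.
suff -> : i = i0 by [].
by apply/val_inj/succn_inj; rewrite /= iN i0n.
Qed.

Lemma half_bdry_dist z : 0 < z ord0 i0 -> bdry_dist (@half_space R n) z = z ord0 i0.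
Proof.
move=> z0; set d := z ord0 i0 in z0 *.
have Oz : ~ half_space (z - d *: e0).
  by rewrite half_spaceE !mxE !eqxx mulr1 subrr ltxx.
apply/eqP; rewrite eq_le; apply/andP; split.
  apply: (le_trans (bdry_dist_le _ Oz)).
  by rewrite subKr enormZ enorm_delta mulr1 gtr0_norm.
apply: (bdry_dist_ge Oz) => y /half_spaceE/negP; rewrite -leNgt => y0.
have := coord_le_enorm (z - y) i0; rewrite !mxE; apply: le_trans.
by rewrite (le_trans _ (ler_norm _))// lerBrDr gerDl.
Qed.

Lemma half_energy_le z u g : 0 < z ord0 i0 -> competitor p (@half_space R n) z u g ->
  half_energy <= z ord0 i0 `^ q * energy p g.
Proof.
move=> z0 cu; have Hz : half_space z by apply/half_spaceE.
have H0 : ~ @half_space R n 0 by rewrite half_spaceE mxE ltxx.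
have := lambda_le_competitor p2 np H0 Hz _ cu.
by rewrite half_bdry_dist//; apply.
Qed.

Lemma unit_direction x : exists2 e, enorm e = 1 & x = enorm x *: e.
Proof.
have [->|x0] := eqVneq x 0; first by exists e0; rewrite ?enorm_delta// enorm0 scale0r.
have := enorm_gt0 x0 => n0; exists ((enorm x)^-1 *: x).
  by rewrite enormZ gtr0_norm ?invr_gt0// mulVf// gt_eqF.
by rewrite scalerA divff ?scale1r// gt_eqF.
Qed.

(** The half-space is chosen tangent to the ball at the boundary point [e] nearest to [x], so that
    the distance from [x] to its boundary is exactly 1 - |x|; the reflection exchanging [- e0] and
    [e] brings it to standard position. *)
Lemma ball_energy_ge Omega x u g : (forall y, Omega y -> enorm y < 1) -> enorm x < 1 ->
  competitor p Omega x u g -> half_energy <= (1 - enorm x) `^ q * energy p g.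
Proof.
move=> O1 x1 cu; have [e e1 xe] := unit_direction x.
have ee : enorm (- e0) = enorm e by rewrite enormN enorm_delta e1.
have [M [sM MT e0M eM]] := reflection_ex ee.
have MM : M *m M = 1%:M by have := sM.2; rewrite MT expr1n.
have dM y z : dot (y *m M) (z *m M) = dot y z by rewrite (dot_mulmx _ _ sM.2) expr1n mul1r.
have dMe z : dot (z *m M) e = - z ord0 i0.
  by rewrite -e0M dM dotNr dot_delta.
have dee : dot e e = 1 by rewrite -sqr_enorm e1 expr1n.
pose y := (x - e) *m M.
have yx : aff e M y = x by rewrite /aff /y -mulmxA MM mulmx1 addrC subrK.
have yi : y ord0 i0 = 1 - enorm x.
  have := dMe y; rewrite /y -mulmxA MM mulmx1 dotDl dotNl dee.
  have -> : dot x e = enorm x by rewrite {1}xe dotZl dee mulr1.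
  by move=> h; rewrite -[LHS]opprK -h opprB.
have OO z : Omega (aff e M z) -> half_space z.
  move=> /O1 z1; apply/half_spaceE.
  have := dot_le (aff e M z) e; rewrite e1 mulr1 /aff dotDl dee dMe => h.
  by have := le_lt_trans h z1; rewrite gtrDl oppr_lt0.
have [k [ck Jk]] := competitor_aff sM OO yx cu.
have := half_energy_le _ ck; rewrite yi subr_gt0 => /(_ x1).
by rewrite Jk powR1 mul1r.
Qed.

Lemma near_ball_energy (m : R) : m < half_energy ->
  exists N : nat, forall (r : R) x u g, 0 < r -> r < enorm x ->
    competitor p [set y | r < enorm y] x u g -> (enorm x - r) * N.+1%:R <= r ->
    m < (enorm x - r) `^ q * energy p g.
Proof.
move=> mk; apply: contrapT => /forallNP H.
pose Om (k : nat) : set 'rV[R]_n := [set y | k.+1%:R < enorm (y + k.+1%:R *: e0)].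
have Odec (k l : nat) : (k <= l)%N -> Om l `<=` Om k.
  move=> kl y; rewrite /Om/= => yl; rewrite ltNge; apply/negP => yk.
  move: yl; apply/negP; rewrite -leNgt.
  have -> : y + l.+1%:R *: e0 = (y + k.+1%:R *: e0) + (l.+1%:R - k.+1%:R) *: e0.
    by rewrite -addrA -scalerDl (addrC k.+1%:R) subrK.
  rewrite (le_trans (enormD _ _))// enormZ enorm_delta mulr1 ger0_norm; last first.
    by rewrite subr_ge0 ler_nat ltnS.
  by rewrite -lerBrDr subKr.
have adm (k : nat) : admissible p (Om k) e0 m.
  have /existsNP[r /existsNP[x /existsNP[u /existsNP[g h]]]] := H k.
  move: h => /not_implyP[r0 /not_implyP[rx /not_implyP[cu /not_implyP[kr /negP]]]].
  rewrite -leNgt => Jm.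
  have [e e1 xe] := unit_direction x.
  have ee : enorm e0 = enorm e by rewrite enorm_delta e1.
  have [M [sM MT e0M _]] := reflection_ex ee.
  pose s := enorm x - r; have s0 : 0 < s by rewrite subr_gt0.
  have sS := similitudeZ s0 sM; rewrite mulr1 in sS.
  have yx : aff (r *: e) (s *: M) e0 = x.
    by rewrite /aff -scalemxAr e0M -scalerDl /s addrC subrK -xe.
  (* In units of s the radius r is at least k + 1, so the rescaled ball contains the tangent ball of
     radius k + 1. *)
  have OO z : [set y | r < enorm y] (aff (r *: e) (s *: M) z) -> Om k z.
    rewrite /Om/= => rz; rewrite ltNge; apply/negP => zk; move: rz; apply/negP; rewrite -leNgt.
    have -> : aff (r *: e) (s *: M) z = (r - s * k.+1%:R) *: e + s *: ((z + k.+1%:R *: e0) *m M).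
      rewrite /aff mulmxDl -scalemxAl e0M -scalemxAr scalerDr scalerA.
      by rewrite [RHS]addrCA -scalerDl subrK addrC.
    rewrite (le_trans (enormD _ _))// !enormZ e1 mulr1 (enorm_mulmx _ ler01 sM.2) mul1r.
    rewrite ger0_norm ?subr_ge0// gtr0_norm// -lerBrDl subKr.
    by rewrite ler_pM2l.
  have [k' [ck Jk]] := competitor_aff sS OO yx cu.
  by exists (u \o aff (r *: e) (s *: M)), k'; split => //; rewrite Jk.
have O0 : ~ Om 0%N 0 by rewrite /Om/= add0r scale1r enorm_delta ltxx.
have [u [g [cu Jm]]] := admissible_bigcap p2 np Odec O0 adm (cvg_cst m).
have [ug u0 ue] := cu; have [uc _ _ _] := ug.
have neg z : z ord0 i0 < 0 -> u z = 0.
  move=> z0; apply: u0 => zO.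
  pose d := dot z z; have d0 : 0 <= d := dot_ge0 z.
  pose k := Num.bound (d / - z ord0 i0).
  have kd : d / - z ord0 i0 < k%:R.
    by apply: archi_boundP; rewrite divr_ge0// oppr_ge0 ltW.
  have := zO k I; rewrite /Om/= ltNge => /negP; apply.
  rewrite enorm_le ?ler0n// !(dotDl, dotDr, dotZl, dotZr) (dotC e0 z) !dot_delta.
  rewrite mxE !eqxx mulr1 -/d.
  move: kd; rewrite ltr_pdivrMr ?oppr_gt0// => kd.
  have k1 : k%:R <= k.+1%:R :> R by rewrite ler_nat.
  have k0 : 0 <= k.+1%:R :> R by [].
  move: z0 kd k1 k0 d0; move: (k.+1%:R : R) (k%:R : R) (z ord0 i0) => K K' t *.
  nra.
(* The intersection of the exteriors still contains points of the hyperplane; there [u] vanishes by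
   continuity from the negative side. *)
have ch : competitor p (@half_space R n) e0 u g.
  split => // z /half_spaceE/negP; rewrite -leNgt le_eqVlt => /predU1P[z0|]; last exact: neg.
  apply: (@continuous_ray u z (- e0) uc) => t /andP[t0 t1]; apply: neg.
  by rewrite !mxE !eqxx z0 mulrN mulr1 add0r oppr_lt0.
have := half_energy_le _ ch; rewrite mxE !eqxx powR1 mul1r => /(_ ltr01) h.
by move: mk; rewrite ltNge (le_trans h Jm).
Qed.

End half_space.

End geometry.

(** * Competitors on annuli and closedness of [inner_bound] *)

Section annuli.
Context {R : realType} {n : nat}.
Implicit Types (x y z a : 'rV[R]_n) (u v phi : 'rV[R]_n -> R)
  (g k : 'rV[R]_n -> 'rV[R]_n) (i : 'I_n).
Variable p : R.
Hypothesis p2 : 2 <= p.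
Hypothesis np : n%:R < p.

Let p1 : 1 <= p. Proof. by apply: le_trans p2; rewrite ler1n. Qed.
Let p0 : 0 < p. Proof. exact: lt_le_trans ltr01 p1. Qed.

Local Notation al := (1 - n%:R / p).
Local Notation q := (p - n%:R).
Local Notation ev i := (delta_mx (@ord0 0) i : 'rV[R]_n).
Implicit Types (Omega : set 'rV[R]_n) (M : 'M[R]_n).

Let al0 : 0 < al.
Proof. by rewrite subr_gt0 ltr_pdivrMr// mul1r. Qed.

Let q0 : 0 < q. Proof. by rewrite subr_gt0. Qed.

Variable i0 : 'I_n.
Hypothesis i0n : i0.+1 = n.
Local Notation e0 := (ev i0).
Local Notation kappa := (half_energy (R := R) (n := n) p).

Definition inner_bound (m d : R) := exists x u g,
  competitor p (annulus d 1) x u g /\ (enorm x - d) `^ q * energy p g <= m.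

Lemma competitor_mem Omega x u g : competitor p Omega x u g -> Omega x.
Proof.
move=> [_ u0 ux]; apply: contrapT => /u0; rewrite ux => /eqP.
by rewrite oner_eq0.
Qed.

Lemma annulus_sub (d d' r r' : R) : d' <= d -> r <= r' ->
  @annulus R n d r `<=` annulus d' r'.
Proof.
move=> dd rr y /andP[h1 h2]; apply/andP.
by split; [exact: le_lt_trans h1|exact: lt_le_trans rr].
Qed.

Lemma annulus0 (d r : R) : 0 <= d -> ~ @annulus R n d r 0.
Proof. by move=> d0 /andP[]; rewrite enorm0 ltNge d0. Qed.

(** Allows all points to be placed on the ray through [e0], so that only radii have to converge. *)
Lemma competitor_rotate (d r : R) x y u g : enorm x = enorm y ->
  competitor p (annulus d r) x u g ->
  exists v k, competitor p (annulus d r) y v k /\ energy p k = energy p g.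
Proof.
move=> xy cu; have [M [sM MT yM _]] := reflection_ex (esym xy).
have OO z : annulus d r (aff 0 M z) -> annulus d r z.
  by rewrite /annulus/= /aff add0r (enorm_mulmx _ ler01 sM.2) mul1r.
have yx : aff 0 M y = x by rewrite /aff add0r.
have [k [ck Jk]] := competitor_aff p2 sM OO yx cu.
by exists (u \o aff 0 M), k; rewrite Jk powR1 mul1r.
Qed.

Let cvg_sub (a : nat -> R) (l : R) (f : nat -> nat) : a @ \oo --> l ->
  (forall k : nat, (k <= f k)%N) -> (fun k : nat => a (f k)) @ \oo --> l.
Proof.
move=> /cvgrPdist_lt al fk; apply/cvgrPdist_lt => e /al [N _ hN].
by exists N => // k Nk; apply: hN; exact: leq_trans Nk (fk k).
Qed.

Let bounded_cluster (r_ : nat -> R) : (forall k : nat, 0 <= r_ k <= 1) ->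
  exists r, forall (e : R) (N : nat), 0 < e -> exists2 k : nat, (N <= k)%N & `|r_ k - r| < e.
Proof.
move=> r01; have [|r [_ clr]] := @segment_compact R 0 1 (r_ @ \oo) _.
  by exists 0%N => // k _; rewrite /= in_itv/=.
exists r => e N e0.
have [|_ [[k Nk <-] rk]] := clr (r_ @` [set k | (N <= k)%N]) (ball r e) _ (nbhsx_ballx r e e0).
  by exists N => // k Nk; exists k.
by exists k => //; move: rk; rewrite -ball_normE /= distrC.
Qed.

Let ge_half_of_dist (s : R) : `|s - 1| <= 2^-1 -> 2^-1 <= s.
Proof. by move=> /ler_normlP[h1 h2]; lra. Qed.

(** The radii of the points stay a fixed distance [eta] from both spheres, so they cluster at some
    [r] inside and the energies are bounded. Morrey's inequality moves the normalization from radius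
    [r_ k] to [r] at the price of a factor tending to 1, and [admissible_bigcap] applies to the
    decreasing annuli at the fixed point [r *: e0]. *)
Lemma inner_bound_closed (d_ m_ : nat -> R) (d m : R) :
  (forall k l : nat, (k <= l)%N -> d_ k <= d_ l) -> 0 < d_ 0%N ->
  d_ @ \oo --> d -> m_ @ \oo --> m -> m < kappa ->
  (forall k : nat, inner_bound (m_ k) (d_ k)) -> d < 1 /\ inner_bound m d.
Proof.
move=> dnd d00 dd mm mk P.
have dpos (k : nat) : 0 < d_ k by apply: lt_le_trans d00 (dnd _ _ (leq0n k)).
pose K' := (m + kappa) / 2.
have mK : m < K' by rewrite /K' ltr_pdivlMr// mulr_natr mulr2n ltrD2l.
have Kk : K' < kappa by rewrite /K' ltr_pdivrMr// mulr_natr mulr2n ltrD2r.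
have [N0 _ hN0] := cvgr_lt _ mm _ mK.
have rot (k : nat) : exists t : R * ('rV[R]_n -> R) * ('rV[R]_n -> 'rV[R]_n),
    [/\ competitor p (annulus (d_ k) 1) (t.1.1 *: e0) t.1.2 t.2, d_ k < t.1.1 < 1 &
     (t.1.1 - d_ k) `^ q * energy p t.2 <= m_ k].
  have [x [u [g [cu Jm]]]] := P k.
  have x1 : d_ k < enorm x < 1 := competitor_mem cu.
  have xe : enorm x = enorm (enorm x *: e0).
    by rewrite enormZ enorm_delta mulr1 ger0_norm// enorm_ge0.
  have [v [g' [cv Jv]]] := competitor_rotate xe cu.
  exists (enorm x, v, g'); split; [exact: cv|exact: x1|].
  exact: (eq_ind _ (fun J : R => (enorm x - d_ k) `^ q * J <= m_ k) Jm _ (esym Jv)).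
have [t_ tP] := choice rot.
pose r_ (k : nat) := (t_ k).1.1; pose u_ (k : nat) := (t_ k).1.2; pose g_ (k : nat) := (t_ k).2.
have cu (k : nat) : competitor p (annulus (d_ k) 1) (r_ k *: e0) (u_ k) (g_ k) by case: (tP k).
have dr (k : nat) : d_ k < r_ k by case: (tP k) => _ /andP[].
have r1 (k : nat) : r_ k < 1 by case: (tP k) => _ /andP[].
have Jm (k : nat) : (r_ k - d_ k) `^ q * energy p (g_ k) <= m_ k by case: (tP k).
have r0 (k : nat) : 0 < r_ k by exact: lt_trans (dpos k) (dr k).
have re (k : nat) : enorm (r_ k *: e0) = r_ k.
  by rewrite enormZ enorm_delta mulr1 gtr0_norm.
have [N hN] := near_ball_energy p2 np i0n Kk.
(* Closer than [eta] to the inner sphere, whose radius is at least d_0, [near_ball_energy] would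
   contradict the bound by [K']. *)
pose eta := d_ 0%N / N.+1%:R; have eta0 : 0 < eta by rewrite divr_gt0.
have low (k : nat) : (N0 <= k)%N -> eta <= r_ k - d_ k.
  move=> Nk; rewrite leNgt; apply/negP => lt_eta.
  have cb : competitor p [set y | d_ k < enorm y] (r_ k *: e0) (u_ k) (g_ k).
    by apply: competitor_sub (cu k) => y /andP[].
  have drk : d_ k < enorm (r_ k *: e0) by rewrite re.
  have small : (enorm (r_ k *: e0) - d_ k) * N.+1%:R <= d_ k.
    rewrite re; apply: (@le_trans _ _ (d_ 0%N)); last exact: dnd.
    by move: (ltW lt_eta); rewrite /eta ler_pdivlMr.
  have := hN _ _ _ _ (dpos k) drk cb small; rewrite re ltNge => /negP; apply.
  exact: le_trans (Jm k) (ltW (hN0 k Nk)).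
(* Otherwise 1 - r_k < eta <= r_k - d_k, and [ball_energy_ge] would force the product up to
   [half_energy]. *)
have upp (k : nat) : (N0 <= k)%N -> eta <= 1 - r_ k.
  move=> Nk; rewrite leNgt; apply/negP => lt_eta.
  have rk1 : enorm (r_ k *: e0) < 1 by rewrite re.
  have inb y : annulus (d_ k) 1 y -> enorm y < 1 by case/andP.
  have := ball_energy_ge p2 np i0n inb rk1 (cu k); rewrite re leNgt => /negP; apply.
  apply: le_lt_trans Kk; apply: le_trans (ltW (hN0 k Nk)); apply: le_trans (Jm k).
  rewrite ler_wpM2r ?energy_ge0// le_powR ?(ltW q0)// ?subr_ge0 ?(ltW (r1 k))//.
  exact: le_trans (ltW lt_eta) (low k Nk).
have d1 : d < 1.
  have : d <= 1 - eta - eta.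
    apply: (cvgr_to_le dd); exists N0 => // k Nk /=.
    by have := low k Nk; have := upp k Nk; lra.
  by move: eta0; lra.
split; first exact: d1.
have r01 (k : nat) : 0 <= r_ k <= 1 by rewrite !ltW.
have [r rcl] := bounded_cluster r01.
have [Km Km0 mor] := morrey p1 np.
pose B := `|K'| / eta `^ q + 1; have B0 : 0 < B by rewrite ltr_wpDl// divr_ge0// powR_ge0.
pose c := B `^ p^-1; have c0 : 0 < c by rewrite powR_gt0.
have cp : c `^ p = B by rewrite -powRrM mulVf ?gt_eqF// powRr1 ?(ltW B0).
have etaq : 0 < eta `^ q by rewrite powR_gt0.
have JB (k : nat) : (N0 <= k)%N -> energy p (g_ k) <= B.
  move=> Nk; apply: (@le_trans _ _ (`|K'| / eta `^ q)); last by rewrite lerDl.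
  rewrite ler_pdivlMr// mulrC (le_trans _ (ler_norm K'))//.
  apply: le_trans (ltW (hN0 k Nk)); apply: le_trans (Jm k).
  by rewrite ler_wpM2r ?energy_ge0// le_powR ?(ltW q0) ?(ltW eta0)// low.
have hol (k : nat) : (N0 <= k)%N -> `|u_ k (r *: e0) - 1| <= Km * (`|r_ k - r| `^ al * c).
  move=> Nk; have [su _ ux] := cu k; rewrite -{1}ux.
  have Jc : energy p (g_ k) <= c `^ p by rewrite cp; exact: JB.
  have := mor _ _ (r *: e0) (r_ k *: e0) _ su c0 Jc.
  by rewrite -scalerBl enormZ enorm_delta mulr1 distrC [`|r - _|]distrC distrC.
(* Within distance [t] of [r], Morrey's bound keeps the value at [r *: e0] at least 1/2, so it can
   be divided by for every k and not only for large ones. *)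
pose t := (2 * (Km * c + 1))^-1 `^ al^-1.
have kc : 0 < Km * c + 1 by rewrite ltr_wpDl// mulr_ge0// ltW.
have t0 : 0 < t by rewrite powR_gt0// invr_gt0 mulr_gt0.
have ta : t `^ al = (2 * (Km * c + 1))^-1.
  by rewrite -powRrM mulVf ?gt_eqF// powRr1// invr_ge0 mulr_ge0// ltW.
pose ep (k : nat) : R := k.+1%:R^-1.
have ep0 (k : nat) : 0 < ep k by rewrite invr_gt0 ltr0n.
have epc : ep @ \oo --> (0 : R) by exact: cvg_harmonic.
have pick (k : nat) : exists f : nat, [/\ (k <= f)%N, (N0 <= f)%N,
    `|r_ f - r| < ep k & `|r_ f - r| < t].
  have m0 : 0 < Num.min (ep k) t by rewrite lt_min ep0 t0.
  have [f] := rcl _ (maxn k N0) m0; rewrite geq_max lt_min => /andP[h1 h2] /andP[h3 h4].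
  by exists f.
have [f fP] := choice pick.
have fk (k : nat) : (k <= f k)%N by case: (fP k).
have fN (k : nat) : (N0 <= f k)%N by case: (fP k).
pose a (k : nat) := u_ (f k) (r *: e0).
have a1 : a @ \oo --> (1 : R).
  have sq : (fun k : nat => Km * (ep k `^ al * c)) @ \oo --> (0 : R).
    rewrite -(mulr0 Km); apply: cvgMl_tmp; rewrite -(mul0r c); apply: cvgMr_tmp.
    rewrite -(powR0 (lt0r_neq0 al0)); apply: cvg_powR => // k; exact: ltW.
  apply/cvgrPdist_le => e e_gt0; apply: filterS (cvgr_lt _ sq _ e_gt0) => k ke.
  rewrite distrC; apply: (le_trans (hol _ (fN k))); apply: le_trans (ltW ke).
  rewrite ler_wpM2l// ler_wpM2r ?(ltW c0)// le_powR ?(ltW al0)//.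
  by case: (fP k) => _ _ /ltW.
have ahalf (k : nat) : 2^-1 <= a k.
  have h : `|a k - 1| <= 2^-1.
    apply: (le_trans (hol _ (fN k))).
    apply: (@le_trans _ _ (Km * (t `^ al * c))).
      rewrite ler_wpM2l// ler_wpM2r ?(ltW c0)// le_powR ?(ltW al0)//.
      by case: (fP k) => _ _ _ /ltW.
    rewrite ta (_ : Km * _ = 2^-1 * ((Km * c) / (Km * c + 1))); last by field; rewrite gt_eqF.
    by rewrite ler_piMr// ler_pdivrMr// mul1r lerDl.
  exact: ge_half_of_dist h.
have a0 (k : nat) : 0 < a k by apply: lt_le_trans (ahalf k).
have rr : (fun k : nat => r_ (f k)) @ \oo --> r.
  apply/cvgrPdist_le => e e_gt0; apply: filterS (cvgr_lt _ epc _ e_gt0) => k ke.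
  by rewrite distrC; case: (fP k) => _ _ h _; rewrite (ltW (lt_trans h ke)).
have ddf := cvg_sub dd fk; have mmf := cvg_sub mm fk.
have drf : (fun k : nat => r_ (f k) - d_ (f k)) @ \oo --> r - d by exact: cvgB.
have rd : eta <= r - d by apply: (cvgr_to_ge drf); near=> k; apply: low.
have r1' : r < 1.
  have : r <= 1 - eta.
    by apply: (cvgr_to_le rr); near=> k; rewrite lerBrDr -lerBrDl; exact: upp.
  by move=> /le_lt_trans; apply; rewrite gtrBl.
pose M_ (k : nat) := (a k `^ p)^-1 * (m_ (f k) * ((r_ (f k) - d_ (f k)) `^ q)^-1).
pose M := m * ((r - d) `^ q)^-1.
have rdq : 0 < (r - d) `^ q by rewrite powR_gt0// (lt_le_trans eta0).
have MM : M_ @ \oo --> M.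
  rewrite -[M]mul1r; apply: cvgM.
    have -> : 1 = (1 `^ p)^-1 :> R by rewrite powR1 invr1.
    apply: cvgV; first by rewrite powR1 oner_neq0.
    by apply: cvg_powR => // k; exact: ltW.
  apply: cvgM; first exact: mmf.
  apply: cvgV; first by rewrite gt_eqF.
  by apply: cvg_powR => // k; rewrite subr_ge0 ltW.
have adm (k : nat) : admissible p (annulus (d_ k) 1) (r *: e0) (M_ k).
  have [su u0 _] := cu (f k).
  have [v [g [cv Jv]]] := competitor_scale p2 su u0 (lt0r_neq0 (a0 k)).
  exists v, g; split.
    by apply: competitor_sub cv; apply: annulus_sub => //; exact: dnd.
  rewrite Jv -/(a k) (gtr0_norm (a0 k)) powRN /M_ ler_wpM2l ?invr_ge0 ?powR_ge0//.
  have rdk : 0 < (r_ (f k) - d_ (f k)) `^ q by rewrite powR_gt0// subr_gt0.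
  by rewrite ler_pdivlMr// mulrC.
have Odec (k l : nat) : (k <= l)%N -> @annulus R n (d_ l) 1 `<=` annulus (d_ k) 1.
  by move=> kl; apply: annulus_sub => //; exact: dnd.
have [u [g [[su u0 ux] Jg]]] := admissible_bigcap p2 np Odec (annulus0 (ltW d00)) adm MM.
have [uc _ _ _] := su.
have dlim (k : nat) : d_ k <= d.
  by apply: (cvgr_to_ge dd); exists k => // l; exact: dnd.
have d0 : 0 < d by exact: lt_le_trans d00 (dlim _).
(* The intersection of the annuli may contain the sphere of radius d; vanishing there follows by
   continuity from inside. *)
have inside y : enorm y < d -> u y = 0.
  move=> yd; apply: u0 => yO.
  have [j _ /(_ j (leqnn j)) hj] := cvgr_gt _ dd _ yd.
  by have /andP[] := yO j I; rewrite ltNge (ltW hj).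
have r0' : 0 < r by apply: lt_trans d0 _; rewrite -subr_gt0 (lt_le_trans eta0).
exists (r *: e0), u, g; split.
  split => // y yA; have [yd|yd] := leP (enorm y) d; last first.
    apply: u0 => yO; apply: yA; apply/andP; split => //.
    by have /andP[] := yO 0%N I.
  apply: (@continuous_ray R n u y (- y) uc) => s /andP[s0 s1]; apply: inside.
  rewrite scalerN -{1}(scale1r y) -scalerBl enormZ gtr0_norm ?subr_gt0//.
  have [y0|y0] := eqVneq (enorm y) 0; first by rewrite y0 mulr0.
  have y_gt0 : 0 < enorm y by rewrite lt0r y0 enorm_ge0.
  by apply: lt_le_trans yd; rewrite gtr_pMl// gtrBl.
rewrite enormZ enorm_delta mulr1 gtr0_norm//.
by rewrite mulrC -ler_pdivlMr.
Unshelve. all: by end_near. Qed.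

End annuli.

(** * The strong maximum principle *)

Section strictness.
Context {R : realType} {n : nat}.
Implicit Types (x y z a : 'rV[R]_n) (u v phi : 'rV[R]_n -> R)
  (g k : 'rV[R]_n -> 'rV[R]_n) (i : 'I_n).
Variable p : R.
Hypothesis p2 : 2 <= p.
Hypothesis np : n%:R < p.

Let p1 : 1 <= p. Proof. by apply: le_trans p2; rewrite ler1n. Qed.
Let p0 : 0 < p. Proof. exact: lt_le_trans ltr01 p1. Qed.

Local Notation q := (p - n%:R).
Local Notation ev i := (delta_mx (@ord0 0) i : 'rV[R]_n).
Implicit Types (Omega : set 'rV[R]_n) (M : 'M[R]_n).

Variable i0 : 'I_n.
Local Notation e0 := (ev i0).

Lemma sobolev_subc u g (c : R) : sobolev p u g -> sobolev p (fun x => u x - c) g.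
Proof.
move=> ug; have := sobolevB p1 ug (sobolev_cst c p1).
by have -> : (fun x => g x - 0) = g by apply/funext => x; rewrite subr0.
Qed.

Lemma energy0 : energy p (fun=> 0 : 'rV[R]_n) = 0.
Proof.
rewrite /energy (_ : (fun _ => _) = fun=> 0); first by rewrite Rintegral_cst// mul0r.
by apply/funext => x; rewrite enorm0 powR0// gt_eqF.
Qed.

Let q0 : 0 < q. Proof. by rewrite subr_gt0. Qed.

Let sum_le_left (a b c d : R) : a + b <= c + d -> d = 0 -> 0 <= b -> a <= c.
Proof. by move=> *; lra. Qed.

Let sum_le_right (a b c d : R) : a + b <= c + d -> d = 0 -> 0 <= a -> b <= c.
Proof. by move=> *; lra. Qed.

(** Since constants have zero energy, [sobolev_max_min] against a constant bounds the energy of the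
    truncation alone. *)
Lemma sobolev_truncate u g (c : R) : sobolev p u g ->
  exists2 k, sobolev p (fun x => Num.max (u x - c) 0) k & energy p k <= energy p g.
Proof.
move=> ug; have [G [H [sG _ JGH]]] := sobolev_max_min p1 p2 (sobolev_subc c ug) (sobolev_cst 0 p1).
exists G; [exact: sG|exact: (sum_le_left JGH energy0 (energy_ge0 p H))].
Qed.

Lemma sobolev_min_cst u g (c : R) : sobolev p u g ->
  exists2 k, sobolev p (fun x => Num.min (u x) c) k & energy p k <= energy p g.
Proof.
move=> ug; have [G [H [_ sH JGH]]] := sobolev_max_min p1 p2 ug (sobolev_cst c p1).
exists H; [exact: sH|exact: (sum_le_right JGH energy0 (energy_ge0 p G))].
Qed.

Definition minimizer Omega x u g := competitor p Omega x u g /\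
  forall v k, competitor p Omega x v k -> energy p g <= energy p k.

Lemma minimizer_ex Omega x z u0 g0 : ~ Omega z -> competitor p Omega x u0 g0 ->
  exists u g, minimizer Omega x u g.
Proof.
move=> Oz c0.
pose E : set R := [set J | exists u g, competitor p Omega x u g /\ J = energy p g].
have hE : has_inf E.
  split; last by exists 0 => _ [u [g [_ ->]]]; exact: energy_ge0.
  by exists (energy p g0), u0, g0.
have [|u [g [cu Jg]]] := @admissible_min R n p p2 np Omega x z (inf E) Oz.
  move=> e e_gt0; have [_ [u [g [cu ->]]] Jlt] := inf_adherent e_gt0 hE.
  by exists u, g; split => //; exact: ltW.
exists u, g; split; first exact: cu.
move=> v k cv; apply: (le_trans Jg).
by apply: ge_inf; [exact: hE.2|exists v, k].
Qed.

Lemma minimizer_eq Omega x z u g v k : ~ Omega z -> minimizer Omega x u g ->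
  competitor p Omega x v k -> energy p k <= energy p g -> v = u.
Proof.
move=> Oz [cu mu_] cv Jk.
exact: (competitor_unique p2 np Oz cv cu mu_ Jk (lexx _)).
Qed.

(** Truncating at 0 or at 1 gives a competitor of no larger energy, hence [u] itself by
    uniqueness. *)
Lemma minimizer_bounds Omega x z u g : ~ Omega z -> minimizer Omega x u g ->
  forall y, 0 <= u y <= 1.
Proof.
move=> Oz mu_ y; have [[ug u0 ux] _] := mu_.
have [k1 s1 J1] := sobolev_truncate 0 ug; have [k2 s2 J2] := sobolev_min_cst 1 ug.
have c1 : competitor p Omega x (fun x => Num.max (u x - 0) 0) k1.
  split; [exact: s1|by move=> z' /u0 ->; rewrite subr0 maxxx|].
  by rewrite ux subr0; apply/max_idPl; exact: ler01.
have c2 : competitor p Omega x (fun x => Num.min (u x) 1) k2.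
  split; [exact: s2| |by rewrite ux minxx].
  by move=> z' /u0 ->; apply/min_idPl; exact: ler01.
apply/andP; split.
  by rewrite -(minimizer_eq Oz mu_ c1 J1) le_max lexx orbT.
by rewrite -(minimizer_eq Oz mu_ c2 J2) ge_min lexx orbT.
Qed.

Local Notation ball1 := [set y : 'rV[R]_n | enorm y < 1].

Let ball1_e0 : ~ ball1 e0.
Proof. by rewrite /= enorm_delta ltxx. Qed.

Lemma ball_minimizer_ex : exists w h, minimizer ball1 0 w h.
Proof.
have [u [g [ug u0 _ u1]]] := @sobolev_bump R n p p1.
apply: (@minimizer_ex ball1 0 e0 u g ball1_e0); split => // y /negP.
by rewrite -leNgt; exact: u1.
Qed.

(* If [w] vanished outside the ball of radius 1/2, dilating it would lower its
   energy; [w] is radial by uniqueness. *)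
Lemma ball_minimizer_gt0 w h : minimizer ball1 0 w h ->
  exists2 rho : R, 2^-1 <= rho & forall y, enorm y = rho -> 0 < w y.
Proof.
move=> mw; have [cw wmin] := mw; have [sw w0 wx] := cw.
have wb := minimizer_bounds ball1_e0 mw.
have [y1 [y1h wy1]] : exists y, 2^-1 <= enorm y /\ w y != 0.
  apply: contrapT => H.
  have half y : 2^-1 <= enorm y -> w y = 0.
    by move=> yh; apply/eqP; apply: contrapT => /negP wy; apply: H; exists y.
  have h2 : 0 < (2^-1 : R) by rewrite invr_gt0.
  have T0 : aff 0 (2^-1)%:M 0 = 0 :> 'rV[R]_n by rewrite /aff mul0mx addr0.
  have cw' : competitor p [set y | enorm y < 2^-1] 0 w h.
    by split => // y /negP; rewrite -leNgt; exact: half.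
  have OO z : [set y : 'rV[R]_n | enorm y < 2^-1] (aff 0 (2^-1)%:M z) -> ball1 z.
    rewrite /= /aff add0r mul_mx_scalar enormZ gtr0_norm// => hz.
    by rewrite -(ltr_pM2l h2) mulr1.
  have [k [ck Jk]] := competitor_aff p2 (similitude_scalar h2) OO T0 cw'.
  have := wmin _ _ ck; rewrite Jk => Jle.
  have hq : (2^-1 : R) `^ q < 1.
    have : (2^-1 : R) `^ q < 1 `^ q.
      by apply: gt0_ltr_powR; rewrite ?nnegrE ?invf_lt1// ?ltr1n.
    by rewrite powR1.
  have J0 : energy p h = 0.
    apply/eqP; rewrite eq_le energy_ge0 andbT leNgt; apply/negP => Jpos.
    by move: Jle; rewrite leNgt gtr_pMl// hq.
  have := energy_eq0_cst p1 np 0 e0 sw J0; rewrite wx (w0 e0 ball1_e0) => /eqP.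
  by rewrite oner_eq0.
have wpos : 0 < w y1 by rewrite lt0r wy1; have /andP[] := wb y1.
exists (enorm y1) => // y yE.
have [M [sM MT yM _]] := reflection_ex yE.
have OO z : ball1 (aff 0 M z) -> ball1 z.
  by rewrite /= /aff add0r (enorm_mulmx _ ler01 sM.2) mul1r.
have T0 : aff 0 M 0 = 0 by rewrite /aff mul0mx addr0.
have [k [ck Jk]] := competitor_aff p2 sM OO T0 cw.
have Jle : energy p k <= energy p h by rewrite Jk powR1 mul1r.
by rewrite -(minimizer_eq ball1_e0 mw ck Jle) /= /aff add0r yM.
Qed.

Let sum_le_cancel (a b c d : R) : a + b <= c + d -> c <= a -> b <= d.
Proof. by move=> *; lra. Qed.

(* Strong maximum principle: compare the energies of [max u W] and [min u W]
   with those of [u] and of the rescaled ball minimizer [W]. *)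
Lemma minimizer_comparison Omega x z u g w h y0 (L : R) : ~ Omega z ->
  minimizer Omega x u g -> minimizer ball1 0 w h -> 0 < L ->
  [set y | enorm (y - y0) < L] `<=` Omega -> 0 < u y0 ->
  forall y, u y0 * w (L^-1 *: (y - y0)) <= u y.
Proof.
move=> Oz mu_ mw L0 BO c0 y; have [cu umin] := mu_; have [su u0 ux] := cu.
have ub := minimizer_bounds Oz mu_; have wb := minimizer_bounds ball1_e0 mw.
have [cw wmin] := mw.
set c := u y0 in c0 *.
pose B : set 'rV[R]_n := [set y | enorm (y - y0) < L].
have L'0 : 0 < L^-1 by rewrite invr_gt0.
pose T := aff (- (L^-1 *: y0)) (L^-1)%:M.
have TE (v : 'rV[R]_n) : T v = L^-1 *: (v - y0) by rewrite /T /aff mul_mx_scalar addrC scalerBr.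
have T0 : T y0 = 0 by rewrite TE subrr scaler0.
have OO (v : 'rV[R]_n) : ball1 (T v) -> B v.
  rewrite TE /B /= enormZ gtr0_norm// => hv.
  by rewrite -(ltr_pM2l L'0) mulVf// gt_eqF.
have [kn [cn Jn]] := competitor_aff p2 (similitude_scalar L'0) OO T0 cw.
set Wn := w \o T in cn.
have LL : L `^ q * L^-1 `^ q = 1 by rewrite -powRM ?ltW// divff ?gt_eqF// powR1.
have Wmin : minimizer B y0 Wn kn.
  split; first exact: cn.
  move=> v k cv.
  have T'0 : aff y0 L%:M 0 = y0 by rewrite /aff mul0mx addr0.
  have OO' (v' : 'rV[R]_n) : B (aff y0 L%:M v') -> ball1 v'.
    rewrite /B /= /aff mul_mx_scalar (addrC y0) addrK enormZ gtr0_norm// => hv.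
    by rewrite -(ltr_pM2l L0) mulr1.
  have [k' [ck' Jk']] := competitor_aff p2 (similitude_scalar L0) OO' T'0 cv.
  have := wmin _ _ ck'; rewrite Jk' Jn => hle.
  have := ler_wpM2l (powR_ge0 L^-1 q) hle; rewrite mulrA [_ * L `^ q]mulrC LL mul1r.
  exact.
have Bz : ~ B (y0 + L *: e0).
  by rewrite /B /= addrC addKr enormZ enorm_delta mulr1 gtr0_norm// ltxx.
have [sn n0 n1] := cn.
have sW := sobolevZ c p1 sn.
have [G [H [sG sH JGH]]] := sobolev_max_min p1 p2 su sW.
(* The value at [x] stays 1 because c and the ball minimizer are at most 1. *)
have cG : competitor p Omega x (fun y' : 'rV[R]_n => Num.max (u y') (c * Wn y')) G.
  split; first exact: sG.
    move=> v Ov; rewrite u0// n0 ?mulr0 ?maxxx//.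
    by move=> /BO.
  rewrite ux; apply/max_idPl.
  have /andP[w0 w1] := wb (T x); have /andP[_ c1] := ub y0.
  by rewrite mulr_ile1// ltW.
have cH : competitor p B y0 (fun y' : 'rV[R]_n => c^-1 * Num.min (u y') (c * Wn y')) (fun y' : 'rV[R]_n => c^-1 *: H y').
  split; first exact: sobolevZ p1 sH.
    move=> v Bv; rewrite n0// mulr0.
    by have /andP[uv _] := ub v; rewrite (min_idPr uv) mulr0.
  by rewrite n1 mulr1 minxx mulVf// gt_eqF.
(* The maximum costs at least as much as [u], so the minimum costs at most as much as c W;
   uniqueness on the ball then forces min(u, c W) = c W. *)
have JG := umin _ _ cG; have JH := sum_le_cancel JGH JG.
have Jle : energy p (fun y' : 'rV[R]_n => c^-1 *: H y') <= energy p kn.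
  rewrite (energyZ c^-1 sH); rewrite (energyZ c sn) in JH.
  have cc : `|c^-1| `^ p * `|c| `^ p = 1.
    by rewrite -powRM// -normrM mulVf ?gt_eqF// normr1 powR1.
  have := ler_wpM2l (powR_ge0 `|c^-1| p) JH; rewrite mulrA cc mul1r.
  exact.
have := congr1 (fun f => f y) (minimizer_eq Bz Wmin cH Jle).
rewrite /= => E; rewrite -TE -[w (T y)]/(Wn y) -[X in c * X]E mulrA divff ?gt_eqF// mul1r.
by rewrite ge_min lexx.
Qed.

End strictness.

(** * Strict monotonicity in the inner radius *)

Section monotonicity.
Context {R : realType} {n : nat}.
Implicit Types (x y z a : 'rV[R]_n) (u v phi : 'rV[R]_n -> R)
  (g k : 'rV[R]_n -> 'rV[R]_n) (i : 'I_n).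
Variable p : R.
Hypothesis p2 : 2 <= p.
Hypothesis np : n%:R < p.

Let p1 : 1 <= p. Proof. by apply: le_trans p2; rewrite ler1n. Qed.
Let p0 : 0 < p. Proof. exact: lt_le_trans ltr01 p1. Qed.

Local Notation al := (1 - n%:R / p).
Local Notation q := (p - n%:R).
Implicit Types (Omega : set 'rV[R]_n) (M : 'M[R]_n).

Let al0 : 0 < al.
Proof. by rewrite subr_gt0 ltr_pdivrMr// mul1r. Qed.

Let q0 : 0 < q. Proof. by rewrite subr_gt0. Qed.

Variable i0 : 'I_n.

(** The weight gains the factor s^q and the energy s^-q, so their product is unchanged. *)
Lemma annulus_dilate (d r s : R) x u g : 0 < s -> competitor p (annulus d r) x u g ->
  exists v k, competitor p (annulus (s * d) (s * r)) (s *: x) v k /\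
    [/\ (enorm (s *: x) - s * d) `^ q * energy p k = (enorm x - d) `^ q * energy p g &
     forall y, v y = u (s^-1 *: y)].
Proof.
move=> s0 cu; have s'0 : 0 < s^-1 by rewrite invr_gt0.
have TE (y : 'rV[R]_n) : aff 0 (s^-1)%:M y = s^-1 *: y by rewrite /aff add0r mul_mx_scalar.
have Tx : aff 0 (s^-1)%:M (s *: x) = x by rewrite TE scalerA mulVf ?scale1r// gt_eqF.
have OO z : annulus d r (aff 0 (s^-1)%:M z) -> annulus (s * d) (s * r) z.
  rewrite TE /annulus/= enormZ gtr0_norm// => /andP[h1 h2].
  by rewrite -ltr_pdivlMl// h1 -ltr_pdivrMl.
have [k [ck Jk]] := competitor_aff p2 (similitude_scalar s'0) OO Tx cu.
exists (u \o aff 0 (s^-1)%:M), k; split; first exact: ck.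
split; last by move=> y; rewrite /= TE.
have /andP[dx _] := competitor_mem cu.
rewrite Jk enormZ gtr0_norm// -mulrBr powRM ?subr_ge0 ?(ltW dx) ?(ltW s0)//.
rewrite mulrACA -powRM ?(ltW s0) ?(ltW s'0)// divff ?gt_eqF// powR1 mul1r.
by [].
Qed.

Let shrink_factor (b m : R) : 0 <= b -> b < m -> exists2 e : R, 0 < e <= 2^-1 &
  b <= m * (1 - e) `^ p.
Proof.
move=> b0 bm; have m0 : 0 < m by exact: le_lt_trans bm.
pose s := (b / m) `^ p^-1.
have bm0 : 0 <= b / m by rewrite divr_ge0// ltW.
have sp : s `^ p = b / m by rewrite -powRrM mulVf ?gt_eqF// powRr1.
have s0 : 0 <= s := powR_ge0 _ _.
have s1 : s < 1.
  rewrite ltNge; apply/negP => h; have := le_powR (ltW p0) ler01 h.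
  by rewrite powR1 sp leNgt ltr_pdivrMr// mul1r bm.
exists ((1 - s) / 2); first by apply/andP; split; lra.
rewrite -ler_pdivrMl// mulrC -sp le_powR ?(ltW p0)//; lra.
Qed.

(* Truncation pushes the inner boundary outwards at a small cost. *)
Lemma annulus_shrink (d r m : R) x u g : 0 <= d -> competitor p (annulus d r) x u g ->
  (enorm x - d) `^ q * energy p g < m ->
  exists d' v k, [/\ d < d', d' < enorm x, competitor p (annulus d' r) x v k &
    (enorm x - d') `^ q * energy p k <= m].
Proof.
move=> d0 cu Jm; have [su u0 ux] := cu; have /andP[dx xr] := competitor_mem cu.
have J0 := energy_ge0 p g.
have [e /andP[e_gt0 e2] Je] := shrink_factor (mulr_ge0 (powR_ge0 _ _) J0) Jm.
have [C hC] := sobolev_holder p1 np su.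
have C1 : 0 < `|C| + 1 by rewrite ltr_wpDl.
(* The first term keeps the new inner radius below |x|; by Hoelder continuity the second makes u <=
   e in the layer of width [eta] that is cut off. *)
pose eta := Num.min ((enorm x - d) / 2) ((e / (`|C| + 1)) `^ al^-1).
have eC : 0 < e / (`|C| + 1) by rewrite divr_gt0.
have dx2 : 0 < (enorm x - d) / 2 by rewrite divr_gt0// subr_gt0.
have eta0 : 0 < eta by rewrite lt_min dx2 powR_gt0.
have etax : eta <= (enorm x - d) / 2 by rewrite ge_min lexx.
have etaC : eta `^ al <= e / (`|C| + 1).
  have h : eta <= (e / (`|C| + 1)) `^ al^-1 by rewrite ge_min lexx orbT.
  apply: (le_trans (le_powR (ltW al0) (ltW eta0) h)).
  by rewrite -powRrM mulVf ?gt_eqF// powRr1// ltW.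
have [k sk Jk] := sobolev_truncate p2 e su.
pose W y := Num.max (u y - e) 0.
have d'x : d + eta < enorm x.
  rewrite addrC -ltrBrDr; apply: le_lt_trans etax _.
  by rewrite ltr_pdivrMr// ltr_pMr ?subr_gt0// ltr1n.
have W0 y : ~ annulus (d + eta) r y -> W y = 0.
  move=> yA; apply/max_idPr; rewrite subr_le0.
  have [yr|yr] := leP r (enorm y).
    by rewrite u0 ?(ltW e_gt0)// => /andP[_]; rewrite ltNge yr.
  have [yd|yd] := leP (enorm y) d.
    by rewrite u0 ?(ltW e_gt0)// => /andP[]; rewrite ltNge yd.
  have yeta : enorm y <= d + eta.
    by rewrite leNgt; apply/negP => h; apply: yA; apply/andP.
  have y0 : 0 < enorm y by exact: le_lt_trans yd.
  (* The radial projection of [y] on the inner sphere, where [u] vanishes (the origin if d = 0). *)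
  pose y' := (d / enorm y) *: y.
  have y'E : enorm y' = d by rewrite enormZ ger0_norm ?divr_ge0 ?(ltW y0)// divfK// gt_eqF.
  have u'0 : u y' = 0 by apply: u0 => /andP[]; rewrite y'E ltxx.
  have yy' : enorm (y - y') = enorm y - d.
    rewrite /y' -{1}(scale1r y) -scalerBl enormZ ger0_norm.
      by rewrite mulrBl mul1r divfK// gt_eqF.
    by rewrite subr_ge0 ler_pdivrMr// mul1r ltW.
  have := hC y y'; rewrite u'0 subr0 => h; apply: (le_trans (ler_norm _)).
  apply: (le_trans h); apply: (@le_trans _ _ ((`|C| + 1) * eta `^ al)).
    have CC : C <= `|C| + 1 by rewrite (le_trans (ler_norm C))// lerDl.
    apply: (le_trans (ler_wpM2r (powR_ge0 _ _) CC)); rewrite ler_wpM2l ?(ltW C1)//.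
    by rewrite le_powR ?(ltW al0) ?enorm_ge0// yy' lerBlDl.
  by move: etaC; rewrite ler_pdivlMr// mulrC.
have We : W x = 1 - e.
  by rewrite /W ux; apply/max_idPl; rewrite subr_ge0 (le_trans e2)// invf_le1 ?ler1n.
have e1 : 0 < 1 - e by rewrite subr_gt0 (le_lt_trans e2)// invf_lt1 ?ltr1n.
have Wx0 : W x != 0 by rewrite We gt_eqF.
have [v [k' [cv Jv]]] := competitor_scale p2 sk W0 Wx0.
exists (d + eta), v, k'; split; [by rewrite ltrDl|exact: d'x|exact: cv|].
rewrite Jv -[Num.max _ _]/(W x) We gtr0_norm// powRN mulrCA.
rewrite ler_pdivrMl ?powR_gt0// [leRHS]mulrC.
apply: le_trans Je; apply: ler_pM; rewrite ?powR_ge0 ?energy_ge0//.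
by rewrite le_powR ?(ltW q0)// ?subr_ge0 ?(ltW d'x)// lerB// lerDl ltW.
Qed.

Lemma inner_bound_shrink (m d : R) x u g : 0 < d -> competitor p (annulus d 1) x u g ->
  (enorm x - d) `^ q * energy p g < m -> exists d', d < d' < 1 /\ @inner_bound R n p m d'.
Proof.
move=> d0 cu Jm; have [d' [v [k [dd' d'x cv Jv]]]] := annulus_shrink (ltW d0) cu Jm.
have /andP[_ x1] := competitor_mem cu.
exists d'; split; first by rewrite dd' (lt_trans d'x).
by exists x, v, k.
Qed.

Let annulus_mem (ex ey t s L d' D : R) : ex <= t -> t <= s -> L <= ex - d' -> L <= 1 - s ->
  D < L -> t - ey <= D -> ey - t <= D -> d' < ey < 1.
Proof. by move=> *; apply/andP; split; lra. Qed.

Let step_past_sup (T t z l : R) : T - l / 4 < t -> 0 < l -> l / 2 <= z -> t + z <= T -> False.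
Proof. by move=> *; lra. Qed.

Let enorm_unit (t : R) y : enorm y = 1 -> 0 <= t -> enorm (t *: y) = t.
Proof. by move=> y1 t0; rewrite enormZ y1 mulr1 ger0_norm. Qed.

(** A march along the ray through [x]: if u > 0 at radius t, comparison with a ball minimizer
    centred there gives u > 0 at radius t + rho L with rho >= 1/2. If [u] vanished beyond s < 1, the
    same ball radius [L] would fit at every step, and the radii would pass their supremum. *)
Lemma minimizer_support (d' s : R) x u g : 0 < d' -> s < 1 ->
  minimizer p (annulus d' 1) x u g -> ~ (forall y, ~ annulus d' s y -> u y = 0).
Proof.
move=> d'0 s1 mu_ us; have [[_ _ ux] _] := mu_.
have A0 := @annulus0 R n d' 1 (ltW d'0).
have /andP[xd xs] : d' < enorm x < s.
  by apply: contrapT => /us; rewrite ux => /eqP; rewrite oner_eq0.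
have [w [h mw]] := ball_minimizer_ex p2 np i0.
have [rho rho2 wrho] := ball_minimizer_gt0 p2 np i0 mw.
have [e e1 xe] := unit_direction i0 x.
pose L := Num.min (enorm x - d') (1 - s).
have L0 : 0 < L by rewrite lt_min !subr_gt0 xd s1.
have L1 : L <= enorm x - d' by rewrite ge_min lexx.
have L2 : L <= 1 - s by rewrite ge_min lexx orbT.
pose S := [set t : R | enorm x <= t /\ 0 < u (t *: e)].
have ux_gt0 : 0 < u x by rewrite ux ltr01.
have Sx : S (enorm x).
  by split; [exact: lexx|exact: (eq_ind _ (fun y : 'rV[R]_n => 0 < u y) ux_gt0 _ xe)].
have enormt (t : R) : enorm x <= t -> enorm (t *: e) = t.
  by move=> xt; exact: enorm_unit e1 (le_trans (enorm_ge0 x) xt).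
have Ss t : S t -> t < s.
  move=> [xt ut]; rewrite ltNge; apply/negP => st; move: ut.
  have /us -> : ~ annulus d' s (t *: e); last by rewrite ltxx.
  by rewrite /annulus/= (enormt _ xt) => /andP[_]; rewrite ltNge st.
have hS : has_sup S by split; [exists (enorm x)|exists s => t /Ss /ltW].
have step t : S t -> S (t + rho * L).
  move=> St; have ts := Ss t St; have [xt ut] := St.
  have rL : 0 <= rho * L by rewrite mulr_ge0 ?(ltW L0)// (le_trans _ rho2)// invr_ge0.
  split; first by rewrite (le_trans xt)// lerDl.
  have BO : [set y | enorm (y - t *: e) < L] `<=` @annulus R n d' 1.
    move=> y /= yL; have h1 := enorm_subl (t *: e) y; rewrite enormB enormt// in h1.
    have h2 := enorm_subl y (t *: e); rewrite enormt// in h2.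
    exact: annulus_mem xt (ltW ts) L1 L2 yL h1 h2.
  have := minimizer_comparison p2 np i0 A0 mu_ mw L0 BO ut ((t + rho * L) *: e).
  apply: lt_le_trans; apply: mulr_gt0 => //; apply: wrho.
  rewrite -scalerBl addrC addKr enormZ enormZ e1 mulr1 gtr0_norm ?invr_gt0//.
  by rewrite ger0_norm// mulrC mulfK// gt_eqF.
(* Starting within L/4 of the supremum, a step of length at least L/2 overshoots it. *)
have L4 : 0 < L / 4 by rewrite divr_gt0.
have [t St tT] := sup_adherent L4 hS.
have := ub_le_sup hS.2 (step t St).
have : L / 2 <= rho * L by rewrite mulrC ler_pM2r.
by move=> h3 h4; exact: step_past_sup tT L0 h3 h4.
Qed.

(* A dilated optimal function vanishes near the outer boundary, so by the strong
   maximum principle it is not a minimizer on the larger annulus. *)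
Lemma inner_bound_strict (m d d' : R) : 0 < d' -> d' < d -> @inner_bound R n p m d ->
  exists2 m', m' < m & @inner_bound R n p m' d'.
Proof.
move=> d'0 d'd [x0 [u0 [g0 [cu0 Jm]]]].
have d0 : 0 < d by exact: lt_trans d'd.
pose s := d' / d; have s0 : 0 < s by rewrite divr_gt0.
have s1 : s < 1 by rewrite ltr_pdivrMr// mul1r.
have sd : s * d = d' by rewrite divfK// gt_eqF.
have [u [g [cu' [Jg uE]]]] := annulus_dilate s0 cu0.
rewrite sd mulr1 in cu' Jg; set x := s *: x0 in cu' Jg.
have cu := competitor_sub (annulus_sub (lexx d') (ltW s1)) cu'.
have A0 := @annulus0 R n d' 1 (ltW d'0).
have [v [k [cv vmin]]] := minimizer_ex p2 np A0 cu.
have /andP[xd xs] := competitor_mem cu'.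
have xd0 : 0 < enorm x - d' by rewrite subr_gt0.
have xdq : 0 < (enorm x - d') `^ q by exact: powR_gt0.
(* Either the true minimizer is strictly better and provides m', or the dilated function is itself a
   minimizer, although it vanishes beyond radius s < 1. *)
have [Jlt|Jle] := ltP (energy p k) (energy p g).
  exists ((enorm x - d') `^ q * energy p k); last first.
    by exists x, v, k; exact: conj cv (lexx _).
  have Jm' := eq_ind _ (fun J : R => J <= m) Jm _ (esym Jg).
  by move: Jlt; rewrite -(ltr_pM2l xdq) => h; exact: lt_le_trans h Jm'.
exfalso; have [_ us _] := cu'.
have mu_ : minimizer p (annulus d' 1) x u g.
  split; first exact: cu.
  by move=> v' k' cv'; exact: le_trans Jle (vmin _ _ cv').
exact: minimizer_support d'0 s1 mu_ us.
Qed.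

End monotonicity.

(** * From [lambda_p] to [inner_bound], and the theorem *)

Section conclusion.
Context {R : realType} {n : nat}.
Implicit Types (x y z a : 'rV[R]_n) (u v phi : 'rV[R]_n -> R)
  (g k : 'rV[R]_n -> 'rV[R]_n) (i : 'I_n).
Variable p : R.
Hypothesis p2 : 2 <= p.
Hypothesis np : n%:R < p.

Let p1 : 1 <= p. Proof. by apply: le_trans p2; rewrite ler1n. Qed.

Local Notation q := (p - n%:R).
Local Notation ev i := (delta_mx (@ord0 0) i : 'rV[R]_n).
Implicit Types (Omega : set 'rV[R]_n) (M : 'M[R]_n).

Let q0 : 0 < q. Proof. by rewrite subr_gt0. Qed.

Variable i0 : 'I_n.
Hypothesis i0n : i0.+1 = n.
Local Notation e0 := (ev i0).
Local Notation kappa := (half_energy (R := R) (n := n) p).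

Local Notation inner_bound := (@inner_bound R n p).

Lemma bump_ex x0 (L : R) : 0 < L -> exists v k,
  [/\ competitor p [set y | enorm (y - x0) < L] x0 v k & forall y, 0 <= v y].
Proof.
move=> L0; have [phi [g [sphi phi0 phige phi1]]] := @sobolev_bump R n p p1.
have L'0 : 0 < L^-1 by rewrite invr_gt0.
have c1 : competitor p [set y | enorm y < 1] 0 phi g.
  by split => // y /negP; rewrite -leNgt; exact: phi1.
have TE y : aff (- (L^-1 *: x0)) (L^-1)%:M y = L^-1 *: (y - x0).
  by rewrite /aff mul_mx_scalar addrC scalerBr.
have OO y : [set y : 'rV[R]_n | enorm y < 1] (aff (- (L^-1 *: x0)) (L^-1)%:M y) ->
    [set y | enorm (y - x0) < L] y.
  rewrite TE /= enormZ gtr0_norm// => hy.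
  by rewrite -(ltr_pM2l L'0) mulVf// gt_eqF.
have T0 : aff (- (L^-1 *: x0)) (L^-1)%:M x0 = 0 by rewrite TE subrr scaler0.
have [k [ck _]] := competitor_aff p2 (similitude_scalar L'0) OO T0 c1.
by exists (phi \o aff (- (L^-1 *: x0)) (L^-1)%:M), k; split; [exact: ck|move=> y; exact: phige].
Qed.

(* Bumps of large radius have small energy since [p > n]. *)
Lemma wide_bump_ex x0 (e : R) : 0 < e -> exists L v k, [/\ 0 < L,
  competitor p [set y | enorm (y - x0) < L] x0 v k, forall y, 0 <= v y & energy p k <= e].
Proof.
move=> e_gt0; have [v0 [k0 [c0 v0ge]]] := bump_ex x0 ltr01.
have J0 := energy_ge0 p k0.
(* Dilation by L divides the energy by L^q; the added 1 keeps L positive when the energy is 0. *)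
pose L := (energy p k0 / e + 1) `^ q^-1.
have Je : 0 < energy p k0 / e + 1 by rewrite ltr_wpDl// divr_ge0// ltW.
have L0 : 0 < L by rewrite powR_gt0.
have Lq : L `^ q = energy p k0 / e + 1 by rewrite -powRrM mulVf ?gt_eqF// powRr1 ?(ltW Je).
have L'0 : 0 < L^-1 by rewrite invr_gt0.
pose a := x0 - L^-1 *: x0.
have TE y : aff a (L^-1)%:M y - x0 = L^-1 *: (y - x0).
  by rewrite /aff /a mul_mx_scalar; apply/rowP => j; rewrite !mxE; ring.
have OO y : [set y | enorm (y - x0) < 1] (aff a (L^-1)%:M y) -> [set y | enorm (y - x0) < L] y.
  rewrite /= TE enormZ gtr0_norm// => hy.
  by rewrite -(ltr_pM2l L'0) mulVf// gt_eqF.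
have T0 : aff a (L^-1)%:M x0 = x0.
  by apply/eqP; rewrite -subr_eq0 TE subrr scaler0.
have [k [ck Jk]] := competitor_aff p2 (similitude_scalar L'0) OO T0 c0.
exists L, (v0 \o aff a (L^-1)%:M), k; split; [exact: L0|exact: ck|by move=> y; exact: v0ge|].
have LL : L `^ q * L^-1 `^ q = 1 by rewrite -powRM ?(ltW L0) ?(ltW L'0)// divff ?gt_eqF// powR1.
have Lq0 : 0 < L `^ q by rewrite powR_gt0.
rewrite Jk -(ler_pM2l Lq0) mulrA LL mul1r Lq mulrDl mul1r divfK ?gt_eqF//.
by rewrite lerDl ltW.
Qed.

Let mid_arith (X J1 m e : R) : 0 < X -> e = (m - X * J1) / (2 * X) -> X * J1 < m ->
  X * (J1 + e) < m.
Proof.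
move=> X0 -> h; rewrite mulrDr (_ : X * ((m - X * J1) / (2 * X)) = (m - X * J1) / 2).
  lra.
by field; rewrite gt_eqF.
Qed.

(** A competitor on the punctured space is cut off by taking the minimum with a very wide bump,
    whose energy is negligible. On the punctured ball so obtained, [annulus_shrink] pushes the inner
    radius away from 0, and a dilation brings the outer radius to 1. *)
Lemma inner_bound_ex (m : R) : lambda_p p (~` [set (0 : 'rV[R]_n)]) < m ->
  exists2 d : R, 0 < d < 1 & inner_bound m d.
Proof.
pose Om : set 'rV[R]_n := ~` [set 0].
have O0 : ~ Om 0 by move=> h; apply: h.
have dist x : enorm x <= bdry_dist Om x.
  apply: (bdry_dist_ge O0) => y /contrapT ->; by rewrite subr0.
have nz x : Om x -> 0 < enorm x by move=> x0; apply: enorm_gt0; apply/eqP.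
move=> lm; have [x [u [g [Ox cu Jm]]]] : exists x u g, [/\ Om x, competitor p Om x u g &
    bdry_dist Om x `^ q * energy p g < m].
  apply: (lambda_lt_competitor p2 np O0 _ _ lm).
    by move=> x Ox; exact: lt_le_trans (nz x Ox) (dist x).
  have [v [k [cv _]]] := bump_ex e0 ltr01.
  exists e0, v, k; apply: competitor_sub cv => y /= y1 y0; move: y1.
  by rewrite y0 sub0r enormN enorm_delta ltxx.
have x0 := nz x Ox; have xq : 0 < enorm x `^ q by rewrite powR_gt0.
have {}Jm : enorm x `^ q * energy p g < m.
  apply: le_lt_trans Jm; rewrite ler_wpM2r ?energy_ge0//.
  by rewrite le_powR ?(ltW q0)// ltW.
have [su u0 ux] := cu.
(* Passing to the positive part makes the minimum with a nonnegative bump vanish wherever either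
   function does. *)
have [g1 s1 J1] := sobolev_truncate p2 0 su.
pose u1 y := Num.max (u y - 0) 0.
have u1x : u1 x = 1 by rewrite /u1 ux subr0; apply/max_idPl; exact: ler01.
have u1ge y : 0 <= u1 y by rewrite le_max lexx orbT.
have u10 : u1 0 = 0 by rewrite /u1 u0// subr0 maxxx.
have Jm1 : enorm x `^ q * energy p g1 < m.
  by apply: le_lt_trans Jm; rewrite ler_wpM2l// ltW.
(* Half of the available slack, divided by the weight at [x]. *)
pose e := (m - enorm x `^ q * energy p g1) / (2 * enorm x `^ q).
have e_gt0 : 0 < e by rewrite divr_gt0 ?subr_gt0// mulr_gt0.
have [L [phi [k [L0 ck phige Jk]]]] := wide_bump_ex x e_gt0.
have [sk k0 kx] := ck.
have [G [H [_ sH JGH]]] := sobolev_max_min p1 p2 s1 sk.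
pose r := L + enorm x.
have cH : competitor p (annulus 0 r) x (fun y => Num.min (u1 y) (phi y)) H.
  split; [exact: sH| |by rewrite u1x kx minxx].
  move=> y yA; have [->|y0] := eqVneq y 0.
    by rewrite u10; apply/min_idPl; exact: phige.
  rewrite k0; first by apply/min_idPr; exact: u1ge.
  move=> /= yL; apply: yA; rewrite /annulus/= enorm_gt0//= /r.
  by rewrite -(subrK x y) (le_lt_trans (enormD _ _))// ltrD2r.
have JH : (enorm x - 0) `^ q * energy p H < m.
  rewrite subr0; apply: le_lt_trans (mid_arith xq erefl Jm1).
  rewrite ler_wpM2l ?(ltW xq)//; apply: (@le_trans _ _ (energy p g1 + energy p k)).
    by apply: le_trans JGH; rewrite lerDr energy_ge0.
  by rewrite lerD2l.
have [d [v [k' [d0 dx cv Jv]]]] := annulus_shrink p2 np (lexx 0) cH JH.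
have r0 : 0 < r by rewrite addr_gt0.
have r'0 : 0 < r^-1 by rewrite invr_gt0.
have [v' [k'' [cv' [Jv' _]]]] := annulus_dilate p2 r'0 cv.
rewrite (mulVf (lt0r_neq0 r0)) in cv'.
exists (r^-1 * d); last by exists (r^-1 *: x), v', k''; split; [exact: cv'|rewrite Jv'].
have dr : d < r by apply: (lt_trans dx); rewrite /r ltrDr.
apply/andP; split; first exact: mulr_gt0.
by rewrite (ltr_pdivrMl _ _ r0) mulr1; exact: dr.
Qed.

(** * The value of [lambda_p] on an annulus *)

Section annulus_lambda.
Variable d : R.
Hypothesis d0 : 0 < d.
Hypothesis d1 : d < 1.
Local Notation A := (@annulus R n d 1).

Let A0 : ~ A 0 := @annulus0 R n d 1 (ltW d0).

Lemma annulus_bdry_dist_ge x : Num.min (enorm x - d) (1 - enorm x) <= bdry_dist A x.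
Proof.
apply: (bdry_dist_ge A0) => y yA; rewrite ge_min.
have [yd|yd] := leP (enorm y) d.
  by rewrite (le_trans _ (enorm_subl x y))// lerB.
have [y1|y1] := leP 1 (enorm y).
  apply/orP; right; rewrite enormB; apply: le_trans (enorm_subl y x).
  by rewrite lerD2r.
by exfalso; apply: yA; apply/andP.
Qed.

Lemma annulus_bdry_dist_le x : A x -> bdry_dist A x <= enorm x - d.
Proof.
move=> /andP[dx x1]; have x0 : 0 < enorm x by exact: lt_trans dx.
pose y := (d / enorm x) *: x.
have yE : enorm y = d by rewrite enormZ gtr0_norm ?divr_gt0// divfK// gt_eqF.
have yA : ~ A y by move=> /andP[]; rewrite yE ltxx.
apply: (le_trans (bdry_dist_le x yA)).
rewrite /y -{1}(scale1r x) -scalerBl enormZ ger0_norm.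
  by rewrite mulrBl mul1r divfK// gt_eqF.
by rewrite subr_ge0 ler_pdivrMr// mul1r ltW.
Qed.

Lemma annulus_bdry_dist_gt0 x : A x -> 0 < bdry_dist A x.
Proof.
move=> /andP[dx x1]; apply: lt_le_trans (annulus_bdry_dist_ge x).
by rewrite lt_min !subr_gt0 dx x1.
Qed.

Lemma lambda_annulus_le (m : R) : inner_bound m d -> lambda_p p A <= m.
Proof.
move=> [x [u [g [cu Jm]]]]; have Ax := competitor_mem cu.
apply: (le_trans (lambda_le_competitor p2 np A0 Ax (annulus_bdry_dist_gt0 Ax) cu)).
apply: le_trans Jm; rewrite ler_wpM2r ?energy_ge0//.
by rewrite le_powR ?(ltW q0) ?bdry_dist_ge0// annulus_bdry_dist_le.
Qed.

Let annulus_mid (a b c : R) : b < (1 - c) / 2 -> (1 + c) / 2 - a <= b ->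
  a - (1 + c) / 2 <= b -> c < a < 1.
Proof. by move=> *; apply/andP; split; lra. Qed.

Lemma lambda_annulus_lt (m : R) : lambda_p p A < m -> m <= kappa ->
  exists2 m', m' < m & inner_bound m' d.
Proof.
move=> lm mk.
have [x [u [g [Ax cu Jm]]]] : exists x u g, [/\ A x, competitor p A x u g &
    bdry_dist A x `^ q * energy p g < m].
  apply: (lambda_lt_competitor p2 np A0 annulus_bdry_dist_gt0 _ lm).
  have L0 : 0 < (1 - d) / 2 by rewrite divr_gt0// subr_gt0.
  have [v [k [cv _]]] := bump_ex (((1 + d) / 2) *: e0) L0.
  exists (((1 + d) / 2) *: e0), v, k; apply: competitor_sub cv => y /= yL.
  have cE : enorm (((1 + d) / 2) *: e0) = (1 + d) / 2.
    by rewrite enormZ enorm_delta mulr1 gtr0_norm// divr_gt0// addr_gt0.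
  have h1 := enorm_subl (((1 + d) / 2) *: e0) y; rewrite enormB cE in h1.
  have h2 := enorm_subl y (((1 + d) / 2) *: e0); rewrite cE in h2.
  exact: annulus_mid yL h1 h2.
have /andP[dx x1] := Ax; have J0 := energy_ge0 p g.
exists (bdry_dist A x `^ q * energy p g); first exact: Jm.
exists x, u, g; split; first exact: cu.
rewrite ler_wpM2r// le_powR ?(ltW q0)// ?subr_ge0 ?(ltW dx)//.
apply: le_trans (annulus_bdry_dist_ge x); rewrite le_min lexx /=.
(* If the outer sphere were the nearer one, [ball_energy_ge] would put the product at or above
   [half_energy]. *)
rewrite leNgt; apply/negP => lt1.
have inb y : A y -> enorm y < 1 by case/andP.
have := ball_energy_ge p2 np i0n inb x1 cu; rewrite leNgt => /negP; apply.
apply: lt_le_trans mk; apply: le_lt_trans Jm; rewrite ler_wpM2r//.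
rewrite le_powR ?(ltW q0)// ?subr_ge0 ?(ltW x1)//.
by apply: le_trans (annulus_bdry_dist_ge x); rewrite le_min lexx (ltW lt1).
Qed.

(** Attainment: closedness is applied with a constant inner radius and levels decreasing to m. The
    levels start at [half_energy] itself, since [lambda_annulus_lt] holds only up to it. *)
Lemma lambda_annulus_eq (m : R) : m = lambda_p p A -> m < kappa ->
  inner_bound m d.
Proof.
move=> mE; set k0 := kappa => mk.
have km : 0 < k0 - m by rewrite subr_gt0.
pose ms (k : nat) := m + (k0 - m) * k.+1%:R^-1.
have msm : ms @ \oo --> m.
  rewrite -[X in _ --> X]addr0; apply: cvgD; first exact: cvg_cst.
  by rewrite -(mulr0 (k0 - m)); apply: cvgMl_tmp; exact: cvg_harmonic.
have P (k : nat) : inner_bound (ms k) d.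
  have e_gt0 : 0 < (k.+1%:R : R)^-1 by rewrite invr_gt0.
  have lt1 : lambda_p p A < ms k by rewrite -mE ltrDl mulr_gt0.
  have le1 : ms k <= k0.
    by rewrite -lerBrDl ler_piMr ?(ltW km)// invf_le1 ?ltr0n// ler1n.
  have [m' m'lt [x [u [g [cu Jm]]]]] := lambda_annulus_lt lt1 le1.
  by exists x, u, g; split; [exact: cu|exact: le_trans Jm (ltW m'lt)].
have [_ Pm] := @inner_bound_closed R n p p2 np i0 i0n (fun=> d) ms d m
  (fun (k l : nat) _ => lexx d) d0 (cvg_cst d) msm mk P.
exact: Pm.
Qed.

End annulus_lambda.

Lemma lambda_annulus_inj (m a b : R) : 0 < a -> a < b -> b < 1 ->
  m < kappa ->
  m = lambda_p p (@annulus R n a 1) -> m = lambda_p p (@annulus R n b 1) -> False.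
Proof.
move=> a0 ab b1 mk ma mb.
have Pb := lambda_annulus_eq (lt_trans a0 ab) b1 mb mk.
have [m' m'm Pa] := inner_bound_strict p2 np i0 a0 ab Pb.
have := lambda_annulus_le a0 Pa.
by rewrite -ma leNgt m'm.
Qed.

End conclusion.

Theorem theorem10p1 (R : realType) (n : nat) (p lambda : R) :
  (2 <= n)%N -> n%:R < p ->
  lambda_p p (~` [set (0 : 'rV[R]_n)]) < lambda ->
  lambda < lambda_p p (@half_space R n) ->
  exists! delta : R,
    (0 < delta < 1) /\ lambda = lambda_p p (@annulus R n delta 1).
Proof.
move=> n2 np l0 lk.
(* The bound on the dimension puts p in the range of Clarkson's inequality as proved above. *)
have p2 : 2 <= p by apply: le_trans (ltW np); rewrite ler_nat.
have n1 : (n.-1 < n)%N by rewrite prednK// ltnW.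
pose i0 := Ordinal n1; have i0n : i0.+1 = n by rewrite /= prednK// ltnW.
pose S := [set d : R | 0 < d < 1 /\ @inner_bound R n p lambda d].
have [dS dS01 PdS] := inner_bound_ex p2 np i0 l0.
have S1 : ubound S 1 by move=> d [/andP[_ /ltW]].
have hS : has_sup S by split; [exists dS|exists 1].
pose ds := sup S.
have ds0 : 0 < ds.
  by have /andP[h _] := dS01; apply: (lt_le_trans h); apply: (ub_le_sup hS.2).
have ds1 : ds <= 1 by apply: ge_sup; [exact: hS.1|exact: S1].
(* Every smaller positive radius is good, by [inner_bound_strict] from a good radius near the
   supremum. *)
have down (d : R) : 0 < d -> d < ds -> @inner_bound R n p lambda d.
  move=> d0 dds; have e0 : 0 < ds - d by rewrite subr_gt0.
  have [s [_ Ps]] := sup_adherent e0 hS; rewrite subKr => d_s.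
  have [m' m'l [x [u [g [cu Jm]]]]] := inner_bound_strict p2 np i0 d0 d_s Ps.
  by exists x, u, g; split; [exact: cu|exact: le_trans Jm (ltW m'l)].
(* An increasing sequence strictly below the supremum; k + 2 instead of k + 1 makes its first term
   positive, as closedness requires. *)
pose d_ (k : nat) : R := ds * (1 - k.+2%:R^-1).
have k2 (k : nat) : 0 < (k.+2%:R : R)^-1 < 1.
  by rewrite invr_gt0 ltr0n/= invf_lt1 ?ltr0n// ltr1n.
have d_gt0 (k : nat) : 0 < d_ k.
  by have /andP[_ h] := k2 k; rewrite mulr_gt0// subr_gt0.
have d_lt (k : nat) : d_ k < ds.
  by have /andP[h _] := k2 k; rewrite gtr_pMr// gtrBl.
have d_nd (k l : nat) : (k <= l)%N -> d_ k <= d_ l.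
  by move=> kl; rewrite ler_pM2l// lerB// lef_pV2 ?posrE ?ltr0n// ler_nat.
have d_cvg : d_ @ \oo --> ds.
  rewrite -[X in _ --> X]mulr1; apply: cvgMl_tmp.
  rewrite -[X in _ --> X]subr0; apply: cvgB; first exact: cvg_cst.
  by have := @cvg_harmonic R; rewrite -(cvg_shiftS (fun k : nat => k.+1%:R^-1 : R)).
have [ds_lt1 Pds] := inner_bound_closed p2 np i0n d_nd (d_gt0 0%N) d_cvg (cvg_cst lambda) lk
  (fun k : nat => down _ (d_gt0 k) (d_lt k)).
have lE : lambda = lambda_p p (@annulus R n ds 1).
  apply/eqP; rewrite eq_le (lambda_annulus_le p2 np ds0 Pds) andbT leNgt.
  apply/negP => lt1.
  (* A strict inequality leaves room for [inner_bound_shrink] to produce a good radius beyond the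
     supremum. *)
  have [m' m'l [x [u [g [cu Jm]]]]] := lambda_annulus_lt p2 np i0n ds0 ds_lt1 lt1 (ltW lk).
  have [d [/andP[dds d1] Pd]] := inner_bound_shrink p2 np ds0 cu (le_lt_trans Jm m'l).
  have : d <= ds by apply: (ub_le_sup hS.2); split; [rewrite (lt_trans ds0)|].
  by rewrite leNgt dds.
exists ds; split; first by rewrite ds0 ds_lt1.
move=> d [/andP[d0 d1] dE]; have [lt1|lt1|//] := ltgtP ds d.
  by exfalso; exact: (lambda_annulus_inj p2 np i0n ds0 lt1 d1 lk lE dE).
by exfalso; exact: (lambda_annulus_inj p2 np i0n d0 lt1 ds_lt1 lk dE lE).
Qed.
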